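(* The group $\Gamma_1$ is generated by the classes of $$a=\begin{pmatrix}-i&0&-1\\i-1&-1&i+1\\i-1&i-1&1\end{pmatrix},\qquad b=\begin{pmatrix}-1&0&i\\i+1&1&-i+1\\1&-i+1&-i-1\end{pmatrix},$$ and has a presentation with generators $a,b$ and defining relations $$a^8=b^{12}=r^4=s^2=t^2=u^4=v^2=w^2=1,\quad \mathrm{br}_2(r,s),\ \mathrm{br}_4(t,u),\ \mathrm{br}_3(v,w),\ \mathrm{br}_2(a^2,ba^2b^{-1}),$$ where $r=a^{-2}b^{-3}a^2$, $s=aba^{-2}ba^2b^{-1}$, $t=a^{-1}b^2a^2b^{-1}$, $u=a^2$, $v=aba^{-2}ba^2b^{-1}$, $w=aba^{-2}b^{-2}$.
   Context: $J=\begin{pmatrix}0&0&1\\0&1&0\\1&0&0\end{pmatrix}$, $U(J)=\{A\in GL_3(\mathbb{C}):A^*JA=J\}$, and $\Gamma_1=PU(J,\mathbb{Z}[i])$ is the image in $PU(J)$ of $U(J)\cap GL_3(\mathbb{Z}[i])$. $\mathrm{br}_n(x,y)$ denotes the braid relation of length $n$: $xyx\cdots=yxy\cdots$ with $n$ factors on each side. *)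

(* Defs.v *)
From HB Require Import structures.
From mathcomp Require Import all_boot all_order all_algebra.
From mathcomp Require Import all_classical reals complex ring.

Set Implicit Arguments.
Unset Strict Implicit.
Unset Printing Implicit Defensive.

Import Order.TTheory GRing.Theory Num.Theory.

Local Open Scope group_scope.
Local Open Scope quotient_scope.

(* The quotient of a *-monoid by a congruence that turns the involution into
   an inverse.  It is used twice: for words modulo relations, and for a group
   of matrices modulo scalars. *)

Record group_congruence (M : starMonoidType) := GroupCongruence {
  cong_rel :> equiv_rel M;
  congM : forall x x' y y',
    cong_rel x x' -> cong_rel y y' -> cong_rel (x * y) (x' * y');
  congV : forall x x', cong_rel x x' -> cong_rel x^-1 x'^-1;
  congVg : forall x, cong_rel (x^-1 * x) 1;
}.

Definition quotg (M : starMonoidType) (e : group_congruence M) : Type :=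
  {eq_quot e}.

HB.instance Definition _ M (e : group_congruence M) := Choice.on (quotg e).
HB.instance Definition _ M (e : group_congruence M) :=
  EqQuotient.on (quotg e).

Section QuotientGroup.
Variables (M : starMonoidType) (e : group_congruence M).
Implicit Types x y : M.

Definition quotg_pi (x : M) : quotg e := \pi_(quotg e) x.

Lemma quotg_piP x y : quotg_pi x = quotg_pi y <-> e x y.
Proof. by split=> [/(@eqmodP _ e)|?]; [|exact/(@eqmodP _ e)]. Qed.

Lemma quotg_piK u : quotg_pi (repr u) = u.
Proof. exact: reprK. Qed.

Lemma cong_repr x : e (repr (quotg_pi x)) x.
Proof. by apply/quotg_piP; rewrite quotg_piK. Qed.

Definition quotg_one : quotg e := quotg_pi 1.
Definition quotg_mul (u v : quotg e) : quotg e := quotg_pi (repr u * repr v).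
Definition quotg_inv (u : quotg e) : quotg e := quotg_pi (repr u)^-1.

Lemma quotg_piM x y : quotg_pi (x * y) = quotg_mul (quotg_pi x) (quotg_pi y).
Proof.
by apply/quotg_piP; rewrite equiv_sym; apply: congM; apply: cong_repr.
Qed.

Lemma quotg_piV x : quotg_pi x^-1 = quotg_inv (quotg_pi x).
Proof.
by apply/quotg_piP; rewrite equiv_sym; apply: congV; apply: cong_repr.
Qed.

Lemma quotg_mulA : associative quotg_mul.
Proof.
move=> u v w; rewrite -(quotg_piK u) -(quotg_piK v) -(quotg_piK w).
by rewrite -!quotg_piM mulgA.
Qed.

Lemma quotg_mul1 : left_id quotg_one quotg_mul.
Proof. by move=> u; rewrite -(quotg_piK u) -quotg_piM mul1g. Qed.

Lemma quotg_mulr1 : right_id quotg_one quotg_mul.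
Proof. by move=> u; rewrite -(quotg_piK u) -quotg_piM mulg1. Qed.

Lemma quotg_mulV : left_inverse quotg_one quotg_inv quotg_mul.
Proof.
move=> u; rewrite -(quotg_piK u) -quotg_piV -quotg_piM.
by apply/quotg_piP; apply: congVg.
Qed.

Lemma quotg_mulrV : right_inverse quotg_one quotg_inv quotg_mul.
Proof.
move=> u; rewrite -(quotg_piK u) -quotg_piV -quotg_piM.
by apply/quotg_piP; rewrite -{1}(invgK (repr u)); apply: congVg.
Qed.

HB.instance Definition _ := isGroup.Build (quotg e)
  quotg_mulA quotg_mul1 quotg_mulr1 quotg_mulV quotg_mulrV.

HB.instance Definition _ := isMultiplicative.Build M (quotg e)
  quotg_pi quotg_piM.

End QuotientGroup.

(* The letter (i, false) stands for the generator x_i and (i, true) for its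
   formal inverse; words are not required to be reduced. *)
Definition word (n : nat) : Type := seq ('I_n * bool).

HB.instance Definition _ n := Choice.on (word n).

Section Words.
Variable n : nat.
Implicit Types v w : word n.

Definition letter (i : 'I_n) : word n := [:: (i, false)].

Definition word_inv w : word n := rev [seq (x.1, ~~ x.2) | x <- w].

Lemma word_invK : involutive word_inv.
Proof.
move=> w; rewrite /word_inv map_rev revK -map_comp -[RHS]map_id.
by apply: eq_map => -[i s] /=; rewrite negbK.
Qed.

Lemma word_invM v w : word_inv (v ++ w) = word_inv w ++ word_inv v.
Proof. by rewrite /word_inv map_cat rev_cat. Qed.

HB.instance Definition _ := isStarMonoid.Build (word n)
  (@catA _) (@cat0s _) word_invK word_invM.

(* The least congruence on words containing the free cancellations and the
   relations v = w for (v, w) in rels. *)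
Inductive rel_eq (rels : seq (word n * word n)) : word n -> word n -> Prop :=
  | rel_eq_rel v w : (v, w) \in rels -> rel_eq rels v w
  | rel_eq_cancel w : rel_eq rels (w^-1 * w) 1
  | rel_eq_mul v v' w w' :
      rel_eq rels v v' -> rel_eq rels w w' -> rel_eq rels (v * w) (v' * w')
  | rel_eq_refl w : rel_eq rels w w
  | rel_eq_sym v w : rel_eq rels v w -> rel_eq rels w v
  | rel_eq_trans u v w : rel_eq rels u v -> rel_eq rels v w -> rel_eq rels u w.

Variable rels : seq (word n * word n).

Definition rel_eqb : rel (word n) := fun v w => `[< rel_eq rels v w >].

Lemma rel_eqb_refl : reflexive rel_eqb.
Proof. by move=> w; apply/asboolP; apply: rel_eq_refl. Qed.

Lemma rel_eqb_sym : symmetric rel_eqb.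
Proof. by move=> v w; apply/asboolP/asboolP; apply: rel_eq_sym. Qed.

Lemma rel_eqb_trans : transitive rel_eqb.
Proof.
by move=> v u w /asboolP uv /asboolP vw; apply/asboolP/(rel_eq_trans uv).
Qed.

Definition rel_equiv : equiv_rel (word n) :=
  EquivRel rel_eqb rel_eqb_refl rel_eqb_sym rel_eqb_trans.

Lemma rel_equivM v v' w w' :
  rel_equiv v v' -> rel_equiv w w' -> rel_equiv (v * w) (v' * w').
Proof. by move=> /asboolP ? /asboolP ?; apply/asboolP/rel_eq_mul. Qed.

Lemma rel_equivVg w : rel_equiv (w^-1 * w) 1.
Proof. by apply/asboolP; apply: rel_eq_cancel. Qed.

Lemma rel_equivV v w : rel_equiv v w -> rel_equiv v^-1 w^-1.
Proof.
move=> vw; apply: (@equiv_trans _ _ (v^-1 * (w * w^-1))).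
  rewrite -{1}[v^-1]mulg1; apply: rel_equivM; first exact: equiv_refl.
  by rewrite equiv_sym -{1}(invgK w); apply: rel_equivVg.
rewrite mulgA -{2}[w^-1]mul1g.
apply: rel_equivM; last exact: equiv_refl.
apply: (@equiv_trans _ _ (v^-1 * v)); last exact: rel_equivVg.
by apply: rel_equivM; [exact: equiv_refl | rewrite equiv_sym].
Qed.

Definition rel_cong : group_congruence (word n) :=
  GroupCongruence rel_equivM rel_equivV rel_equivVg.

Definition presented : Type := quotg rel_cong.

HB.instance Definition _ := Group.on presented.

Definition presented_gen (i : 'I_n) : presented := quotg_pi rel_cong (letter i).

Lemma presented_eqP v w :
  quotg_pi rel_cong v = quotg_pi rel_cong w <-> rel_eq rels v w.
Proof. by rewrite quotg_piP; split=> /asboolP. Qed.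

End Words.

Definition generated (G : groupType) (S : set G) : set G :=
  smallest (fun K : set G => group_closed (mem K)) S.

Definition has_presentation (G : groupType) (H : set G) (n : nat)
    (gens : n.-tuple G) (rels : seq (word n * word n)) : Prop :=
  exists f : {multiplicative presented rels -> G},
    [/\ injective f, range f = H
      & forall i, f (presented_gen rels i) = tnth gens i].

Fixpoint alternating (n k : nat) (x y : word n) : word n :=
  if k is k'.+1 then x * alternating k' y x else 1.

Definition braid (n k : nat) (x y : word n) : word n * word n :=
  (alternating k x y, alternating k y x).

Local Open Scope ring_scope.
Local Open Scope complex_scope.
Local Open Scope sesquilinear_scope.

Definition mx3 (C : nzRingType) (rows : seq (seq C)) : 'M[C]_3 :=
  \matrix_(i, j) nth 0 (nth [::] rows i) j.

Section UnitaryGroup.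
Variable R : realType.
Implicit Types A B : 'M[R[i]]_3.

Definition J : 'M[R[i]]_3 :=
  mx3 [:: [:: 0; 0; 1];
          [:: 0; 1; 0];
          [:: 1; 0; 0]].

Definition unitaryJ : pred 'M[R[i]]_3 :=
  fun A => (A \in unitmx) && (A ^t* *m J *m A == J).

Record UJ : Type := MkUJ { UJmx :> 'M[R[i]]_3; _ : unitaryJ UJmx }.

HB.instance Definition _ := [isSub for UJmx].
HB.instance Definition _ := [Choice of UJ by <:].

Lemma unitaryJ1 : unitaryJ 1%:M.
Proof. by rewrite /unitaryJ unitmx1 trmx1 map_mx1 mul1mx mulmx1 eqxx. Qed.

Lemma adjM A B : (A *m B) ^t* = B ^t* *m A ^t*.
Proof. by rewrite trmx_mul map_mxM. Qed.

Lemma unitaryJM A B : unitaryJ A -> unitaryJ B -> unitaryJ (A *m B).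
Proof.
move=> /andP[uA /eqP JA] /andP[uB /eqP JB].
rewrite /unitaryJ unitmx_mul uA uB /= adjM.
by rewrite !mulmxA -(mulmxA _ _ J) -(mulmxA _ _ A) JA JB.
Qed.

Lemma unitaryJV A : unitaryJ A -> unitaryJ (invmx A).
Proof.
move=> /andP[uA /eqP JA]; rewrite /unitaryJ unitmx_inv uA /=.
rewrite -{1}JA !mulmxA -adjM mulmxV // trmx1 map_mx1 mul1mx.
by rewrite -mulmxA mulmxV // mulmx1.
Qed.

Definition UJ_one : UJ := MkUJ unitaryJ1.
Definition UJ_mul (A B : UJ) : UJ := MkUJ (unitaryJM (valP A) (valP B)).
Definition UJ_inv (A : UJ) : UJ := MkUJ (unitaryJV (valP A)).

Lemma UJ_unit (A : UJ) : UJmx A \in unitmx.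
Proof. by case/andP: (valP A). Qed.

Lemma UJ_mulA : associative UJ_mul.
Proof. by move=> A B C; apply: val_inj; rewrite /= mulmxA. Qed.

Lemma UJ_mul1 : left_id UJ_one UJ_mul.
Proof. by move=> A; apply: val_inj; rewrite /= mul1mx. Qed.

Lemma UJ_mulr1 : right_id UJ_one UJ_mul.
Proof. by move=> A; apply: val_inj; rewrite /= mulmx1. Qed.

Lemma UJ_mulV : left_inverse UJ_one UJ_inv UJ_mul.
Proof. by move=> A; apply: val_inj; rewrite /= mulVmx ?UJ_unit. Qed.

Lemma UJ_mulrV : right_inverse UJ_one UJ_inv UJ_mul.
Proof. by move=> A; apply: val_inj; rewrite /= mulmxV ?UJ_unit. Qed.

HB.instance Definition _ := isGroup.Build UJ
  UJ_mulA UJ_mul1 UJ_mulr1 UJ_mulV UJ_mulrV.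

(* Congruence modulo the scalar matrices of U(J): as A and B lie in U(J), the
   scalar c necessarily has modulus 1. *)
Definition scalar_eq : rel UJ :=
  fun A B : UJ => `[< exists c : R[i], UJmx A = c *: UJmx B >].

Lemma scalar_eq_refl : reflexive scalar_eq.
Proof. by move=> A; apply/asboolP; exists 1; rewrite scale1r. Qed.

Lemma UJ_neq0 (A : UJ) : UJmx A != 0.
Proof.
apply/eqP=> A0; move: (UJ_unit A); rewrite A0 unitmxE det0 unitr0 //.
Qed.

Lemma scalar_neq0 (c : R[i]) (A B : UJ) : UJmx A = c *: UJmx B -> c != 0.
Proof.
by move=> AB; apply: contraNneq (UJ_neq0 A) => c0; rewrite AB c0 scale0r.
Qed.

Lemma scalar_eq_sym : symmetric scalar_eq.
Proof.
suff sym (A B : UJ) : scalar_eq A B -> scalar_eq B A.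
  by move=> A B; apply/idP/idP => /sym.
case/asboolP=> c AB; apply/asboolP; exists c^-1.
by rewrite AB scalerA mulVf ?scale1r // (scalar_neq0 AB).
Qed.

Lemma scalar_eq_trans : transitive scalar_eq.
Proof.
move=> B A C /asboolP[c AB] /asboolP[d BC]; apply/asboolP; exists (c * d).
by rewrite AB BC scalerA.
Qed.

Definition scalar_equiv : equiv_rel UJ :=
  EquivRel scalar_eq scalar_eq_refl scalar_eq_sym scalar_eq_trans.

Lemma scalar_equivM (A A' B B' : UJ) :
  scalar_equiv A A' -> scalar_equiv B B' ->
  scalar_equiv (A * B)%g (A' * B')%g.
Proof.
move=> /asboolP[c AA] /asboolP[d BB]; apply/asboolP; exists (c * d) => /=.
by rewrite AA BB -scalemxAl -scalemxAr scalerA.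
Qed.

Lemma scalar_equivV (A B : UJ) :
  scalar_equiv A B -> scalar_equiv (A^-1)%g (B^-1)%g.
Proof.
move=> /asboolP[c AB]; apply/asboolP; exists c^-1 => /=.
by rewrite AB invmxZ // -AB UJ_unit.
Qed.

Lemma scalar_equivVg (A : UJ) : scalar_equiv (A^-1 * A)%g 1%g.
Proof. by rewrite mulVg; apply: equiv_refl. Qed.

Definition scalar_cong : group_congruence UJ :=
  GroupCongruence scalar_equivM scalar_equivV scalar_equivVg.

Definition PUJ : Type := quotg scalar_cong.

HB.instance Definition _ := Group.on PUJ.

Definition PUclass (A : UJ) : PUJ := quotg_pi scalar_cong A.

Lemma PUclassP (A B : UJ) :
  PUclass A = PUclass B <-> exists c : R[i], UJmx A = c *: UJmx B.
Proof. by rewrite /PUclass quotg_piP; split=> /asboolP. Qed.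

Definition gaussian_int : {pred R[i]} :=
  fun z => (complex.Re z \is a Num.int) && (complex.Im z \is a Num.int).

Definition GL3_gaussian : pred 'M[R[i]]_3 := fun A =>
  [&& A \in unitmx, A \is a mxOver gaussian_int & invmx A \is a mxOver gaussian_int].

Definition Gamma1 : set PUJ := [set PUclass A | A in [set A : UJ | GL3_gaussian A]].

(* 'i of complex.v, not the 'i of numClosedFieldType that ring_scope would
   select. *)
Local Notation I := (0 +i* 1 : R[i]).

Definition mx_a : 'M[R[i]]_3 :=
  mx3 [:: [:: - I;   0;     - 1  ];
          [:: I - 1; - 1;   I + 1];
          [:: I - 1; I - 1; 1    ]].

Definition mx_b : 'M[R[i]]_3 :=
  mx3 [:: [:: - 1;   0;       I      ];
          [:: I + 1; 1;       - I + 1];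
          [:: 1;     - I + 1; - I - 1]].

Lemma unitaryJ_adj A : A ^t* *m J *m A = J -> unitaryJ A.
Proof.
move=> JA; rewrite /unitaryJ JA eqxx andbT.
have JJ : J *m J = 1%:M.
  apply/matrixP=> i j; rewrite !mxE !big_ord_recl big_ord0 !mxE.
  by case: i => [[|[|[|//]]] ?]; case: j => [[|[|[|//]]] ?] /=;
    rewrite ?(mul0r, mulr0, mul1r, addr0, add0r).
have AJ : (J *m A ^t* *m J) *m A = 1%:M by rewrite -!mulmxA (mulmxA _ J) JA.
by case: (mulmx1_unit AJ).
Qed.

Lemma conj_i : Num.conj I = - I.
Proof. by apply/eqP; rewrite eq_complex /= oppr0 !eqxx. Qed.

Lemma unitaryJ_a : unitaryJ mx_a.
Proof.
have ii : I * I = -1 by rewrite -expr2 sqr_i.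
apply: unitaryJ_adj; apply/matrixP=> i j.
rewrite !mxE !big_ord_recl !big_ord0 !mxE !big_ord_recl !big_ord0 !mxE.
by case: i => [[|[|[|//]]] ?]; case: j => [[|[|[|//]]] ?] /=;
  rewrite ?(rmorphD, rmorphB, rmorphN, rmorph1, rmorph0) /= ?conj_i; ring: ii.
Qed.

Lemma unitaryJ_b : unitaryJ mx_b.
Proof.
have ii : I * I = -1 by rewrite -expr2 sqr_i.
apply: unitaryJ_adj; apply/matrixP=> i j.
rewrite !mxE !big_ord_recl !big_ord0 !mxE !big_ord_recl !big_ord0 !mxE.
by case: i => [[|[|[|//]]] ?]; case: j => [[|[|[|//]]] ?] /=;
  rewrite ?(rmorphD, rmorphB, rmorphN, rmorph1, rmorph0) /= ?conj_i; ring: ii.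
Qed.

Definition UJ_a : UJ := MkUJ unitaryJ_a.
Definition UJ_b : UJ := MkUJ unitaryJ_b.

End UnitaryGroup.

Arguments Gamma1 : clear implicits.

(* Main.v *)
Require Import Defs.
From Stdlib Require Import ZArith String Ascii.
From HB Require Import structures.
From mathcomp Require Import all_boot all_order all_algebra.
From mathcomp Require Import all_classical reals complex.
From mathcomp Require Import ring lra zify ssrZ.

(* Let infty = [1 : 0 : 0].  Its stabilizer in Gamma_1 consists of the elements
   X^m Y^n Z^t r^k, a Heisenberg group extended by a rotation r of order 4, and
   Gamma_1 is generated by this stabilizer and the involution
   s = [[0, 0, 1], [0, -1, 0], [1, 0, 0]].  A Knuth-Bendix completion of the
   presentation in a and b yields relations between X, Y, Z, r, s which hold in
   the abstractly presented group P as well: those of the stabilizer, two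
   relations sZs = Z^-1 s Z^-1 r and sXs = X s X^-1 r^2, and four relations of the
   form s g s h s = k s l with g, h, k, l in the stabilizer.

   Injectivity of P -> Gamma_1 is a peak reduction on the cusps g infty, with
   height |g_31|^2.  Call g infty and g s infty adjacent.  By induction on N one
   constructs an inverse L of P -> Gamma_1 on the elements of height at most N:
   at height N + 1, move down to an adjacent cusp of smaller height, apply L
   there and move back in P.  The result does not depend on the descending
   neighbour, since any two of them are joined by triangles and squares of
   cusps of height at most N, and the relations above fill these polygons.  The
   same polygons handle an edge with both ends at height N + 1.  The existence of
   the polygons is a statement about finitely many polynomial inequalities in the
   three Heisenberg coordinates of a cusp, which range over a compact set; it is
   checked by subdividing boxes. *)

Set Implicit Arguments.
Unset Strict Implicit.
Unset Printing Implicit Defensive.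

Local Open Scope classical_set_scope.
Local Open Scope group_scope.

(** * Rewriting certificates *)

(** The obstacle is the lack of a canonical way down: a cusp may have several lower neighbours, and
    adjacent cusps may have equal height. What makes this finite is a frame at each cusp. The bottom
    row of a matrix in U(J) is isotropic; divided by its first entry it becomes a point x of the
    Heisenberg group, and the height of a nearby cusp is the height of the given one times an
    explicit quartic polynomial in x. Comparing heights thus means comparing such polynomials with
    1, and this is done for all real x of a bounded region; powers of r move x into a quadrant where
    needed. Rounding x to the lattice of translations gives a neighbour of at most half the height,
    which is the descent itself. The inverse L is a function of group elements rather than cusps
    because the stabilizer must be carried along. It is only fixed up to a common left factor in P,
    and this factor cancels in L (f u) = L 1 * u. *)

HB.instance Definition _ := hasDecEq.Build ascii Ascii.eqb_spec.

Notation letters := list_ascii_of_string.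

(* A step [(i, p, forward)] replaces at position [p] one side of the equation
   [nth E i] by the other; it leaves the word unchanged if that side does not
   occur there. *)
Definition rewrite_at (E : seq (string * string)) (w : seq ascii)
    (st : nat * nat * bool) : seq ascii :=
  let: (i, p, forward) := st in
  let: e := nth (EmptyString, EmptyString) E i in
  let: u := letters (if forward then e.1 else e.2) in
  let: v := letters (if forward then e.2 else e.1) in
  if take (size u) (drop p w) == u
  then take p w ++ v ++ drop (p + size u) w else w.

Fixpoint derivation (E : seq (string * string))
    (D : seq (string * string * seq (nat * nat * bool))) : bool :=
  if D is (e, sts) :: D' then
    (foldl (rewrite_at E) (letters e.1) sts == letters e.2)
      && derivation (rcons E e) D'
  else true.

Section WordValue.
Variables (G : groupType) (val : ascii -> G).

Definition word_value (w : seq ascii) : G :=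
  foldr (fun c g => val c * g) 1 w.

Definition string_value (w : string) : G := word_value (letters w).

Lemma word_value_cat u v : word_value (u ++ v) = word_value u * word_value v.
Proof. by elim: u => [|c u IH] /=; rewrite ?mul1g // IH mulgA. Qed.

Definition holds (e : string * string) : Prop :=
  string_value e.1 = string_value e.2.

Lemma rewrite_at_value E w st :
  (forall i, holds (nth (EmptyString, EmptyString) E i)) ->
  word_value (rewrite_at E w st) = word_value w.
Proof.
case: st => [[i p] d] /(_ i) /=; set e := nth _ _ _ => he.
set u := letters (if d then e.1 else e.2).
set v := letters (if d then e.2 else e.1).
have uv : word_value u = word_value v by rewrite /u /v; case: (d); rewrite ?he.
case: eqP => // upref.
rewrite -[in RHS](cat_take_drop p w) -[in RHS](cat_take_drop (size u) (drop p w)).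
by rewrite upref !word_value_cat uv drop_drop addnC.
Qed.

(** Quantifying over all indices costs nothing: past the end [nth] returns the equation between two
    empty words, which always holds. *)
Lemma derivation_holds E D :
  derivation E D ->
  (forall i, holds (nth (EmptyString, EmptyString) E i)) ->
  forall i,
    holds (nth (EmptyString, EmptyString) (E ++ map fst D) i).
Proof.
elim: D E => [|[e sts] D IH] E /=; first by rewrite cats0.
case/andP=> /eqP eE dD hE.
have he : holds e.
  rewrite /holds /string_value -eE.
  elim: sts (letters e.1) {eE} => //= st sts IHs w.
  by rewrite -IHs rewrite_at_value.
rewrite -cat_rcons; apply: IH => // i; rewrite nth_rcons.
by case: ifP => // _; case: ifP.
Qed.

End WordValue.

Record heisenberg_relations (G : groupType) (X Y Z r : G) : Prop := {
  heis_XZ : X * Z = Z * X;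
  heis_YZ : Y * Z = Z * Y;
  heis_rZ : r * Z = Z * r;
  heis_rX : r * X = Y * r;
  heis_rY : r * Y = X^-1 * r;
  heis_r4 : r ^+ 4 = 1;
  heis_XY : X * Y = Y * X * Z ^- 4
}.

(* The last four relations are squares of cusps; the two before them, triangles. *)
Record picard_relations (G : groupType) (X Y Z r s : G) : Prop := {
  picard_heis :> heisenberg_relations X Y Z r;
  picard_ss : s * s = 1;
  picard_rs : r * s = s * r;
  picard_sZs : s * Z * s = Z^-1 * s * Z^-1 * r;
  picard_sXs : s * X * s = X * s * X^-1 * r ^+ 2;
  picard_sq1 : s * (Y * Z^-1) * s * (X * Y^-1 * Z ^- 2) * s =
    X * Y * Z ^+ 2 * s * (Y^-1 * Z^-1);
  picard_sq2 : s * (X * Z) * s * (X^-1 * Y * Z ^- 2) * s =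
    X * Y * Z ^+ 2 * s * (X^-1 * Z);
  picard_sq3 : s * (Y * Z^-1) * s * (Y^-1 * Z) * s =
    X * Z * s * (X^-1 * Z^-1);
  picard_sq4 : s * (X * Z) * s * (Y * Z) * s = X * Z * s * (Y * Z)
}.

(* A capital and the corresponding small letter are mutually inverse; the
   letters "s" and "w" stand for involutions. *)
Definition relators : seq (string * string) :=
  [:: ("aA", "");
    ("Aa", "");
    ("bB", "");
    ("Bb", "");
    ("rR", "");
    ("Rr", "");
    ("Zz", "");
    ("zZ", "");
    ("ss", "");
    ("ww", "");
    ("s", "abAAbaaB");
    ("r", "AABBBaa");
    ("w", "abAABB");
    ("Z", "baaBA");
    ("X", "aarZ");
    ("aaaaaaaa", "");
    ("rrrr", "");
    ("rs", "sr");
    ("sws", "wsw");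
    ("aabaaB", "baaBaa");
    ("x", "zRAA");
    ("Y", "rXR");
    ("y", "rxR");
    ("xX", "");
    ("Xx", "");
    ("yY", "");
    ("Yy", "")]%string.

(* Knuth-Bendix completion found these derivations: each word is rewritten with
   the relators and the preceding consequences, numbered consecutively. *)
Definition fw (i p : nat) := (i, p, true).
Definition bw (i p : nat) := (i, p, false).

Definition consequences : seq (string * string * seq (nat * nat * bool)) :=
  [::("Y", "raarZR", [:: fw 21 0; fw 14 1]);
    ("y", "rzRAAR", [:: fw 22 0; fw 20 1]);
    ("rsR", "s", [:: fw 17 0; fw 4 1]);
    ("sR", "Rs", [:: bw 5 0; fw 29 1]);
    ("rrr", "R", [:: bw 4 3; fw 16 0]);
    ("RR", "rr", [:: bw 31 1; fw 5 0]);
    ("baaB", "Za", [:: bw 1 4; bw 13 0]);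
    ("baa", "Zab", [:: bw 3 3; fw 33 0]);
    ("ZabA", "ba", [:: bw 34 0; fw 0 2]);
    ("BZa", "aaB", [:: bw 33 1; fw 3 0]);
    ("aaBA", "BZ", [:: bw 36 0; fw 0 2]);
    ("abA", "zba", [:: bw 7 0; fw 35 1]);
    ("Azba", "bA", [:: bw 38 1; fw 1 0]);
    ("ABZ", "aBA", [:: bw 37 1; fw 1 0]);
    ("aBAz", "AB", [:: bw 40 0; fw 6 2]);
    ("bAA", "Azb", [:: bw 39 0; fw 0 3]);
    ("BAz", "AAB", [:: bw 1 0; fw 41 1]);
    ("aaZa", "Zaaa", [:: bw 2 4; bw 34 2; fw 19 0; fw 34 0; fw 2 2]);
    ("aaZ", "Zaa", [:: bw 0 3; fw 44 0; fw 0 3]);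
    ("bZaa", "ZabZ", [:: bw 45 1; fw 34 0]);
    ("Zaaz", "aa", [:: bw 45 0; fw 6 2]);
    ("AZaa", "aZ", [:: bw 45 1; fw 1 0]);
    ("aaBaz", "Baa", [:: bw 36 0; fw 47 1]);
    ("aaz", "zaa", [:: bw 7 0; fw 47 1]);
    ("Azaa", "az", [:: bw 50 1; fw 1 0]);
    ("AZa", "aZA", [:: bw 0 3; fw 48 0]);
    ("aZAA", "AZ", [:: bw 52 0; fw 0 2]);
    ("Aza", "azA", [:: bw 0 3; fw 51 0]);
    ("azAA", "Az", [:: bw 54 0; fw 0 2]);
    ("AAZ", "ZAA", [:: bw 53 1; fw 1 0]);
    ("bZAA", "AzbZ", [:: bw 56 1; fw 42 0]);
    ("AAz", "zAA", [:: bw 55 1; fw 1 0]);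
    ("zB", "w", [:: bw 2 1; bw 0 2; bw 38 0; bw 12 0]);
    ("Zw", "B", [:: bw 59 1; fw 6 0]);
    ("wb", "z", [:: bw 59 0; fw 3 1]);
    ("Bw", "Z", [:: bw 60 0; fw 9 1]);
    ("Bz", "Zb", [:: bw 61 1; fw 62 0]);
    ("wz", "b", [:: bw 61 1; fw 9 0]);
    ("bZ", "w", [:: bw 62 1; fw 2 0]);
    ("zAAB", "AAw", [:: bw 58 0; fw 59 2]);
    ("zaaB", "aaw", [:: bw 50 0; fw 59 2]);
    ("AAw", "wAz", [:: bw 66 0; bw 43 1; fw 59 0]);
    ("AABB", "BAw", [:: bw 43 0; fw 59 2]);
    ("aaw", "wZa", [:: bw 67 0; bw 36 1; fw 59 0]);
    ("swsb", "wsz", [:: fw 18 0; fw 61 2]);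
    ("Azw", "wAA", [:: bw 65 2; bw 57 0; fw 65 0]);
    ("waa", "Zaw", [:: bw 65 0; fw 46 0; fw 65 2]);
    ("bwAz", "Azbw", [:: bw 68 1; fw 42 0]);
    ("awAz", "Aw", [:: bw 68 1; fw 0 0]);
    ("wAAb", "Azz", [:: bw 72 0; fw 61 2]);
    ("awAA", "zw", [:: bw 72 1; fw 0 0]);
    ("wZaa", "ZawZ", [:: bw 45 1; fw 73 0]);
    ("waz", "ZAw", [:: bw 1 3; bw 54 1; bw 68 0; fw 73 2; fw 56 0; fw 1 2]);
    ("ZZAw", "Baz", [:: bw 79 1; fw 60 0]);
    ("ZAwB", "waw", [:: bw 79 0; fw 59 2]);
    ("AAsws", "wAzsw", [:: fw 18 2; fw 68 0]);
    ("azw", "wZA", [:: bw 1 2; bw 54 0; fw 70 2; fw 72 0; fw 56 1; fw 1 3]);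
    ("wZAb", "azz", [:: bw 83 0; fw 61 2]);
    ("Azbwa", "wAwA", [:: bw 74 0; fw 54 2; fw 79 1; fw 65 0]);
    ("awAw", "AwB", [:: bw 59 3; fw 75 0]);
    ("AwZ", "awA", [:: bw 75 0; fw 7 3]);
    ("awawA", "AwBZ", [:: bw 87 2; fw 86 0]);
    ("awA", "zwa", [:: bw 1 3; fw 77 0]);
    ("zwaw", "AwB", [:: bw 89 0; fw 86 0]);
    ("AwBZ", "abwa", [:: bw 88 0; fw 89 2; fw 64 1]);
    ("bwaw", "wAwB", [:: bw 81 1; fw 65 0]);
    ("ABaa", "aBaz", [:: bw 47 2; fw 40 0; fw 1 2]);
    ("bwaZAw", "wAwBaz", [:: bw 79 3; fw 92 0]);
    ("BAwBaa", "r", [:: bw 69 0; bw 11 0]);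
    ("AwBaa", "br", [:: bw 2 0; fw 95 1]);
    ("waZAw", "Abr", [:: bw 52 1; bw 73 2; bw 59 2; bw 68 0; fw 96 1]);
    ("awawa", "brZ", [:: bw 65 1; bw 73 2; bw 91 0; bw 45 3; fw 96 0]);
    ("AwBa", "brA", [:: bw 0 4; fw 96 0]);
    ("wawa", "ZbrA", [:: bw 81 0; fw 99 1]);
    ("brAA", "AwB", [:: bw 99 0; fw 0 3]);
    ("abrA", "wBa", [:: bw 99 1; fw 0 0]);
    ("aZbrA", "brZ", [:: bw 100 1; fw 98 0]);
    ("wAwB", "zrAA", [:: bw 101 1; fw 61 0]);
    ("BAwB", "rAA", [:: bw 101 1; fw 3 0]);
    ("wBaa", "abr", [:: bw 102 0; fw 1 3]);
    ("Zbwab", "rzAA", [:: bw 63 0; bw 89 1; bw 87 1; bw 63 3; fw 105 0; fw 58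
     1]);
    ("rAAb", "BAw", [:: bw 105 0; fw 3 3]);
    ("wabr", "Baa", [:: bw 106 1; fw 9 0]);
    ("RBAw", "AAb", [:: bw 108 1; fw 5 0]);
    ("BaaR", "wab", [:: bw 109 0; fw 4 3]);
    ("AAbb", "RAAB", [:: bw 110 0; fw 61 3; fw 43 1]);
    ("AAbw", "RBA", [:: bw 110 0; fw 9 3]);
    ("ZawR", "zwab", [:: bw 73 0; bw 59 0; fw 111 1]);
    ("bwab", "aaR", [:: bw 111 1; fw 2 0]);
    ("rzAA", "ZaaR", [:: bw 107 0; fw 115 1]);
    ("Azzw", "wRBA", [:: bw 76 0; fw 113 1]);
    ("aRBA", "Abw", [:: bw 113 1; fw 0 0]);
    ("zzwab", "awR", [:: bw 114 1; fw 7 0]);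
    ("aaRZ", "zrAA", [:: bw 115 0; fw 65 3; fw 92 0; fw 104 0]);
    ("RZaaR", "zAA", [:: bw 116 1; fw 5 0]);
    ("Abwa", "aRB", [:: bw 118 0; fw 1 3]);
    ("AwAw", "aRZb", [:: bw 65 1; bw 79 2; fw 122 0; fw 63 2]);
    ("Awaw", "aRBa", [:: bw 65 1; bw 73 2; fw 122 0]);
    ("bAbr", "zrAz", [:: bw 97 1; fw 94 0; fw 104 0; fw 1 3]);
    ("brAz", "zAbr", [:: bw 64 0; bw 125 1; fw 61 0]);
    ("zAbrB", "brAw", [:: bw 126 0; fw 59 3]);
    ("waZa", "Zbrw", [:: bw 9 2; bw 70 3; fw 100 0; fw 1 3]);
    ("brZA", "awaw", [:: bw 103 0; fw 101 2; fw 81 1]);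
    ("ZbrAw", "zrZA", [:: bw 100 0; bw 129 1; fw 61 0]);
    ("AzzrAA", "waRZb", [:: bw 104 2; fw 72 0; fw 68 2; fw 59 4; fw 123 1]);
    ("AbrB", "zrZA", [:: bw 97 0; bw 52 1; bw 73 2; bw 36 3; fw 104 0; fw 56
     2; fw 1 4]);
    ("zzrZA", "brAw", [:: bw 132 1; fw 127 0]);
    ("azrZA", "brB", [:: bw 132 1; fw 0 0]);
    ("ZAwAb", "RBaz", [:: bw 79 0; bw 54 1; bw 68 0; bw 65 2; bw 34 3; fw 112
     0; fw 93 2; fw 1 1]);
    ("AwAb", "ZAwR", [:: bw 7 0; bw 79 1; bw 54 2; bw 68 1; bw 58 0; bw 114 2;
     fw 56 0; fw 1 2]);
    ("BazR", "RBaz", [:: bw 80 0; bw 136 1; fw 135 0]);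
    ("ZAwRZ", "aRZb", [:: bw 136 0; fw 65 3; fw 123 0]);
    ("zRBaz", "ZAwR", [:: bw 137 1; fw 59 0; fw 79 0]);
    ("Bazrr", "rrBaz", [:: bw 32 3; fw 137 0; fw 137 1; fw 32 0]);
    ("RBazr", "Baz", [:: bw 137 0; fw 5 3]);
    ("waRZb", "azRZ", [:: bw 131 0; bw 120 2; fw 54 0; fw 1 2]);
    ("bRBa", "azRZ", [:: bw 1 1; bw 124 2; fw 42 0; fw 85 0; fw 123 1; fw 142
     0]);
    ("aRZb", "zRBa", [:: bw 138 0; bw 79 0; bw 143 1; fw 61 0]);
    ("brwa", "awaZ", [:: bw 6 2; bw 89 3; bw 87 3; fw 129 0; fw 9 3]);
    ("azzrB", "wrZA", [:: bw 84 0; fw 132 2; fw 6 1]);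
    ("ZAwRwa", "AwaRB", [:: bw 136 0; fw 122 2]);
    ("RZaa", "zAAr", [:: bw 5 4; fw 121 0]);
    ("RzAAr", "rrZaa", [:: bw 148 1; fw 32 0]);
    ("brAwa", "zzrZ", [:: bw 133 0; fw 1 4]);
    ("brBa", "azrZ", [:: bw 134 0; fw 1 4]);
    ("ZAwrZ", "zrBa", [:: bw 79 0; bw 151 1; fw 61 0]);
    ("ZAwRw", "zRZZA", [:: bw 139 0; fw 83 3; fw 62 2]);
    ("AwaRB", "zRZZ", [:: bw 147 0; fw 153 0; fw 1 4]);
    ("Bazr", "rBaz", [:: bw 141 0; fw 140 1; fw 5 0]);
    ("aarBaz", "Baar", [:: bw 155 2; fw 49 0]);
    ("AwrZA", "zzrB", [:: bw 146 1; fw 1 0]);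
    ("zzrBa", "AwrZ", [:: bw 152 1; fw 7 0]);
    ("zRZZb", "AwaR", [:: bw 154 0; fw 3 4]);
    ("Awrwa", "zzrZZ", [:: bw 6 3; bw 89 4; bw 87 4; fw 157 0; fw 62 3]);
    ("zwa", "s", [:: bw 2 3; bw 65 1; bw 34 2; bw 0 2; bw 38 0; bw 10 0]);
    ("AwB", "sw", [:: bw 90 0; fw 161 0]);
    ("brA", "swa", [:: bw 99 0; fw 162 0]);
    ("waw", "Zsw", [:: bw 81 0; fw 162 1]);
    ("as", "wZ", [:: bw 161 1; fw 83 0; fw 1 2]);
    ("aRs", "wZR", [:: bw 30 1; fw 165 0]);
    ("ars", "wZr", [:: fw 17 1; fw 165 0]);
    ("wZs", "a", [:: bw 165 0; fw 8 1]);
    ("Aw", "sz", [:: bw 7 0; bw 79 1; fw 161 0]);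
    ("szw", "A", [:: bw 169 0; fw 9 1]);
    ("aw", "sa", [:: bw 7 0; bw 73 1; fw 161 0]);
    ("wsa", "Zsw", [:: bw 171 1; fw 164 0]);
    ("As", "wA", [:: bw 161 1; fw 72 0; fw 1 2]);
    ("wa", "Zs", [:: bw 6 0; fw 161 1]);
    ("AZs", "sza", [:: bw 174 1; fw 169 0]);
    ("BZs", "Za", [:: bw 174 1; fw 62 0]);
    ("ZZs", "Ba", [:: bw 174 1; fw 60 0]);
    ("sA", "zw", [:: bw 161 0; fw 0 2]);
    ("swA", "zws", [:: bw 173 1; fw 178 0]);
    ("szsz", "zRBa", [:: bw 169 2; bw 169 0; fw 123 0; fw 144 0]);
    ("brsz", "sZsw", [:: bw 169 2; fw 163 0; fw 174 1]);
    ("wBs", "swB", [:: bw 60 1; bw 165 0; fw 18 1; fw 171 0; fw 165 1; fw 60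
     2]);
    ("aaR", "wsb", [:: bw 115 0; fw 174 1; fw 65 0]);
    ("brZs", "sZaa", [:: bw 174 2; fw 145 0; fw 171 0; fw 45 1]);
    ("sZsw", "zrA", [:: bw 172 1; fw 18 0; bw 163 1; fw 61 0]);
    ("AZRs", "szaR", [:: bw 30 2; fw 175 0]);
    ("ZZrs", "Bar", [:: fw 17 2; fw 177 0]);
    ("bws", "sbw", [:: bw 64 0; bw 179 1; bw 18 0; fw 178 2; fw 64 1]);
    ("aarr", "wsbR", [:: bw 32 2; fw 183 0]);
    ("bwrs", "sbwr", [:: fw 17 2; fw 188 0]);
    ("saR", "zsb", [:: bw 171 0; bw 119 0; fw 174 2; fw 7 1]);
    ("ZswR", "bsb", [:: bw 172 0; fw 191 1; fw 64 0]);
    ("swZR", "zsbs", [:: bw 166 1; fw 191 0]);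
    ("zzrZ", "zr", [:: bw 150 0; fw 163 0; fw 174 1; fw 185 0; fw 1 2]);
    ("zrZA", "rA", [:: bw 130 0; fw 163 1; fw 174 2; fw 185 1; fw 6 0]);
    ("brw", "sZa", [:: bw 7 0; bw 128 1; fw 161 0]);
    ("sZab", "brz", [:: bw 196 0; fw 61 2]);
    ("Azs", "wRB", [:: bw 161 2; fw 117 0; fw 1 3]);
    ("sbr", "Zsa", [:: bw 161 0; fw 109 1; fw 59 0; fw 174 0]);
    ("szrZs", "zrZ", [:: bw 174 3; bw 169 0; fw 160 0; fw 194 0]);
    ("zzrB", "rzw", [:: bw 157 0; fw 169 0; fw 195 1; bw 17 0; fw 178 1]);
    ("zRZZ", "RZ", [:: bw 62 2; bw 165 3; bw 180 0; bw 169 2; bw 169 0; bw 173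
     1; fw 82 0; fw 198 1; fw 9 0; fw 62 1]);
    ("zrsz", "sZs", [:: bw 169 2; bw 185 0; bw 181 0; fw 170 2; fw 163 0; fw
     174 1]);
    ("ZsaZ", "swr", [:: bw 171 1; bw 78 0; bw 176 1; bw 199 2; fw 182 0; fw 3
     2]);
    ("wszr", "saa", [:: bw 71 0; fw 199 2; fw 168 1]);
    ("szrZ", "rs", [:: bw 169 0; bw 158 0; fw 201 0; fw 174 2; fw 7 1]);
    ("szaR", "RZb", [:: bw 169 0; bw 159 0; fw 202 0]);
    ("zrZ", "r", [:: bw 200 0; fw 206 0; fw 8 1]);
    ("rz", "zr", [:: bw 208 0; fw 6 2]);
    ("szr", "rsz", [:: bw 209 1; bw 17 0]);
    ("rZ", "Zr", [:: bw 6 0; fw 208 1]);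
    ("sZr", "rsZ", [:: bw 211 1; bw 17 0]);
    ("sZaa", "wrs", [:: bw 184 0; fw 211 1; fw 65 0]);
    ("Rz", "zR", [:: bw 31 0; fw 209 2; fw 209 1; fw 209 0; fw 31 1]);
    ("zRB", "Rw", [:: bw 214 0; fw 59 1]);
    ("wrsz", "saa", [:: bw 210 1; fw 205 0]);
    ("Bar", "rBa", [:: bw 187 0; bw 211 1; bw 211 0; fw 177 1]);
    ("RZ", "ZR", [:: bw 31 0; fw 211 2; fw 211 1; fw 211 0; fw 31 1]);
    ("bRB", "wRw", [:: bw 64 0; fw 215 1]);
    ("Zrraa", "zRAAr", [:: bw 211 0; bw 211 1; bw 149 0; fw 214 0]);
    ("RsZs", "zsz", [:: bw 203 1; fw 214 0; fw 5 1]);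
    ("bsw", "sbs", [:: bw 65 2; bw 192 0; fw 218 3; fw 193 1; fw 6 0]);
    ("sbsz", "bsb", [:: bw 222 0; fw 64 2]);
    ("sXs", "Xsxrr", [:: fw 14 1; fw 211 3; fw 45 1; fw 213 0; bw 17 2; fw 8
     3; bw 6 0; bw 178 1; bw 0 2; bw 4 3; bw 199 0; bw 64 1; bw 209 2; bw 209
     3; bw 20 4; bw 204 0; bw 171 1; bw 167 2; bw 45 0; bw 211 2; bw 14 0]);
    ("YZ", "ZY", [:: fw 27 0; fw 211 3; fw 45 1; fw 211 0; fw 4 4; fw 45 2; fw
     211 1; bw 4 5; bw 211 1; bw 45 2; bw 211 4; bw 27 1]);
    ("sYzsyZs", "XZsxz", [:: fw 27 1; bw 17 0; fw 211 4; fw 45 2; fw 213 1; bw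
     17 3; fw 30 4; fw 4 3; fw 216 1; fw 165 3; fw 171 2; fw 8 1; fw 28 3; fw
     209 3; fw 6 2; fw 4 2; fw 0 1; fw 218 2; fw 186 1; fw 207 1; fw 4 0; bw
     63 0; bw 0 1; bw 0 2; bw 4 3; bw 156 0; bw 20 5; bw 217 2; bw 36 0; bw 45
     1; bw 177 0; bw 171 2; bw 167 3; bw 45 1; bw 211 3; bw 45 0; bw 211 2; bw
     14 0]);
    ("sYs", "Ysyrr", [:: fw 27 1; bw 17 0; fw 211 4; fw 45 2; fw 213 1; bw 17
     3; fw 30 4; fw 4 3; fw 8 3; bw 5 2; bw 6 0; bw 209 1; bw 178 2; bw 0 3;
     bw 4 4; bw 6 4; bw 209 5; bw 28 5; bw 171 2; bw 165 3; bw 4 4; bw 211 0;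
     bw 45 1; bw 211 3; bw 27 0]);
    ("rX", "Yr", [:: fw 14 1; bw 5 5; bw 27 0]);
    ("rY", "xr", [:: fw 27 1; fw 211 4; fw 45 2; fw 211 1; fw 211 0; fw 220 0;
     fw 4 5; bw 20 0]);
    ("sZs", "zszr", [:: bw 203 0; bw 210 1]);
    ("sXZsYZs", "XZsYZ", [:: fw 14 1; fw 211 3; fw 45 1; fw 213 0; bw 17 2; fw
     27 6; bw 17 5; fw 212 3; fw 31 1; fw 221 1; fw 64 0; fw 211 5; fw 45 3;
     fw 7 2; fw 4 4; fw 45 2; fw 213 1; fw 190 0; fw 190 1; fw 8 0; bw 65 1;
     bw 211 2; bw 4 3; bw 7 2; bw 211 3; bw 211 4; bw 209 2; bw 197 1; bw 34
     2; bw 223 0; bw 64 1; bw 221 2; bw 174 4; bw 30 2; fw 18 0; bw 219 2; bw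
     189 0; bw 217 3; bw 27 5; bw 217 2; bw 36 0; bw 45 1; bw 177 0; bw 171 2;
     bw 167 3; bw 45 1; bw 211 3; bw 45 0; bw 211 2; bw 14 0]);
    ("w", "sXrrs", [:: bw 8 1; bw 5 1; fw 17 2; bw 31 1; fw 17 3; fw 17 2; bw
     213 0; bw 45 1; bw 211 3; bw 14 1]);
    ("XZ", "ZX", [:: fw 14 0; fw 211 2; fw 45 0; fw 211 3; fw 45 1; bw 45 1;
     bw 211 3; bw 14 1]);
    ("XzRXzRXzRXzR", "", [:: fw 14 0; fw 6 3; fw 4 2; fw 14 2; fw 6 5; fw 4 4;
     fw 14 4; fw 6 7; fw 4 6; fw 14 6; fw 15 0; fw 6 1; fw 4 0]);
    ("ZYz", "Y", [:: bw 225 0; fw 6 1]);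
    ("ZXz", "X", [:: bw 233 0; fw 6 1]);
    ("Zrz", "r", [:: bw 211 0; fw 6 1]);
    ("rYR", "x", [:: fw 229 0; fw 4 1]);
    ("xZX", "Z", [:: bw 233 1; fw 23 0]);
    ("XrY", "r", [:: fw 229 1; fw 24 0]);
    ("XR", "RY", [:: bw 5 0; bw 21 1]);
    ("xRY", "R", [:: bw 241 1; fw 23 0]);
    ("YR", "Rx", [:: bw 5 0; fw 238 1]);
    ("yRx", "R", [:: bw 243 1; fw 25 0]);
    ("xZ", "Zx", [:: bw 24 2; fw 239 0]);
    ("Zxz", "x", [:: bw 245 0; fw 6 1]);
    ("Xr", "ry", [:: bw 26 2; fw 240 0]);
    ("Yz", "zY", [:: bw 7 0; fw 235 1]);
    ("Xz", "zX", [:: bw 7 0; fw 236 1]);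
    ("Rzr", "z", [:: bw 209 1; fw 5 0]);
    ("xR", "Ry", [:: bw 26 2; fw 242 0]);
    ("yR", "RX", [:: bw 23 2; fw 244 0]);
    ("yz", "zy", [:: bw 250 1; fw 252 0; fw 249 1; fw 247 2; fw 250 0]);
    ("xz", "zx", [:: bw 7 0; fw 246 1]);
    ("zzzzXyxY", "", [:: bw 4 4; bw 252 5; bw 251 6; bw 243 7; bw 241 8; bw
     209 3; bw 253 4; bw 254 5; bw 248 6; bw 249 7; bw 4 4; bw 251 5; bw 243
     6; bw 241 7; bw 209 2; bw 209 3; bw 254 4; bw 248 5; bw 249 6; bw 32 2;
     bw 243 3; bw 241 4; bw 214 1; bw 248 2; bw 249 3; bw 241 1; bw 249 0; fw
     234 0]);
    ("zzzzyxY", "x", [:: bw 23 4; bw 254 3; bw 254 2; bw 254 1; bw 254 0; fw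
     255 1]);
    ("zzzzxY", "Yx", [:: bw 26 4; bw 248 3; bw 248 2; bw 248 1; bw 248 0; fw
     256 1]);
    ("zzzzY", "XYx", [:: bw 24 4; bw 249 3; bw 249 2; bw 249 1; bw 249 0; fw
     257 1]);
    ("ZXYx", "zzzY", [:: bw 233 0; bw 225 1; bw 245 2; bw 258 0; fw 225 4; fw
     7 3]);
    ("zzzYX", "ZXY", [:: bw 259 0; fw 23 3]);
    ("XY", "YXzzzz", [:: bw 6 0; bw 249 1; bw 248 2; bw 260 0; bw 248 2; bw
     249 3; bw 248 1; bw 249 2; bw 248 0; bw 249 1]);
    ("XrrsX", "sXs", [:: fw 17 2; fw 228 3; fw 17 1; fw 229 2; bw 224 0]);
    ("RZr", "Z", [:: bw 211 1; fw 5 0]);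
    ("yrX", "r", [:: fw 228 1; fw 25 0]);
    ("yZY", "Z", [:: bw 225 1; fw 25 0]);
    ("yZ", "Zy", [:: bw 26 2; fw 265 0]);
    ("sZR", "RsZ", [:: bw 218 1; fw 30 0]);
    ("yr", "rx", [:: bw 24 2; fw 264 0]);
    ("szR", "Rsz", [:: bw 214 1; fw 30 0]);
    ("rrxsX", "sXs", [:: bw 268 1; bw 247 0; fw 262 0]);
    ("rrsZs", "zRsz", [:: bw 32 0; fw 221 1; fw 214 0]);
    ("RxsZs", "zYsz", [:: bw 243 0; fw 221 1; fw 248 0]);
    ("RYsZs", "zXsz", [:: bw 241 0; fw 221 1; fw 249 0]);
    ("Rsxs", "rXsx", [:: bw 30 0; bw 243 1; bw 30 2; fw 227 0; fw 4 4; fw 268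
     2; bw 17 1; bw 228 0]);
    ("rrsxs", "Xsx", [:: bw 32 0; fw 274 1; fw 5 0]);
    ("rrsys", "Ysy", [:: bw 32 0; bw 30 1; bw 251 2; bw 30 3; fw 274 0; fw 251
     3; fw 30 2; fw 241 1; fw 4 0]);
    ("ysYs", "rrsY", [:: fw 227 1; fw 25 0; fw 268 1; bw 17 0; bw 229 2; bw 17
     1]);
    ("rrsYs", "ysY", [:: bw 277 0; fw 8 3]);
    ("RsYs", "rysY", [:: bw 30 0; bw 241 1; bw 30 2; bw 262 0; fw 241 4; fw
     247 0; fw 268 1; fw 30 3; fw 251 2; fw 4 1]);
    ("RsXs", "rxsX", [:: bw 270 1; fw 5 0]);
    ("rsZxsX", "zszXs", [:: bw 212 0; bw 280 2; fw 267 0; fw 221 0]);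
    ("rrxsZs", "zRYsz", [:: bw 268 1; bw 247 0; fw 271 1; fw 249 0; fw 241 1]);
    ("rrysZs", "zRxsz", [:: bw 247 1; fw 228 0; fw 271 1; fw 248 0; fw 243 1]);
    ("rXsZxs", "szYsz", [:: bw 245 3; bw 274 0; bw 30 0; fw 272 1]);
    ("rysZYs", "szXsz", [:: bw 225 3; bw 279 0; bw 30 0; fw 273 1]);
    ("Rsys", "rYsy", [:: bw 31 0; fw 276 1]);
    ("rsZYsy", "zszys", [:: bw 212 0; bw 286 2; fw 267 0; fw 221 0]);
    ("ZZXY", "zzYX", [:: bw 233 1; bw 225 2; bw 260 0; fw 233 4; fw 225 3; fw
     7 2]);
    ("zRszxs", "sZXsx", [:: bw 271 0; bw 212 1; bw 212 0; fw 275 2]);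
    ("zRszYs", "sZysY", [:: bw 271 0; bw 212 1; bw 212 0; fw 278 2]);
    ("szYszX", "zYszXs", [:: bw 284 0; fw 228 0; fw 281 1; fw 248 0]);
    ("RszYsz", "XsZxs", [:: bw 269 0; bw 282 1; bw 17 0; bw 17 1; fw 275 0; fw
     245 2]);
    ("Rszxsz", "YsZys", [:: bw 269 0; bw 283 1; bw 17 0; bw 17 1; fw 276 0; fw
     266 2]);
    ("szXszy", "zXszys", [:: bw 285 0; bw 247 0; fw 287 1; fw 249 0]);
    ("sZXszx", "zYsZys", [:: bw 254 4; bw 289 0; fw 293 1]);
    ("sZyszY", "zXsZxs", [:: bw 248 4; bw 290 0; fw 292 1]);
    ("sYzsXyzzs", "XYZZsyz", [:: fw 248 1; fw 253 5; fw 249 4; fw 291 0; fw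
     253 6; fw 294 2; fw 248 1; fw 8 7; bw 253 5; bw 288 0; bw 233 1; bw 225
     2; bw 233 0; bw 225 1]);
    ("sXZsxYzzs", "XYZZsxZ", [:: fw 233 1; fw 248 5; fw 254 4; fw 295 0; fw
     248 6; fw 296 2; fw 248 1; fw 8 7; bw 245 5; bw 288 0; bw 233 1; bw 225
     2; bw 233 0; bw 225 1])]%string.
Lemma consequences_derivation : derivation relators consequences.
Proof. by vm_compute. Qed.

Ltac expand_words :=
  rewrite ?(expgS, expg0, mulg1, invgM, invgK, mulgA).

(** * Relations of the stabilizer and the involution, derived from those of a and b *)

Section TwoGenerators.
Variables (G : groupType) (a b : G).

(** [gen_r], [gen_s], [gen_w] are words of the presentation, in which v repeats s. [gen_Z] is to be
    the central vertical translation, [gen_X] and [gen_Y] the horizontal ones; at the given matrices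
    they take the values [gZ], [gX], [gY] modulo scalars. *)
Definition gen_r : G := a ^- 2 * b ^- 3 * a ^+ 2.
Definition gen_s : G := a * b * a ^- 2 * b * a ^+ 2 * b^-1.
Definition gen_w : G := a * b * a ^- 2 * b ^- 2.
Definition gen_Z : G := b * a ^+ 2 * b^-1 * a^-1.
Definition gen_X : G := a ^+ 2 * gen_r * gen_Z.
Definition gen_Y : G := gen_r * gen_X * gen_r^-1.

Definition letter_value (c : ascii) : G :=
  match c with
  | "a" => a | "A" => a^-1 | "b" => b | "B" => b^-1
  | "r" => gen_r | "R" => gen_r^-1 | "Z" => gen_Z | "z" => gen_Z^-1
  | "X" => gen_X | "x" => gen_X^-1 | "Y" => gen_Y | "y" => gen_Y^-1
  | "s" => gen_s | "w" => gen_w | _ => 1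
  end%char.

(* The generalization keeps [mulgA] and [invgM] from unfolding the generators. *)
Ltac derived H := have := H _ _ erefl; rewrite /string_value /=;
  move: gen_X gen_Y gen_Z gen_r gen_s gen_w => ? ? ? ? ? ?; expand_words.

(** The relators of the certificate follow from the hypotheses and the definitions of the letters;
    the fields of the conclusion are then relators or derived equations. The formulas for a and b
    come from w = s X r^2 s, a = w Z s and b = w Z^-1; they show that the stabilizer and s
    generate. *)
Lemma gen_picard_relations :
  a ^+ 8 = 1 -> gen_r ^+ 4 = 1 -> gen_s ^+ 2 = 1 -> gen_w ^+ 2 = 1 ->
  gen_r * gen_s = gen_s * gen_r ->
  gen_s * gen_w * gen_s = gen_w * gen_s * gen_w ->
  a ^+ 2 * (b * a ^+ 2 * b^-1) = b * a ^+ 2 * b^-1 * a ^+ 2 ->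
  [/\ picard_relations gen_X gen_Y gen_Z gen_r gen_s,
      a = gen_s * gen_X * gen_r ^+ 2 * gen_s * gen_Z * gen_s
    & b = gen_s * gen_X * gen_r ^+ 2 * gen_s * gen_Z^-1].
Proof.
move=> a8 r4 s2 w2 rs sws ac.
have ax i : holds letter_value
    (nth (EmptyString, EmptyString) relators i).
  rewrite /holds /string_value.
  do 27?[case: i => [|i]];
    rewrite ?[nth _ _ _]/= /= ?mulg1 ?mulgV ?mulVg //.
  all: try by rewrite -?expg2.
  all: try by rewrite /gen_Y /gen_X.
  all: try by rewrite -?a8 -?r4 -?rs.
  all: try by rewrite /gen_s /gen_r /gen_w /gen_Z; expand_words.
  all: try by rewrite /gen_Y /gen_X; expand_words.
  - by rewrite mulgA sws -mulgA.
  - by move: ac; expand_words.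
  - by case: i.
(* The numbers passed to [der] count the 27 relators first, then the consequences. *)
have der i u v : nth (EmptyString, EmptyString)
    (relators ++ map fst consequences) i = (u, v) ->
    string_value letter_value u = string_value letter_value v.
  by move=> e; have := derivation_holds consequences_derivation ax i; rewrite e.
suff: picard_relations gen_X gen_Y gen_Z gen_r gen_s.
  have ew : gen_w = gen_s * gen_X * gen_r ^+ 2 * gen_s.
    by derived (der 232).
  have ea : gen_w * gen_Z * gen_s = a.
    by derived (der 168).
  have eb : b = gen_w * gen_Z^-1.
    by derived (der 64).
  by split=> //; [rewrite -ew ea | rewrite -ew].
split; first split.
- by derived (der 233).
- by derived (der 225).
- by derived (der 211).
- by derived (der 228).
- by derived (der 229).
- exact: r4.
- by derived (der 261).
- by rewrite -expg2.
- exact: rs.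
- by derived (der 230).
- by derived (der 224).
- by derived (der 297).
- by derived (der 298).
- by derived (der 226).
- by derived (der 231).
Qed.

End TwoGenerators.

(** * The stabilizer of a cusp *)

Lemma morph_group (G H : groupType) (phi : G -> H) :
  {morph phi : x y / x * y} ->
  [/\ phi 1 = 1, {morph phi : x / x^-1}
    & forall n, {morph phi : x / x ^+ n}].
Proof.
move=> phiM; have phi1 : phi 1 = 1 by apply: (mulgI (phi 1)); rewrite -phiM !mulg1.
split=> // [x|n x]; first by apply: (mulgI (phi x)); rewrite -phiM !mulgV.
by elim: n => // n IH; rewrite !expgS phiM IH.
Qed.

Section IntegerPowers.
Variable G : groupType.
Implicit Types (x y g : G) (m n : int).

Definition expz x n : G :=
  match n with Posz k => x ^+ k | Negz k => x ^- k.+1 end.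

Lemma expzN x n : expz x (- n)%R = (expz x n)^-1.
Proof. by case: n => [[|k]|k] /=; rewrite ?invg1 ?invgK. Qed.

Lemma expzS x n : expz x (n + 1)%R = expz x n * x.
Proof.
case: n => [k|k]; first by rewrite /= addn1 expgSr.
have -> : (Negz k + 1 = - (k : int))%R by rewrite NegzE -addn1 PoszD; lia.
by rewrite expzN /= expgS invgM mulgVK.
Qed.

Lemma expzB1 x n : expz x (n - 1)%R = expz x n * x^-1.
Proof. by rewrite -[in RHS](GRing.subrK 1%R n) expzS mulgK. Qed.

Lemma expzD x m n : expz x (m + n)%R = expz x m * expz x n.
Proof.
elim/int_rec: n => [|n IH|n IH].
- by rewrite GRing.addr0 mulg1.
- by rewrite -addn1 PoszD GRing.addrA !expzS IH mulgA.
- by rewrite -addn1 PoszD GRing.opprD GRing.addrA !expzB1 IH mulgA.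
Qed.

Lemma expzA x m n : expz (expz x m) n = expz x (m * n)%R.
Proof.
elim/int_rec: n => [|n IH|n IH]; first by rewrite GRing.mulr0.
  by rewrite -addn1 PoszD expzS IH GRing.mulrDr GRing.mulr1 expzD.
rewrite -addn1 PoszD GRing.opprD expzB1 IH GRing.mulrDr GRing.mulrN1.
by rewrite expzD expzN.
Qed.

Lemma expzM x y n : commute x y -> expz (x * y) n = expz x n * expz y n.
Proof.
move=> xy; case: n => k /=; rewrite expgMn //.
by rewrite (commuteX2 _ _ xy) invgM.
Qed.

Lemma expz_conj g x y n : g * x = y * g -> g * expz x n = expz y n * g.
Proof.
move=> gx; have gxk k : g * x ^+ k = y ^+ k * g.
  elim: k => [|k IH]; first by rewrite mulg1 mul1g.
  by rewrite !expgSr mulgA IH -!mulgA gx.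
case: n => k //=; apply: (mulIg (x ^+ k.+1)).
by rewrite mulgVK -mulgA gxk mulKg.
Qed.

Lemma expz_comm x y m n : commute x y -> commute (expz x m) (expz y n).
Proof.
move=> xy; rewrite /commute; apply: expz_conj; apply: esym.
by apply: expz_conj; apply: esym.
Qed.

End IntegerPowers.

(** (m, n, t, k) stands for X^m Y^n Z^t r^k. As k is not reduced modulo 4, an element has many
    indices. *)
Definition cusp_index : Type := int * int * int * nat.

(** Conjugation by r: X^m Y^n becomes Y^m X^-n, and restoring the order of the factors costs
    Z^(-4mn). *)
Definition turn_index (h : int * int * int) : int * int * int :=
  let: (m, n, t) := h in (- n, m, t - 4 * (m * n))%R.

Definition mul_index (h h' : cusp_index) : cusp_index :=
  let: (m, n, t, k) := h in let: (h'', k') := h' in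
  let: (m', n', t') := iter k turn_index h'' in
  ((m + m')%R, (n + n')%R, (t + t' + 4 * (n * m'))%R, (k + k')%N).

(** The exponent 3k stands for -k, since exponents of r are natural numbers and r^4 = 1. *)
Definition inv_index (h : cusp_index) : cusp_index :=
  let: (m, n, t, k) := h in
  mul_index (0, 0, 0, 3 * k)%R (mul_index (0, - n, - t, 0) (- m, 0, 0, 0))%R.

Section NormalForms.
Variables (G : groupType) (X Y Z r : G).
Hypothesis heis : heisenberg_relations X Y Z r.

Definition normal_form3 (h : int * int * int) : G :=
  let: (m, n, t) := h in expz X m * expz Y n * expz Z t.

Definition normal_form (h : cusp_index) : G := normal_form3 h.1 * r ^+ h.2.

(** The commutator of Y and X is a power of the central Z: moving one Y across X^m produces Z^(4m),
    and moving Y^n across produces the n-th power of that. *)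
Lemma heis_expXY m n :
  expz Y n * expz X m = expz X m * expz Y n * expz Z (4 * (n * m))%R.
Proof.
have ZX k : commute X (expz Z k).
  by have := @expz_comm _ X Z 1%R k (heis_XZ heis); rewrite /= expg1.
have ZY k : commute Y (expz Z k).
  by have := @expz_comm _ Y Z 1%R k (heis_YZ heis); rewrite /= expg1.
have YXm : expz X m * (Y * expz Z (4 * m)%R) = Y * expz X m.
  have YX : Y * X = X * expz Z 4 * Y.
    by rewrite -mulgA -(ZY 4) mulgA (heis_XY heis) /= mulgVK.
  by rewrite (expz_conj m YX) expzM // expzA -mulgA -ZY.
by rewrite -(expz_conj n YXm) expzM // expzA mulgA; congr (_ * expz _ _); lia.
Qed.

Lemma normal_form3M h h' :
  normal_form3 h * normal_form3 h' =
  normal_form3 (h.1.1 + h'.1.1, h.1.2 + h'.1.2,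
                h.2 + h'.2 + 4 * (h.1.2 * h'.1.1))%R.
Proof.
case: h h' => [[m n] t] [[m' n'] t'] /=.
have Zc k j : expz Z k * expz X j = expz X j * expz Z k.
  exact: expz_comm (esym (heis_XZ heis)).
have ZcY k j : expz Z k * expz Y j = expz Y j * expz Z k.
  exact: expz_comm (esym (heis_YZ heis)).
rewrite -!mulgA (mulgA (expz Z t)) Zc -!mulgA (mulgA (expz Z t)) ZcY.
rewrite (mulgA (expz Y n) (expz X m')) heis_expXY -!mulgA.
rewrite (mulgA (expz Z (4 * _)%R)) ZcY !expzD -!mulgA.
congr (_ * (_ * (_ * (_ * _)))).
rewrite -!expzD; congr expz; lia.
Qed.

Lemma normal_form3_rot k h :
  r ^+ k * normal_form3 h = normal_form3 (iter k turn_index h) * r ^+ k.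
Proof.
elim: k => [|k IH]; first by rewrite mul1g mulg1.
rewrite expgS -mulgA IH mulgA iterS.
case: (iter _ _ _) => [[m n] t] /=.
have rZ : r * expz Z t = expz Z t * r by apply: expz_conj; apply: heis_rZ heis.
have rX : r * expz X m = expz Y m * r by apply: expz_conj; apply: heis_rX heis.
have rY : r * expz Y n = expz X (- n)%R * r.
  rewrite (expz_conj n (heis_rY heis)); congr (_ * _).
  by case: (n) => [[|j]|j] /=; rewrite ?expVgn ?invgK ?invg1.
rewrite !mulgA rX -!mulgA (mulgA r (expz Y n)) rY -!mulgA (mulgA r (expz Z t)) rZ.
rewrite !mulgA heis_expXY -!mulgA; congr (_ * (_ * _)).
by rewrite mulgA -expzD; congr (expz _ _ * _); lia.
Qed.

Lemma normal_formM h h' :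
  normal_form h * normal_form h' = normal_form (mul_index h h').
Proof.
case: h h' => [[[m n] t] k] [h' k']; rewrite /normal_form /mul_index /=.
rewrite -!mulgA (mulgA (r ^+ k)) normal_form3_rot.
case: (iter _ _ _) => [[m' n'] t'].
rewrite -mulgA -expgnDr 3!mulgA; congr (_ * _).
exact: (normal_form3M (m, n, t) (m', n', t')).
Qed.

Lemma normal_formV h : normal_form (inv_index h) = (normal_form h)^-1.
Proof.
case: h => [[[m n] t] k]; rewrite /inv_index -!normal_formM /normal_form /=.
rewrite !mul1g !mulg1 !invgM !expzN.
have rk : r ^+ (3 * k) = r ^- k.
  apply: (mulIg (r ^+ k)); rewrite mulVg -expgnDr -mulSnr mulnC.
  by rewrite mulnC expgnA (heis_r4 heis) expg1n.
rewrite rk; congr (_ * _); rewrite mulgA; congr (_ * _).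
rewrite -!expzN; exact: (expz_comm _ _ (heis_YZ heis)).
Qed.
End NormalForms.

(** * Inequalities on boxes *)

Delimit Scope Z_scope with BZ.

Section BoxSubdivision.
Local Open Scope Z_scope.

(* A cusp [(s, a, b, t)] is an isotropic vector whose last coordinate has squared
   modulus [s], at the Heisenberg point with horizontal coordinates [a], [b] and
   vertical coordinate [t / 2].  A box [(c1, c2, c3, h)] has center
   [(c1, c2, c3) / scale] and half-width [h / scale]. *)
Definition cusp_data : Type := Z * Z * Z * Z.
Definition box : Type := Z * Z * Z * Z.

(** A power of two, so that repeated halving keeps centers and half-widths integral. *)
Definition scale : Z := 4096.

Definition sq_lower (c h : Z) : Z := let d := Z.max 0 (Z.abs c - h) in d * d.
Definition sq_upper (c h : Z) : Z := let d := Z.abs c + h in d * d.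

Definition depth_lower (v : cusp_data) (bx : box) : Z :=
  let: (s, a, b, t) := v in let: (c1, c2, c3, h) := bx in
  let d := sq_lower (c1 - a * scale) h + sq_lower (c2 - b * scale) h in
  s * (d * d + 4 * (scale * scale) *
    sq_lower (c3 - t * 2048 + a * c2 - b * c1) (h * (1 + Z.abs a + Z.abs b))).

Definition depth_upper (v : cusp_data) (bx : box) : Z :=
  let: (s, a, b, t) := v in let: (c1, c2, c3, h) := bx in
  let d := sq_upper (c1 - a * scale) h + sq_upper (c2 - b * scale) h in
  s * (d * d + 4 * (scale * scale) *
    sq_upper (c3 - t * 2048 + a * c2 - b * c1) (h * (1 + Z.abs a + Z.abs b))).

Definition depth_one : Z := 4 * (scale * scale) * (scale * scale).

Definition halves (c h : Z) : seq Z := [:: c - h; c + h].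

Definition split_box (bx : box) : seq box :=
  let: (c1, c2, c3, h) := bx in
  let h' := Z.div2 (h + 1) in
  [seq (p.1.1, p.1.2, p.2, h') |
    p <- [seq (q, z) | q <- [seq (x, y) | x <- halves c1 h', y <- halves c2 h'],
                       z <- halves c3 h']].

(* Conditionals replace disjunctions because [vm_compute] evaluates both sides of
   [||] and would always subdivide. *)
Fixpoint box_check (fuel : nat) (inside on : seq cusp_data)
    (goals : seq (seq cusp_data)) (bx : box) : bool :=
  if has (fun v => depth_one <=? depth_lower v bx) inside then true else
  if has (fun v => (depth_one <? depth_lower v bx)
                || (depth_upper v bx <? depth_one)) on then true else
  if has (all (fun v => depth_upper v bx <? depth_one)) goals then true else
  if fuel is fuel'.+1
  then all (box_check fuel' inside on goals) (split_box bx) else false.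

End BoxSubdivision.

Section BoxSoundness.
Local Open Scope ring_scope.
Import Order.TTheory GRing.Theory Num.Theory.
Variable R : realFieldType.
Implicit Types (v : cusp_data) (bx : box) (c h : Z).

Definition ofZ (z : Z) : R := (int_of_Z z)%:~R.

Lemma ofZD : {morph ofZ : x y / (x + y)%BZ >-> x + y}.
Proof. by move=> x y; rewrite /ofZ -intrD; congr _%:~R; lia. Qed.

Lemma ofZM : {morph ofZ : x y / (x * y)%BZ >-> x * y}.
Proof. by move=> x y; rewrite /ofZ -intrM; congr _%:~R; lia. Qed.

Lemma ofZN : {morph ofZ : x / (- x)%BZ >-> - x}.
Proof. by move=> x; rewrite /ofZ -mulrNz; congr _%:~R; lia. Qed.

Lemma ofZB : {morph ofZ : x y / (x - y)%BZ >-> x - y}.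
Proof. by move=> x y; rewrite /ofZ -intrB; congr _%:~R; lia. Qed.

Lemma ofZ_le x y : (ofZ x <= ofZ y) = (x <=? y)%BZ.
Proof. by rewrite /ofZ ler_int; apply/idP/idP; lia. Qed.

Lemma ofZ_lt x y : (ofZ x < ofZ y) = (x <? y)%BZ.
Proof. by rewrite /ofZ ltr_int; apply/idP/idP; lia. Qed.

Lemma ofZ_abs x : ofZ (Z.abs x) = `|ofZ x|.
Proof. by rewrite /ofZ -intr_norm; congr _%:~R; lia. Qed.

Lemma ofZ_max x y : ofZ (Z.max x y) = Num.max (ofZ x) (ofZ y).
Proof.
case: (leP (ofZ x) (ofZ y)); rewrite ?ofZ_le ?ofZ_lt => xy; congr ofZ; lia.
Qed.

Definition in_box bx (x : R * R * R) : Prop :=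
  let: (c1, c2, c3, h) := bx in
  [/\ `|ofZ scale * x.1.1 - ofZ c1| <= ofZ h,
      `|ofZ scale * x.1.2 - ofZ c2| <= ofZ h
    & `|ofZ scale * x.2 - ofZ c3| <= ofZ h].

(* If a point has Heisenberg coordinates [x] in the frame of a cusp of height
   [H], then the cusp [v] of this frame has height [H * depth v x]. *)
Definition depth v (x : R * R * R) : R :=
  let: (s, a, b, t) := v in let: (x1, x2, x3) := x in
  ofZ s * (((x1 - ofZ a) ^+ 2 + (x2 - ofZ b) ^+ 2) ^+ 2 / 4
           + (x3 - ofZ t / 2 + ofZ a * x2 - ofZ b * x1) ^+ 2).

Lemma sq_bounds (y : R) c h : `|y - ofZ c| <= ofZ h ->
  ofZ (sq_lower c h) <= y ^+ 2 <= ofZ (sq_upper c h).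
Proof.
move=> yc; rewrite /sq_lower /sq_upper !ofZM ofZ_max ofZD ofZB ofZ_abs -!expr2.
have h0 : 0 <= ofZ h := le_trans (normr_ge0 _) yc.
have z0 : ofZ 0 = 0 by [].
rewrite -[y ^+ 2]real_normK ?num_real // z0; apply/andP; split.
- rewrite ler_sqr ?nnegrE ?le_max ?lexx ?normr_ge0 // ge_max normr_ge0 /=.
  rewrite lerBlDr; apply: le_trans (lerD (lexx _) yc).
  by rewrite distrC -{1}(subrKC y (ofZ c)) ler_normD.
- rewrite ler_sqr ?nnegrE ?addr_ge0 ?normr_ge0 //.
  apply: le_trans (lerD (lexx _) yc).
  by rewrite -{1}(subrKC (ofZ c) y) ler_normD.
Qed.

#[local] Arguments Z.mul : simpl never.

(** Multiplication by 4 D^4, with D = [scale], clears all denominators. The vertical term is an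
    affine form with coefficients a, b and 1, so it varies over the box by at most h (1 + |a| +
    |b|). *)
Lemma depth_bounds v bx x : (0 <=? v.1.1.1)%BZ -> in_box bx x ->
  ofZ (depth_lower v bx) <= ofZ depth_one * depth v x <= ofZ (depth_upper v bx).
Proof.
case: v bx x => [[[s a] b] t] [[[c1 c2] c3] h] [[x1 x2] x3] /= s0 [b1 b2 b3].
have s0' : 0 <= ofZ s by rewrite -[0]/(ofZ 0) ofZ_le.
have [H eH] : exists H, H = ofZ 2048 by eexists.
have [D eDs] : exists D, D = ofZ scale by eexists.
have eD : D = H * 2 by rewrite eDs eH -[2]/(ofZ 2) -ofZM.
rewrite -eDs in b1 b2 b3.
have h0 : 0 <= ofZ h := le_trans (normr_ge0 _) b1.
have e1 : ofZ 1 = 1 by [].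
have /andP[l1 u1] : ofZ (sq_lower (c1 - a * scale) h) <=
    (D * (x1 - ofZ a)) ^+ 2 <= ofZ (sq_upper (c1 - a * scale) h).
  apply: sq_bounds; rewrite ofZB ofZM -eDs.
  by rewrite (_ : _ - _ = D * x1 - ofZ c1) //; ring.
have /andP[l2 u2] : ofZ (sq_lower (c2 - b * scale) h) <=
    (D * (x2 - ofZ b)) ^+ 2 <= ofZ (sq_upper (c2 - b * scale) h).
  apply: sq_bounds; rewrite ofZB ofZM -eDs.
  by rewrite (_ : _ - _ = D * x2 - ofZ c2) //; ring.
have /andP[l3 u3] :
    ofZ (sq_lower (c3 - t * 2048 + a * c2 - b * c1) (h * (1 + Z.abs a + Z.abs b)))
    <= (D * (x3 - ofZ t / 2 + ofZ a * x2 - ofZ b * x1)) ^+ 2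
    <= ofZ (sq_upper (c3 - t * 2048 + a * c2 - b * c1)
                     (h * (1 + Z.abs a + Z.abs b))).
  apply: sq_bounds; rewrite !(ofZB, ofZD, ofZM) e1 !ofZ_abs -eH.
  rewrite (_ : _ - _ = (D * x3 - ofZ c3) + ofZ a * (D * x2 - ofZ c2)
                       - ofZ b * (D * x1 - ofZ c1)); last first.
    by rewrite eD; field.
  apply: le_trans (ler_normB _ _) _; rewrite [leRHS]mulrDr lerD //.
    apply: le_trans (ler_normD _ _) _; rewrite [leRHS]mulrDr mulr1 lerD //.
    by rewrite normrM [leRHS]mulrC ler_wpM2l.
  by rewrite normrM [leRHS]mulrC ler_wpM2l.
set y1 := D * (x1 - _) in l1 u1; set y2 := D * (x2 - _) in l2 u2.
set y3 := D * _ in l3 u3.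
have -> : ofZ depth_one * (ofZ s * (((x1 - ofZ a) ^+ 2 + (x2 - ofZ b) ^+ 2) ^+ 2 / 4
           + (x3 - ofZ t / 2 + ofZ a * x2 - ofZ b * x1) ^+ 2)) =
   ofZ s * ((y1 ^+ 2 + y2 ^+ 2) ^+ 2 + 4 * (D * D) * y3 ^+ 2).
  by rewrite /depth_one !ofZM -eDs -[ofZ 4]/(4 : R) /y1 /y2 /y3; field.
have q0 : 0 <= 4 * (D * D) by rewrite mulr_ge0 // -expr2 sqr_ge0.
have l10 : 0 <= ofZ (sq_lower (c1 - a * scale) h).
  by rewrite -[0]/(ofZ 0) ofZ_le; apply/Z.leb_le/Z.square_nonneg.
have l20 : 0 <= ofZ (sq_lower (c2 - b * scale) h).
  by rewrite -[0]/(ofZ 0) ofZ_le; apply/Z.leb_le/Z.square_nonneg.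
move: l1 u1 l2 u2 l3 u3 l10 l20.
move: (sq_lower (c1 - _) h) (sq_upper (c1 - _) h) => L1 U1.
move: (sq_lower (c2 - _) h) (sq_upper (c2 - _) h) => L2 U2.
move: (sq_lower _ _) (sq_upper _ _) => L3 U3 l1 u1 l2 u2 l3 u3 l10 l20.
rewrite !(ofZD, ofZM) -!expr2 -eDs -[ofZ 4]/(4 : R) -?expr2.
rewrite -expr2 in q0; apply/andP; split.
- apply: ler_wpM2l => //; apply: lerD; last by rewrite ler_wpM2l.
  by rewrite lerXn2r ?nnegrE ?addr_ge0 ?sqr_ge0 ?lerD.
- apply: ler_wpM2l => //; apply: lerD; last by rewrite ler_wpM2l.
  rewrite lerXn2r ?nnegrE ?addr_ge0 ?sqr_ge0 ?lerD //.
    exact: le_trans (sqr_ge0 _) u1.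
  exact: le_trans (sqr_ge0 _) u2.
Qed.

Lemma in_halves (y : R) c h : `|y - ofZ c| <= ofZ h ->
  exists2 c', c' \in halves c (Z.div2 (h + 1)) &
    `|y - ofZ c'| <= ofZ (Z.div2 (h + 1)).
Proof.
(* The half-width is rounded up, so that the two halves also cover the interval when h is odd. *)
have hh : ofZ h <= ofZ (Z.div2 (h + 1)) + ofZ (Z.div2 (h + 1)).
  rewrite -ofZD ofZ_le; have := Z.div2_odd (h + 1); case: Z.odd => /=; lia.
rewrite ler_norml => /andP[y1 y2].
have [yc|yc] := leP y (ofZ c).
  exists (c - Z.div2 (h + 1))%BZ; first by rewrite inE eqxx.
  by rewrite ofZB ler_norml; apply/andP; split; lra.
exists (c + Z.div2 (h + 1))%BZ; first by rewrite !inE eqxx orbT.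
by rewrite ofZD ler_norml; apply/andP; split; lra.
Qed.

Lemma in_split_box bx x : in_box bx x ->
  exists2 bx', bx' \in split_box bx & in_box bx' x.
Proof.
case: bx x => [[[c1 c2] c3] h] [[x1 x2] x3] [/= b1 b2 b3].
have [d1 i1 j1] := in_halves b1; have [d2 i2 j2] := in_halves b2.
have [d3 i3 j3] := in_halves b3.
exists (d1, d2, d3, Z.div2 (h + 1)); last by split.
rewrite /split_box; set h' := Z.div2 (h + 1).
change ((d1, d2, d3, h') \in [seq (p.1.1, p.1.2, p.2, h') |
  p <- [seq (q, z) | q <- [seq (x, y) | x <- halves c1 h', y <- halves c2 h'],
                     z <- halves c3 h']]).
apply/mapP; exists (d1, d2, d3) => //.
have d12 : (d1, d2) \in [seq (x, y) | x <- halves c1 h', y <- halves c2 h'].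
  by apply/allpairsP; exists (d1, d2).
by apply/allpairsP; exists ((d1, d2), d3).
Qed.

(** A box is dismissed when a constraint of [inside] or [on] fails on all of it, and accepted when a
    single goal holds on all of it. The box containing x cannot be dismissed, so following x through
    the subdivision ends in an accepted box. *)
Lemma box_checkP fuel inside on goals bx x :
  all (fun v => 0 <=? v.1.1.1)%BZ (inside ++ on ++ flatten goals) ->
  box_check fuel inside on goals bx -> in_box bx x ->
  (forall v, v \in inside -> depth v x < 1) ->
  (forall v, v \in on -> depth v x = 1) ->
  exists2 g, g \in goals & forall v, v \in g -> depth v x < 1.
Proof.
move=> vpos chk bx_x ins ons.
have one0 : 0 < ofZ depth_one by rewrite -[0]/(ofZ 0) ofZ_lt.
have bnd v bx' : v \in inside ++ on ++ flatten goals -> in_box bx' x ->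
    ofZ (depth_lower v bx') <= ofZ depth_one * depth v x <= ofZ (depth_upper v bx').
  by move=> /(allP vpos); apply: depth_bounds.
have lower_out v bx' : v \in inside ++ on ++ flatten goals -> in_box bx' x ->
    ofZ (depth_lower v bx') <= ofZ depth_one * depth v x.
  by move=> vin /(bnd _ _ vin)/andP[].
have upper_out v bx' : v \in inside ++ on ++ flatten goals -> in_box bx' x ->
    ofZ depth_one * depth v x <= ofZ (depth_upper v bx').
  by move=> vin /(bnd _ _ vin)/andP[].
have no_inside bx' : in_box bx' x ->
    has (fun v => depth_one <=? depth_lower v bx')%BZ inside -> False.
  move=> bx'x /hasP[v vin lo].
  have vall : v \in inside ++ on ++ flatten goals by rewrite mem_cat vin.
  have := lower_out v bx' vall bx'x; rewrite -(ofZ_le depth_one) in lo.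
  by move=> /(le_trans lo); rewrite leNgt gtr_pMr // ins.
have no_on bx' : in_box bx' x -> has (fun v => (depth_one <? depth_lower v bx')
    || (depth_upper v bx' <? depth_one))%BZ on -> False.
  move=> bx'x /hasP[v von lo].
  have vall : v \in inside ++ on ++ flatten goals by rewrite !mem_cat von orbT.
  move: (lower_out v bx' vall bx'x) (upper_out v bx' vall bx'x).
  by rewrite ons // mulr1 !ofZ_le; lia.
have goal bx' : in_box bx' x ->
    has (all (fun v => depth_upper v bx' <? depth_one)%BZ) goals ->
    exists2 g, g \in goals & forall v, v \in g -> depth v x < 1.
  move=> bx'x /hasP[g gin /allP gv]; exists g => // v vg.
  have vall : v \in inside ++ on ++ flatten goals.
    rewrite !mem_cat; apply/orP; right; apply/orP; right.
    by apply/flattenP; exists g.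
  have := le_lt_trans (upper_out v bx' vall bx'x) (_ : _ < ofZ depth_one).
  by rewrite gtr_pMr // ofZ_lt; apply; apply: gv.
elim: fuel bx chk bx_x => [|fuel IH] bx chk bx_x; move: chk => /=.
  case: ifP => [/no_inside|_]; first by case.
  case: ifP => [/no_on|_]; first by case.
  by case: ifP => // /(goal _ bx_x).
case: ifP => [/no_inside|_]; first by case.
case: ifP => [/no_on|_]; first by case.
case: ifP => [/(goal _ bx_x) //|_].
move=> /allP sub; have [bx' bx'in x_bx'] := in_split_box bx_x.
exact: IH (sub _ bx'in) x_bx'.
Qed.

End BoxSoundness.

(** * Peak reduction *)

(* The translation by [[1, *, -(m^2 + n^2) + it], [0, 1, (1 + i)(m + ni)],
   [0, 0, 1]]: the vertical coordinate [t] of the matrix differs from the exponent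
   of [Z] in the normal form by [2mn]. *)
Definition shear (m n t : int) : cusp_index := (m, n, (t + 2 * (m * n))%R, 0%N).

Lemma shearV (Q : groupType) (A B C q : Q) m n t :
  heisenberg_relations A B C q ->
  (normal_form A B C q (shear m n t))^-1 =
  normal_form A B C q (shear (- m) (- n) (- t))%R.
Proof.
move=> hs; rewrite -(normal_formV hs); congr normal_form.
by rewrite /inv_index /mul_index /shear /=; do ![congr (_, _)]; lia.
Qed.

Lemma shearM (Q : groupType) (A B C q : Q) m n t m' n' t' :
  heisenberg_relations A B C q ->
  normal_form A B C q (shear m n t) * normal_form A B C q (shear m' n' t') =
  normal_form A B C q
    (shear (m + m') (n + n') (t + t' + 2 * (n * m') - 2 * (m * n')))%R.
Proof.
move=> hs; rewrite (normal_formM hs); congr normal_form.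
by rewrite /mul_index /shear /=; do ![congr (_, _)]; lia.
Qed.

Lemma shear_rot (Q : groupType) (A B C q : Q) m n t :
  heisenberg_relations A B C q ->
  q * normal_form A B C q (shear m n t) * q^-1 =
  normal_form A B C q (shear (- n)%R m t).
Proof.
move=> hs; have := normal_form3_rot hs 1 (m, n, t + 2 * (m * n))%R.
rewrite /normal_form /shear /= !mulg1 expg1 => ->; rewrite mulgK.
by congr (_ * expz _ _); lia.
Qed.

Section Descent.
Variables (G P : groupType) (X Y Z r s : G) (X' Y' Z' r' s' : P).
Hypothesis picG : picard_relations X Y Z r s.
Hypothesis picP : picard_relations X' Y' Z' r' s'.

Local Notation nf := (normal_form X Y Z r).
Local Notation nf' := (normal_form X' Y' Z' r').
Local Notation K m n t := (nf (shear m n t)).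

Variables (D : G -> Prop) (height : G -> nat).

(* The cusps adjacent to [g infty] are the [g * nf h * s infty].  The fields from
   [apart] on provide polygons of lower cusps between [g * s infty] and a second
   lower neighbour, which up to rotation, inversion and the bounds of
   [near_cusps] is one of finitely many; [tie] treats the edges between cusps of
   the same height. *)
Record cusp_geometry : Prop := {
  dom1 : D 1;
  domM : forall g h, D g -> D (g * nf h);
  doms : forall g, D g -> D (g * s);
  height1 : height 1 = 0%N;
  heightM : forall g h, D g -> height (g * nf h) = height g;
  height0 : forall g, D g -> height g = 0%N -> exists h, g = nf h;
  height0s : forall g, D g -> height g = 0%N -> height (g * s) <> 0%N;
  nf_faithful : forall h, nf h = 1 -> nf' h = 1;
  descend : forall g, D g -> (0 < height g)%N ->
    exists h, (height (g * nf h * s) < height g)%N;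
  near_cusps : forall g m n t k, D g ->
    (height (g * s) < height g)%N ->
    (height (g * nf (m, n, (t + 2 * (m * n))%R, k) * s) < height g)%N ->
    [&& `|m|%N <= 1, `|n|%N <= 1 & `|t|%N <= 4]%N;
  apart : forall g, D g -> (height (g * s) < height g)%N -> forall m n t,
    (m, n, t) \in [:: (0, 0, 2); (0, 0, 3); (0, 0, 4); (1, 0, 3); (1, 0, 4);
                      (1, 1, 3); (1, 1, 4)]%R ->
    (height g <= height (g * K m n t * s))%N;
  near101 : forall g, D g -> (height (g * s) < height g)%N ->
    (height (g * K 1 0 1 * s) < height g)%N ->
    [\/ (height (g * K 0 0 1 * s) < height g)%N,
        (height (g * K 1 0 0 * s) < height g)%N,
        (height (g * s * K 0 1 (-1)%R * s) < height g)%N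
      | (height (g * s * K 1 0 1 * s) < height g)%N];
  near110 : forall g, D g -> (height (g * s) < height g)%N ->
    (height (g * K 1 1 0 * s) < height g)%N ->
       (height (g * s * K 0 1 (-1)%R * s) < height g)%N
    \/ (height (g * s * K 1 0 1 * s) < height g)%N;
  near112 : forall g, D g -> (height (g * s) < height g)%N ->
    (height (g * K 1 1 2 * s) < height g)%N ->
    (height (g * K 0 1 0 * s) < height g)%N;
  near102 : forall g, D g -> (height (g * s) < height g)%N ->
    (height (g * K 1 0 2 * s) < height g)%N ->
    [\/ (height (g * K 0 0 1 * s) < height g)%N,
        (height (g * K 1 0 1 * s) < height g)%N,
        (height (g * K 0 1 0 * s) < height g)%N
      | (height (g * K 1 1 0 * s) < height g)%N];
  near111 : forall g, D g -> (height (g * s) < height g)%N ->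
    (height (g * K 1 1 1 * s) < height g)%N ->
    [\/ (height (g * K 0 1 (-1)%R * s) < height g)%N,
        (height (g * K 0 1 0 * s) < height g)%N
      | (height (g * K 1 1 0 * s) < height g)%N];
  tie : forall g, D g -> (0 < height g)%N -> height (g * s) = height g ->
    exists j, let g' := g * r ^+ j in
      (exists h, h \in [:: shear 0 0 1; shear 0 0 (-1)%R; shear 1 0 0;
                           shear 0 1 0; shear (-1)%R 0 0; shear 0 (-1)%R 0]
         /\ (height (g' * nf h * s) < height g)%N)
      \/ (exists h h', (h, h') \in [:: (shear 1 0 1, shear 0 1 (-1)%R);
                                (shear 1 0 1, shear 1 0 1);
                                (shear 1 0 (-1)%R, shear 1 0 (-1)%R);
                                (shear 1 0 (-1)%R, shear 0 (-1)%R 1)]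
         /\ (height (g' * nf h * s) < height g)%N
         /\ (height (g' * s * nf h' * s) < height g)%N)
}.

Hypothesis geo : cusp_geometry.

Let heisG : heisenberg_relations X Y Z r := picG.
Let heisP : heisenberg_relations X' Y' Z' r' := picP.

(** * The stabilizer in both groups, and the relations of triangles and squares *)

Definition cusp_pair (x : G) (y : P) : Prop := exists h, x = nf h /\ y = nf' h.

Lemma cusp_pairM x y x1 y1 :
  cusp_pair x y -> cusp_pair x1 y1 -> cusp_pair (x * x1) (y * y1).
Proof.
move=> [h [-> ->]] [h1 [-> ->]]; exists (mul_index h h1).
by rewrite (normal_formM heisG) (normal_formM heisP).
Qed.

Lemma cusp_pairV x y : cusp_pair x y -> cusp_pair x^-1 y^-1.
Proof.
move=> [h [-> ->]]; exists (inv_index h).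
by rewrite (normal_formV heisG) (normal_formV heisP).
Qed.

Lemma cusp_pair_nf h : cusp_pair (nf h) (nf' h).
Proof. by exists h. Qed.

Lemma cusp_pair1 : cusp_pair 1 1.
Proof.
exists (0, 0, 0, 0%N)%R; by rewrite /normal_form /= !mulg1.
Qed.

Lemma cusp_pairr k : cusp_pair (r ^+ k) (r' ^+ k).
Proof. by exists (0, 0, 0, k)%R; rewrite /normal_form /= !mul1g. Qed.

(** Normal forms are not unique, so the lift of the stabilizer to P is given as a relation;
    [nf_faithful], applied to a quotient of two lifts, makes it a function. *)
Lemma cusp_pair_fun x y y1 : cusp_pair x y -> cusp_pair x y1 -> y = y1.
Proof.
move=> xy xy1; have [h [h1 hy]] := cusp_pairM (cusp_pairV xy) xy1.
have : nf' h = 1 by apply: (nf_faithful geo); rewrite -h1 mulVg.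
by rewrite -hy => /mulg1_eq; rewrite invgK.
Qed.

Lemma rs_comm k : commute (r ^+ k) s.
Proof.
by apply/commute_sym/commuteX/commute_sym/(picard_rs picG).
Qed.

Lemma rs_comm' k : commute (r' ^+ k) s'.
Proof.
by apply/commute_sym/commuteX/commute_sym/(picard_rs picP).
Qed.

(** Since g x s = g s u s u1, the cusp g x s infty is adjacent to g s infty: both form a triangle
    with g infty. The second equation is the same relation in P. *)
Definition triangular (x : G) (y : P) : Prop :=
  exists u v u1 v1, [/\ cusp_pair u v, cusp_pair u1 v1,
    s * x * s = u * s * u1 & s' * y * s' = v * s' * v1].

Lemma triangularV x y : triangular x y -> triangular x^-1 y^-1.
Proof.
have inv_eq (Q : groupType) (q z p p1 : Q) : q * q = 1 ->
    q * z * q = p * q * p1 -> q * z^-1 * q = p1^-1 * q * p^-1.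
  move=> /mulg1_eq qV /(congr1 (fun g : Q => g^-1)).
  by rewrite !invgM qV !mulgA.
move=> [u [v [u1 [v1 [uv uv1 e e']]]]]; exists u1^-1, v1^-1, u^-1, v^-1.
by split; [exact: cusp_pairV | exact: cusp_pairV | |];
  apply: inv_eq => //; [apply: picard_ss picG | apply: picard_ss picP].
Qed.

Lemma triangular_rot x y :
  triangular x y -> triangular (r * x * r^-1) (r' * y * r'^-1).
Proof.
have rot_eq (Q : groupType) (q z p p1 o : Q) : commute o q ->
    q * z * q = p * q * p1 ->
    q * (o * z * o^-1) * q = (o * p) * q * (p1 * o^-1).
  move=> oq e; have oVq : commute o^-1 q by apply/commute_sym/commuteV/commute_sym.
  by rewrite -!mulgA oVq (mulgA q o) -oq -(mulgA o) (mulgA z q) (mulgA q) (mulgA q) e !mulgA.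
move=> [u [v [u1 [v1 [uv uv1 e e']]]]].
exists (r * u), (r' * v), (u1 * r^-1), (v1 * r'^-1).
have rr := cusp_pairr 1; rewrite !expg1 in rr; have rrV := cusp_pairV rr.
split; [exact: cusp_pairM | exact: cusp_pairM | |]; apply: rot_eq => //.
- exact: picard_rs picG.
- exact: picard_rs picP.
Qed.

(** The vertices are g infty, g s infty, g s u s infty and g x s infty; the equation expresses that
    the last two are adjacent. *)
Definition square (x : G) (y : P) (u : G) (v : P) : Prop :=
  exists u1 v1 u2 v2, [/\ cusp_pair u1 v1, cusp_pair u2 v2,
    s * u * s * u1 * s = x * s * u2 & s' * v * s' * v1 * s' = y * s' * v2].

Local Notation K' m n t := (nf' (shear m n t)).

Lemma triangular001 : triangular (K 0 0 1) (K' 0 0 1).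
Proof.
exists Z^-1, Z'^-1, (Z^-1 * r), (Z'^-1 * r'); split.
- by exists (0, 0, -1, 0%N)%R; rewrite /normal_form /= !mulg1 !mul1g.
- by exists (0, 0, -1, 1%N)%R; rewrite /normal_form /= !mul1g.
- by rewrite /normal_form /= !mulg1 !mul1g (picard_sZs picG) !mulgA.
- by rewrite /normal_form /= !mulg1 !mul1g (picard_sZs picP) !mulgA.
Qed.

Lemma triangular100 : triangular (K 1 0 0) (K' 1 0 0).
Proof.
exists X, X', (X^-1 * r ^+ 2), (X'^-1 * r' ^+ 2); split.
- by exists (1, 0, 0, 0%N)%R; rewrite /normal_form /= !mulg1.
- by exists (-1, 0, 0, 2%N)%R; rewrite /normal_form /= !mulg1.
- by rewrite /normal_form /= !mulg1 (picard_sXs picG) !mulgA.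
- by rewrite /normal_form /= !mulg1 (picard_sXs picP) !mulgA.
Qed.

Lemma triangularK_rot m n t :
  triangular (K m n t) (K' m n t) -> triangular (K (- n) m t)%R (K' (- n) m t)%R.
Proof.
by move=> /triangular_rot; rewrite (shear_rot _ _ _ heisG) (shear_rot _ _ _ heisP).
Qed.

Lemma triangularK_inv m n t : triangular (K m n t) (K' m n t) ->
  triangular (K (- m) (- n) (- t))%R (K' (- m) (- n) (- t))%R.
Proof.
by move=> /triangularV; rewrite (shearV _ _ _ heisG) (shearV _ _ _ heisP).
Qed.

Lemma square_110_01N : square (K 1 1 0) (K' 1 1 0) (K 0 1 (-1)%R) (K' 0 1 (-1)%R).
Proof.
exists (K 1 (-1)%R 0), (K' 1 (-1)%R 0), (K 0 (-1)%R (-1)%R), (K' 0 (-1)%R (-1)%R).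
split; [exact: cusp_pair_nf | exact: cusp_pair_nf | |];
  rewrite /normal_form /= ?mulg1 ?mul1g; first exact: picard_sq1 picG.
exact: picard_sq1 picP.
Qed.

Lemma square_110_101 : square (K 1 1 0) (K' 1 1 0) (K 1 0 1) (K' 1 0 1).
Proof.
exists (K (-1)%R 1 0), (K' (-1)%R 1 0), (K (-1)%R 0 1), (K' (-1)%R 0 1).
split; [exact: cusp_pair_nf | exact: cusp_pair_nf | |];
  rewrite /normal_form /= ?mulg1 ?mul1g; first exact: picard_sq2 picG.
exact: picard_sq2 picP.
Qed.

Lemma square_101_01N : square (K 1 0 1) (K' 1 0 1) (K 0 1 (-1)%R) (K' 0 1 (-1)%R).
Proof.
exists (K 0 (-1)%R 1), (K' 0 (-1)%R 1), (K (-1)%R 0 (-1)%R), (K' (-1)%R 0 (-1)%R).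
split; [exact: cusp_pair_nf | exact: cusp_pair_nf | |];
  rewrite /normal_form /= ?mulg1 ?mul1g; first exact: picard_sq3 picG.
exact: picard_sq3 picP.
Qed.

Lemma square_101_101 : square (K 1 0 1) (K' 1 0 1) (K 1 0 1) (K' 1 0 1).
Proof.
exists (K 0 1 1), (K' 0 1 1), (K 0 1 1), (K' 0 1 1).
split; [exact: cusp_pair_nf | exact: cusp_pair_nf | |];
  rewrite /normal_form /= ?mulg1 ?mul1g; first exact: picard_sq4 picG.
exact: picard_sq4 picP.
Qed.

Lemma square_rot x y u v :
  square x y u v -> square (r * x * r^-1) (r' * y * r'^-1)
                           (r * u * r^-1) (r' * v * r'^-1).
Proof.
have rot_eq (Q : groupType) (q o w w1 w2 w3 : Q) : commute o q ->
    q * w * q * w1 * q = w2 * q * w3 ->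
    q * (o * w * o^-1) * q * (o * w1 * o^-1) * q =
    (o * w2 * o^-1) * q * (o * w3 * o^-1).
  move=> oq e; have oVq : commute o^-1 q by apply/commute_sym/commuteV/commute_sym.
  have -> : o * w2 * o^-1 * q * (o * w3 * o^-1) = o * (w2 * q * w3) * o^-1.
    by rewrite -!mulgA (mulgA o^-1 q) oVq -!mulgA mulKg.
  rewrite -e -!mulgA (mulgA q o) -oq -mulgA; congr (_ * (_ * (_ * _))).
  by rewrite (mulgA o^-1 q) oVq -!mulgA mulKg.
move=> [u1 [v1 [u2 [v2 [uv1 uv2 e e']]]]].
have rr := cusp_pairr 1; rewrite !expg1 in rr; have rrV := cusp_pairV rr.
exists (r * u1 * r^-1), (r' * v1 * r'^-1), (r * u2 * r^-1), (r' * v2 * r'^-1).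
split.
- by apply: cusp_pairM rrV; apply: cusp_pairM.
- by apply: cusp_pairM rrV; apply: cusp_pairM.
- exact: rot_eq (picard_rs picG) e.
- exact: rot_eq (picard_rs picP) e'.
Qed.

(** The same square read in the opposite direction, from the base g x: the two neighbours of g infty
    change places. *)
Lemma square_eqV (Q : groupType) (q x u u1 u2 : Q) : q * q = 1 ->
  q * u * q * u1 * q = x * q * u2 -> q * u2 * q * u1^-1 * q = x^-1 * q * u.
Proof.
move=> qq e; have qK z : q * (q * z) = z by rewrite mulgA qq mul1g.
have -> : u2 = q * (x^-1 * (q * u * q * u1 * q)) by rewrite e -!mulgA mulKg qK.
by rewrite -!mulgA !qK mulVKg qq mulg1.
Qed.

Lemma square_eq_end (Q : groupType) (q x u u1 u2 : Q) : q * q = 1 ->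
  q * u * q * u1 * q = x * q * u2 ->
  q * u^-1 = u1 * (q * (u2^-1 * (q * (x^-1 * q)))).
Proof.
move=> qq /(congr1 (fun g : Q => g^-1)).
rewrite !invgM (mulg1_eq qq) => e.
have qK z : q * (q * z) = z by rewrite mulgA qq mul1g.
have -> : u1 * (q * (u2^-1 * (q * (x^-1 * q)))) =
          u1 * (q * (u2^-1 * (q * x^-1)) * q) by rewrite -!mulgA.
by rewrite -e -!mulgA qK mulVKg qq mulg1.
Qed.

(** This is the relation [picard_sq3] reversed by [square_eqV] and turned twice by r; the next
    square arises from [picard_sq4] in the same way. *)
Lemma square_10N_10N :
  square (K 1 0 (-1)%R) (K' 1 0 (-1)%R) (K 1 0 (-1)%R) (K' 1 0 (-1)%R).
Proof.
have sq : square (K (-1)%R 0 (-1)%R) (K' (-1)%R 0 (-1)%R)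
                 (K (-1)%R 0 (-1)%R) (K' (-1)%R 0 (-1)%R).
  exists (K 0 1 (-1)%R), (K' 0 1 (-1)%R), (K 0 1 (-1)%R), (K' 0 1 (-1)%R).
  split; [exact: cusp_pair_nf | exact: cusp_pair_nf | |].
    rewrite -[K 0 1 _ in LHS](shearV 0 (-1)%R 1 heisG) -(shearV 1 0 1 heisG).
    apply: square_eqV; first exact: picard_ss picG.
    by rewrite (shearV 1 0 1 heisG) /normal_form /= ?mulg1 ?mul1g (picard_sq3 picG).
  rewrite -[K' 0 1 _ in LHS](shearV 0 (-1)%R 1 heisP) -(shearV 1 0 1 heisP).
  apply: square_eqV; first exact: picard_ss picP.
  by rewrite (shearV 1 0 1 heisP) /normal_form /= ?mulg1 ?mul1g (picard_sq3 picP).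
by have := square_rot (square_rot sq); rewrite !(shear_rot _ _ _ heisG) !(shear_rot _ _ _ heisP).
Qed.

Lemma square_10N_0N1 :
  square (K 1 0 (-1)%R) (K' 1 0 (-1)%R) (K 0 (-1)%R 1) (K' 0 (-1)%R 1).
Proof.
have sq : square (K (-1)%R 0 (-1)%R) (K' (-1)%R 0 (-1)%R) (K 0 1 1) (K' 0 1 1).
  exists (K 0 (-1)%R (-1)%R), (K' 0 (-1)%R (-1)%R), (K 1 0 1), (K' 1 0 1).
  split; [exact: cusp_pair_nf | exact: cusp_pair_nf | |].
    rewrite -(shearV 0 1 1 heisG) -(shearV 1 0 1 heisG).
    apply: square_eqV; first exact: picard_ss picG.
    by rewrite /normal_form /= ?mulg1 ?mul1g (picard_sq4 picG).
  rewrite -(shearV 0 1 1 heisP) -(shearV 1 0 1 heisP).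
  apply: square_eqV; first exact: picard_ss picP.
  by rewrite /normal_form /= ?mulg1 ?mul1g (picard_sq4 picP).
by have := square_rot (square_rot sq); rewrite !(shear_rot _ _ _ heisG) !(shear_rot _ _ _ heisP).
Qed.

Lemma triangular_cusps h :
  h \in [:: shear 0 0 1; shear 0 0 (-1)%R; shear 1 0 0; shear 0 1 0;
            shear (-1)%R 0 0; shear 0 (-1)%R 0] -> triangular (nf h) (nf' h).
Proof.
rewrite !inE => /or4P[/eqP-> | /eqP-> | /eqP-> | /or3P[/eqP-> | /eqP-> | /eqP->]].
- exact: triangular001.
- exact: (triangularK_inv triangular001).
- exact: triangular100.
- exact: (triangularK_rot triangular100).
- exact: (triangularK_inv triangular100).
- exact: (triangularK_inv (triangularK_rot triangular100)).
Qed.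

Lemma square_cusps h h' :
  (h, h') \in [:: (shear 1 0 1, shear 0 1 (-1)%R); (shear 1 0 1, shear 1 0 1);
                  (shear 1 0 (-1)%R, shear 1 0 (-1)%R);
                  (shear 1 0 (-1)%R, shear 0 (-1)%R 1)] ->
  square (nf h) (nf' h) (nf h') (nf' h').
Proof.
rewrite !inE => /or4P[] /eqP[-> ->].
- exact: square_101_01N.
- exact: square_101_101.
- exact: square_10N_10N.
- exact: square_10N_0N1.
Qed.

(** A partial inverse up to a left factor: L turns right multiplication by a stabilizer element or
    by s into right multiplication by its counterpart in P, as long as the heights stay at most N.
    The value L 1 is left free. *)
Definition compatible (N : nat) (L : G -> P) : Prop :=
  forall g, D g -> (height g <= N)%N ->
    (forall x y, cusp_pair x y -> L (g * x) = L g * y) /\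
    ((height (g * s) <= N)%N -> L (g * s) = L g * s').

(** Elements of height 0 are stabilizer elements, on which L lifts normal forms. The condition on s
    is vacuous, as s leads from height 0 to positive height. *)
Lemma compatible0 : exists L, compatible 0 L.
Proof.
have ex g : exists y, D g -> height g = 0%N -> cusp_pair g y.
  have [[Dg g0]|n] := pselect (D g /\ height g = 0%N).
    by have [h ->] := height0 geo Dg g0; exists (nf' h) => *; apply: cusp_pair_nf.
  by exists 1 => Dg g0; case: n.
have [L Lg] := choice ex; exists L => g Dg; rewrite leqn0 => /eqP g0; split.
  move=> x y xy; have [h [ex' ey]] := xy.
  apply: (@cusp_pair_fun (g * x)); last by apply: cusp_pairM => //; apply: Lg.
  by apply: Lg; rewrite ex' ?(heightM geo) //; apply: (domM geo).
by rewrite leqn0 => /eqP gs0; case: (height0s geo Dg g0).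
Qed.

Lemma heightE g x y : D g -> cusp_pair x y -> height (g * x) = height g.
Proof. by move=> Dg [h [-> _]]; apply: (heightM geo). Qed.

Lemma domE g x y : D g -> cusp_pair x y -> D (g * x).
Proof. by move=> Dg [h [-> _]]; apply: (domM geo). Qed.

(** * Extension of the partial inverse from height N to height N + 1 *)

Section Step.
Variables (N : nat) (L : G -> P).
Hypothesis IH : compatible N L.

Lemma L_step g x y : D g -> (height g <= N)%N -> cusp_pair x y ->
  (height (g * x * s) <= N)%N -> L (g * x * s) = L g * y * s'.
Proof.
move=> Dg gN xy gxs; have [Lx _] := IH Dg gN.
have Dgx := domE Dg xy.
have [|_ ->] := IH Dgx _; first by rewrite (heightE Dg xy).
  by rewrite (Lx _ y).
by [].
Qed.

Lemma L_cusp g x y : D g -> (height g <= N)%N -> cusp_pair x y ->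
  L (g * x) = L g * y.
Proof. by move=> Dg gN; have [Lx _] := IH Dg gN; apply: Lx. Qed.

(* Descending from [g] through [g * s] and through [g * x * s] gives the same
   extension of [L]. *)
Definition linked (x : G) (y : P) : Prop :=
  forall g, D g -> height g = N.+1 -> (height (g * s) <= N)%N ->
    (height (g * x * s) <= N)%N -> L (g * s) * s' * y = L (g * x * s) * s'.

Lemma linkedV x y : cusp_pair x y -> linked x y -> linked x^-1 y^-1.
Proof.
move=> xy lk g Dg gN gs gxs; have xyV := cusp_pairV xy.
have Dgx := domE Dg xyV.
have := lk _ Dgx; rewrite (heightE Dg xyV) => /(_ gN gxs).
by rewrite mulgVK => /(_ gs) <-; rewrite mulgK.
Qed.

Lemma linked_rot k x y : linked x y -> cusp_pair x y ->
  linked (r ^+ k * x * r ^- k) (r' ^+ k * y * r' ^- k).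
Proof.
move=> lk xy g Dg gN gs gxs.
have rk := cusp_pairr k; have rkV := cusp_pairV rk.
have Dgs := doms geo Dg.
have rsV : commute (r ^- k) s.
  by apply/commute_sym/commuteV/commute_sym/rs_comm.
have Dgr := domE Dg rk.
have e1 : g * r ^+ k * s = g * s * r ^+ k by rewrite -!mulgA rs_comm.
have e2 : g * (r ^+ k * x * r ^- k) * s = g * r ^+ k * x * s * r ^- k.
  by rewrite -!mulgA rsV.
have Dgrxs : D (g * r ^+ k * x * s) by apply: (doms geo); apply: domE xy.
rewrite e2 (heightE Dgrxs rkV) in gxs.
rewrite e2 (L_cusp Dgrxs gxs rkV).
have := lk _ Dgr; rewrite (heightE Dg rk) e1 (heightE Dgs rk) => /(_ gN gs gxs).
rewrite (L_cusp Dgs gs rk) => e3.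
have rsV' : commute (r' ^- k) s'.
  by apply/commute_sym/commuteV/commute_sym/rs_comm'.
rewrite -[RHS]mulgA rsV' [RHS]mulgA -e3 !mulgA.
by rewrite -[in RHS](mulgA _ _ s') rs_comm' !mulgA.
Qed.

Lemma linked_r k x y : cusp_pair x y -> linked x y ->
  linked (x * r ^+ k) (y * r' ^+ k).
Proof.
move=> xy lk g Dg gN gs.
have e1 : g * (x * r ^+ k) * s = g * x * s * r ^+ k by rewrite -!mulgA rs_comm.
have rk := cusp_pairr k.
have Dgxs : D (g * x * s) by apply: (doms geo); apply: domE xy.
rewrite e1 (heightE Dgxs rk) => gxs; rewrite (L_cusp Dgxs gxs rk).
by rewrite mulgA (lk g) // -!mulgA rs_comm'.
Qed.

(** Two links compose when the intermediate neighbour g x s infty is itself low, since the second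
    link is applied at g x. *)
Lemma linked_chain x y x1 y1 g : cusp_pair x y ->
  linked x y -> linked x1 y1 -> D g -> height g = N.+1 ->
  (height (g * s) <= N)%N -> (height (g * x * s) <= N)%N ->
  (height (g * (x * x1) * s) <= N)%N ->
  L (g * s) * s' * (y * y1) = L (g * (x * x1) * s) * s'.
Proof.
move=> xy lk lk1 Dg gN gs gxs.
rewrite !mulgA => gxxs; rewrite (lk g) //.
apply: lk1 => //; first exact: domE xy.
by rewrite (heightE Dg xy).
Qed.

(** The edge of the triangle opposite to g infty joins two low cusps, and L is already compatible
    along it. *)
Lemma linked_triangle x y : cusp_pair x y -> triangular x y -> linked x y.
Proof.
move=> xy [u [v [u1 [v1 [uv uv1 e e']]]]] g Dg gN gs gxs.
have Dgs := doms geo Dg; have Dgsu := domE Dgs uv.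
have Dgsus := doms geo Dgsu.
have eg : g * x * s = g * s * u * s * u1.
  by rewrite -!mulgA (mulgA u s) -e -mulgA (mulgA s s) (picard_ss picG) mul1g.
rewrite eg (heightE Dgsus uv1) in gxs.
rewrite eg (L_cusp Dgsus gxs uv1) (L_step Dgs gs uv gxs) -!mulgA; congr (_ * _).
by rewrite (mulgA s' v1) (mulgA v) (mulgA v s') -e' -!mulgA (picard_ss picP) mulg1.
Qed.

(** With the fourth vertex low as well, L is compatible along the two edges of the square that avoid
    g infty. *)
Lemma linked_square_at g x y u v :
  cusp_pair x y -> cusp_pair u v -> square x y u v ->
  D g -> (height (g * s) <= N)%N -> (height (g * x * s) <= N)%N ->
  (height (g * s * u * s) <= N)%N -> L (g * s) * s' * y = L (g * x * s) * s'.
Proof.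
move=> xy uv [u1 [v1 [u2 [v2 [uv1 uv2 e e']]]]] Dg gs gxs gsus.
have Dgs := doms geo Dg; have Dgsus := doms geo (domE Dgs uv).
have Dgxs := doms geo (domE Dg xy).
have eg : g * s * u * s * u1 * s = g * x * s * u2.
  by rewrite -!mulgA; congr (_ * _); rewrite !mulgA.
have low3 : (height (g * s * u * s * u1 * s) <= N)%N.
  by rewrite eg (heightE Dgxs uv2).
have := L_step Dgsus gsus uv1 low3.
rewrite eg (L_cusp Dgxs gxs uv2) (L_step Dgs gs uv gsus) => /(canRL (mulgK _)) ->.
rewrite -[L (g * s) in RHS]mulg1 -(picard_ss picP) -!mulgA; congr (_ * (_ * _)).
have -> : s' * (v * (s' * (v1 * (s' * (v2^-1 * s'))))) =
   s' * v * s' * v1 * s' * v2^-1 * s' by rewrite !mulgA.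
by rewrite e' mulgK -mulgA (picard_ss picP) mulg1.
Qed.

Definition linkedK m n t : Prop := linked (K m n t) (nf' (shear m n t)).

Lemma linkedK_rot m n t : linkedK m n t -> linkedK (- n)%R m t.
Proof.
move=> lk; have := @linked_rot 1%N _ _ lk (cusp_pair_nf _).
by rewrite !expg1 (shear_rot _ _ _ heisG) (shear_rot _ _ _ heisP).
Qed.

Lemma linkedK_inv m n t : linkedK m n t -> linkedK (- m)%R (- n)%R (- t)%R.
Proof.
by move=> /(linkedV (cusp_pair_nf _)); rewrite (shearV _ _ _ heisG) (shearV _ _ _ heisP).
Qed.

Lemma linkedK_chain m n t m' n' t' g :
  linkedK m n t -> linkedK m' n' t' -> D g -> height g = N.+1 ->
  (height (g * s) <= N)%N -> (height (g * K m n t * s) <= N)%N ->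
  let h := shear (m + m') (n + n') (t + t' + 2 * (n * m') - 2 * (m * n'))%R in
  (height (g * nf h * s) <= N)%N ->
  L (g * s) * s' * nf' h = L (g * nf h * s) * s'.
Proof.
move=> lk lk' Dg gN gs gxs h; rewrite -(shearM _ _ _ _ _ _ heisG) => gxxs.
rewrite -(shearM _ _ _ _ _ _ heisP).
exact: (linked_chain (cusp_pair_nf _) lk lk').
Qed.

Lemma linkedK001 : linkedK 0 0 1.
Proof. exact: linked_triangle (cusp_pair_nf _) triangular001. Qed.

Lemma linkedK100 : linkedK 1 0 0.
Proof. exact: linked_triangle (cusp_pair_nf _) triangular100. Qed.

(** In the first two cases the low cusp is an intermediate neighbour and two triangles suffice; in
    the others it is the fourth vertex of a square. *)
Lemma linkedK101 : linkedK 1 0 1.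
Proof.
move=> g Dg gN gs gxs; have := near101 geo Dg; rewrite gN !ltnS => /(_ gs gxs).
have sq := linked_square_at (cusp_pair_nf _) (cusp_pair_nf _).
case=> low.
- exact: (linkedK_chain linkedK001 linkedK100).
- exact: (linkedK_chain linkedK100 linkedK001).
- exact: sq square_101_01N Dg gs gxs low.
- exact: sq square_101_101 Dg gs gxs low.
Qed.

Lemma linkedK110 : linkedK 1 1 0.
Proof.
move=> g Dg gN gs gxs; have := near110 geo Dg; rewrite gN !ltnS => /(_ gs gxs).
have sq := linked_square_at (cusp_pair_nf _) (cusp_pair_nf _).
case=> low; first exact: sq square_110_01N Dg gs gxs low.
exact: sq square_110_101 Dg gs gxs low.
Qed.

Lemma linkedK010 : linkedK 0 1 0.
Proof. exact: (linkedK_rot linkedK100). Qed.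

Lemma linkedK0N0 : linkedK 0 (-1)%R 0.
Proof. exact: (linkedK_inv linkedK010). Qed.

Lemma linkedK1N0 : linkedK 1 (-1)%R 0.
Proof. exact: (linkedK_rot (linkedK_rot (linkedK_rot linkedK110))). Qed.

Lemma linkedK10N : linkedK 1 0 (-1)%R.
Proof. exact: (linkedK_rot (linkedK_rot (linkedK_inv linkedK101))). Qed.

Lemma linkedK01N : linkedK 0 1 (-1)%R.
Proof. exact: (linkedK_rot linkedK10N). Qed.

Lemma linkedK112 : linkedK 1 1 2.
Proof.
move=> g Dg gN gs gxs; have := near112 geo Dg; rewrite gN !ltnS => /(_ gs gxs).
move=> low; exact: (linkedK_chain linkedK010 linkedK100).
Qed.

(** All four cases pass through an intermediate neighbour. In the last two, the vertical coordinate
    2 is the commutator term of two horizontal translations. *)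
Lemma linkedK102 : linkedK 1 0 2.
Proof.
move=> g Dg gN gs gxs; have := near102 geo Dg; rewrite gN !ltnS => /(_ gs gxs).
case=> low.
- exact: (linkedK_chain linkedK001 linkedK101).
- exact: (linkedK_chain linkedK101 linkedK001).
- exact: (linkedK_chain linkedK010 linkedK1N0).
- exact: (linkedK_chain linkedK110 linkedK0N0).
Qed.

Lemma linkedK111 : linkedK 1 1 1.
Proof.
move=> g Dg gN gs gxs; have := near111 geo Dg; rewrite gN !ltnS => /(_ gs gxs).
case=> low.
- exact: (linkedK_chain linkedK01N linkedK100).
- exact: (linkedK_chain linkedK010 linkedK10N).
- exact: (linkedK_chain linkedK110 linkedK001).
Qed.

Lemma linkedK_apart m n t :
  (m, n, t) \in [:: (0, 0, 2); (0, 0, 3); (0, 0, 4); (1, 0, 3); (1, 0, 4);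
                    (1, 1, 3); (1, 1, 4)]%R -> linkedK m n t.
Proof.
move=> far g Dg gN gs gxs; have := apart geo Dg _ far.
by rewrite gN ltnS => /(_ gs); rewrite ltnNge gxs.
Qed.

Lemma linkedK000 : linkedK 0 0 0.
Proof.
by move=> g Dg gN gs gxs; rewrite /normal_form /= ?mulg1.
Qed.

(** Inversion followed by a half turn fixes (m, n) and negates t, and quarter turns permute the
    pairs (m, n). This leaves 0 <= t <= 4 and the pairs (0, 0), (1, 0), (1, 1). *)
Lemma linkedK_all m n t : [&& `|m|%N <= 1, `|n|%N <= 1 & `|t|%N <= 4]%N ->
  linkedK m n t.
Proof.
have opp q : linkedK 1 0 q -> linkedK 1 0 (- q)%R.
  by move=> /linkedK_inv/linkedK_rot/linkedK_rot.
have opp' q : linkedK 1 1 q -> linkedK 1 1 (- q)%R.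
  by move=> /linkedK_inv/linkedK_rot/linkedK_rot.
have cases (Q : int -> Prop) : (forall q, Q q -> Q (- q)%R) ->
    Q 0%R -> Q 1%R -> Q 2%R -> Q 3%R -> Q 4%R -> (`|t| <= 4)%N -> Q t.
  move=> QN Q0 Q1 Q2 Q3 Q4; case: t => -[|[|[|[|[|k]]]]] //= _.
  - exact: (QN _ Q1).
  - exact: (QN _ Q2).
  - exact: (QN _ Q3).
  - exact: (QN _ Q4).
case/and3P => m1 n1 t4.
have l00 : linkedK 0 0 t.
  apply: (cases (linkedK 0 0)) => // [q /linkedK_inv //||||| ].
  - exact: linkedK000.
  - exact: linkedK001.
  - exact: linkedK_apart.
  - exact: linkedK_apart.
  - exact: linkedK_apart.
have l10 : linkedK 1 0 t.
  apply: (cases (linkedK 1 0)) => //.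
  - exact: linkedK100.
  - exact: linkedK101.
  - exact: linkedK102.
  - exact: linkedK_apart.
  - exact: linkedK_apart.
have l11 : linkedK 1 1 t.
  apply: (cases (linkedK 1 1)) => //.
  - exact: linkedK110.
  - exact: linkedK111.
  - exact: linkedK112.
  - exact: linkedK_apart.
  - exact: linkedK_apart.
case: m n m1 n1 => -[|[|m]] // [] [|[|n]] //= _ _.
- exact: (linkedK_rot l10).
- exact: (linkedK_rot (linkedK_rot (linkedK_rot l10))).
- exact: (linkedK_rot (linkedK_rot (linkedK_rot l11))).
- exact: (linkedK_rot (linkedK_rot l10)).
- exact: (linkedK_rot l11).
- exact: (linkedK_rot (linkedK_rot l11)).
Qed.

(** [near_cusps] leaves finitely many translations; the remaining factor r^k commutes with s and is
    absorbed by the compatibility of L with the stabilizer. *)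
Lemma linked_cusp g x y : cusp_pair x y -> D g -> height g = N.+1 ->
  (height (g * s) <= N)%N -> (height (g * x * s) <= N)%N ->
  L (g * s) * s' * y = L (g * x * s) * s'.
Proof.
move=> [[[[m n] t'] k] [-> ->]] Dg gN gs.
pose t := (t' - 2 * (m * n))%R.
have -> : t' = (t + 2 * (m * n))%R by rewrite /t GRing.subrK.
move=> gxs; have := @near_cusps geo g m n t k Dg.
rewrite gN !ltnS => /(_ gs gxs)/linkedK_all lk.
have nfr (Q : groupType) (A B C q : Q) :
    normal_form A B C q (m, n, (t + 2 * (m * n))%R, k) =
    normal_form A B C q (shear m n t) * q ^+ k.
  by rewrite /normal_form /= mulg1.
rewrite !nfr in gxs *.
exact: (linked_r (cusp_pair_nf _) lk).
Qed.

Lemma linked_independent g x y x1 y1 : cusp_pair x y -> cusp_pair x1 y1 ->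
  D g -> height g = N.+1 ->
  (height (g * x * s) <= N)%N -> (height (g * x1 * s) <= N)%N ->
  L (g * x * s) * s' * y^-1 = L (g * x1 * s) * s' * y1^-1.
Proof.
move=> xy xy1 Dg gN gxs gx1s.
have Dgx := domE Dg xy.
have := @linked_cusp (g * x) _ _ (cusp_pairM (cusp_pairV xy) xy1) Dgx.
rewrite (heightE Dg xy) mulgA mulgK => /(_ gN gxs gx1s) <-.
by rewrite mulgA mulgK.
Qed.

Lemma compatibleS : exists L', compatible N.+1 L'.
Proof.
have ex g : exists h, D g -> height g = N.+1 -> (height (g * nf h * s) <= N)%N.
  have [[Dg gN]|n] := pselect (D g /\ height g = N.+1).
    have [|h hlow] := descend geo Dg; first by rewrite gN.
    by exists h => _ _; rewrite -ltnS -gN.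
  by exists (0, 0, 0, 0%N)%R => Dg gN; case: n.
(* The descending neighbour is chosen arbitrarily; by [linked_independent] every other one gives the
   same value, which is [L'top]. *)
have [c low] := choice ex.
pose L' g := if (height g <= N)%N then L g
             else L (g * nf (c g) * s) * s' * (nf' (c g))^-1.
have L'low g : (height g <= N)%N -> L' g = L g by rewrite /L' => ->.
have L'top g x y : D g -> height g = N.+1 -> cusp_pair x y ->
    (height (g * x * s) <= N)%N -> L' g = L (g * x * s) * s' * y^-1.
  move=> Dg gN xy gxs; rewrite /L' gN ltnn.
  exact: (linked_independent (cusp_pair_nf _) xy Dg gN (low g Dg gN)).
have L'cusp g x y : D g -> (height g <= N.+1)%N -> cusp_pair x y ->
    L' (g * x) = L' g * y.
  move=> Dg gN xy; have [gN'|gN'] := leqP (height g) N.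
    by rewrite !L'low ?(heightE Dg xy) ?(L_cusp Dg gN' xy).
  have {gN gN'}gN : height g = N.+1 by apply/eqP; rewrite eqn_leq gN.
  have Dgx := domE Dg xy; have gxN : height (g * x) = N.+1 by rewrite (heightE Dg xy).
  have xyc := cusp_pairM xy (cusp_pair_nf (c (g * x))).
  have lowc := low _ Dgx gxN.
  rewrite (L'top (g * x) _ _ Dgx gxN (cusp_pair_nf _) lowc).
  rewrite (L'top g _ _ Dg gN xyc); last by rewrite mulgA.
  by rewrite (invgM y) !mulgA mulgVK.
exists L' => g Dg gN; split; first by move=> x y; apply: L'cusp.
move=> gsN; have Dgs := doms geo Dg.
have gss : g * s * s = g by rewrite -mulgA (picard_ss picG) mulg1.
(* An edge with one low end is harmless, because the low end is a descending neighbour of the other.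
   Only an edge with both ends at height N + 1 needs a polygon. *)
have [gN'|gN'] := leqP (height g) N; have [gsN'|gsN'] := leqP (height (g * s)) N.
- by rewrite !L'low //; have [_] := IH Dg gN'; apply.
- have {gsN gsN'}gsN : height (g * s) = N.+1 by apply/eqP; rewrite eqn_leq gsN.
  rewrite (L'top _ 1 1 Dgs gsN cusp_pair1) mulg1 gss // L'low //.
  by rewrite invg1 mulg1.
- have {gN gN'}gN : height g = N.+1 by apply/eqP; rewrite eqn_leq gN.
  rewrite (L'top _ 1 1 Dg gN cusp_pair1) mulg1 // L'low //.
  by rewrite invg1 mulg1 -mulgA (picard_ss picP) mulg1.
have {gN gN'}gN : height g = N.+1 by apply/eqP; rewrite eqn_leq gN.
have {gsN gsN'}gsN : height (g * s) = N.+1 by apply/eqP; rewrite eqn_leq gsN.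
have [] := tie geo Dg; rewrite gN ?gsN // => j.
have rj := cusp_pairr j; have Dgr := domE Dg rj.
have grN : height (g * r ^+ j) = N.+1 by rewrite (heightE Dg rj).
have grs : g * r ^+ j * s = g * s * r ^+ j by rewrite -!mulgA rs_comm.
have grsN : height (g * r ^+ j * s) = N.+1 by rewrite grs (heightE Dgs rj).
(* As r commutes with s, the edge may be turned by r^j before the polygon is applied. *)
suff main : (exists h, h \in [:: shear 0 0 1; shear 0 0 (-1)%R; shear 1 0 0;
                           shear 0 1 0; shear (-1)%R 0 0; shear 0 (-1)%R 0]
         /\ (height (g * r ^+ j * nf h * s) < N.+1)%N)
      \/ (exists h h', (h, h') \in [:: (shear 1 0 1, shear 0 1 (-1)%R);
                                (shear 1 0 1, shear 1 0 1);
                                (shear 1 0 (-1)%R, shear 1 0 (-1)%R);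
                                (shear 1 0 (-1)%R, shear 0 (-1)%R 1)]
         /\ (height (g * r ^+ j * nf h * s) < N.+1)%N
         /\ (height (g * r ^+ j * s * nf h' * s) < N.+1)%N) ->
    L' (g * r ^+ j * s) = L' (g * r ^+ j) * s'.
  move=> /main; rewrite grs (L'cusp _ _ _ Dgs _ rj) ?gsN //.
  rewrite (L'cusp _ _ _ Dg _ rj) ?gN // -[RHS]mulgA rs_comm' mulgA.
  exact: mulIg.
move: (g * r ^+ j) Dgr grN grsN => {gN gsN Dgs gss grs Dg rj}g.
move=> Dg gN gsN; have Dgs := doms geo Dg.
case=> [[h [htri low_h]]|[h [h' [hsq [low_h low_h']]]]].
  have [u [v [u1 [v1 [uv uv1 e e']]]]] := triangular_cusps htri.
  (* The third vertex of the triangle is a descending neighbour of both ends of the edge. *)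
  have eg : g * nf h * s * u1^-1 = g * s * u * s.
    apply: (mulIg u1); rewrite mulgVK -!mulgA (mulgA u s) -e -!mulgA (mulgA s s).
    by rewrite (picard_ss picG) mul1g.
  have Dghs := doms geo (domM geo h Dg).
  have low1 : (height (g * s * u * s) <= N)%N.
    by rewrite -eg (heightE Dghs (cusp_pairV uv1)).
  rewrite (L'top _ _ _ Dgs gsN uv low1) (L'top _ _ _ Dg gN (cusp_pair_nf h) low_h).
  rewrite -eg (L_cusp Dghs low_h (cusp_pairV uv1)) -!mulgA; congr (_ * _).
  apply: invg_inj; rewrite !invgM !invgK (mulg1_eq (picard_ss picP)) mulgA -e'.
  by rewrite mulgA.
have uv := cusp_pair_nf h'.
have [u1 [v1 [u2 [v2 [uv1 uv2 e e']]]]] := square_cusps hsq.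
have Dghs := doms geo (domM geo h Dg).
have Dg1 := doms geo (domM geo h' Dgs).
(* Each end descends to its own vertex of the square, and these two low vertices are adjacent. *)
have eg : g * nf h * s = g * s * nf h' * s * (u1 * s * u2^-1).
  apply: (mulIg u2); transitivity (g * (nf h * s * u2)); first by rewrite !mulgA.
  by rewrite -e !mulgA mulgVK.
have low2 : (height (g * s * nf h' * s * u1 * s) <= N)%N.
  rewrite -(heightE (doms geo (domE Dg1 uv1)) (cusp_pairV uv2)).
  by rewrite -(mulgA _ u1) -(mulgA _ (u1 * s)) -eg.
rewrite (L'top _ _ _ Dgs gsN uv low_h') (L'top _ _ _ Dg gN (cusp_pair_nf h) low_h).
rewrite eg (mulgA _ (u1 * s)) (mulgA _ u1).
rewrite (L_cusp (doms geo (domE Dg1 uv1)) low2 (cusp_pairV uv2)).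
rewrite (L_step Dg1 low_h' uv1 low2) -!mulgA; congr (_ * _).
exact: square_eq_end (picard_ss picP) e'.
Qed.

End Step.

Lemma compatible_all N : exists L, compatible N L.
Proof. by elim: N => [|N [L /compatibleS]]; first exact: compatible0. Qed.

(** * From partial inverses to injectivity and surjectivity *)

Hypothesis generated_by_cusps : forall Q : P -> Prop,
  Q 1 -> (forall u h, Q u -> Q (u * nf' h)) -> (forall u, Q u -> Q (u * s')) ->
  forall u, Q u.

Variable f : UMagmaMorphism.type P G.
Hypothesis f_nf : forall h, f (nf' h) = nf h.
Hypothesis f_s : f s' = s.

Lemma domf g u : D g -> D (g * f u).
Proof.
move=> Dg; elim/generated_by_cusps: u => [|u h Du|u Du].
- by rewrite gmulf1 mulg1.
- by rewrite gmulfM mulgA f_nf; apply: (domM geo).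
- by rewrite gmulfM mulgA f_s; apply: (doms geo).
Qed.

(** N0 bounds the heights met along a path from 1 to f u that spells u, so L can be followed along
    this path. *)
Lemma compatible_follows u : exists N0, forall N L, (N0 <= N)%N -> compatible N L ->
  L (f u) = L 1 * u.
Proof.
have D1 := dom1 geo; have Df v : D (f v) by rewrite -[f v]mul1g; apply: domf.
elim/generated_by_cusps: u => [|u h [N0 Lu]|u [N0 Lu]].
- by exists 0%N => N L _ _; rewrite gmulf1 mulg1.
- exists (maxn N0 (height (f u))) => N L; rewrite geq_max => /andP[N0N hN] LN.
  rewrite gmulfM f_nf; have [Lc _] := LN _ (Df u) hN.
  rewrite (Lc _ (nf' h) (cusp_pair_nf h)) (Lu N _ N0N LN).
  exact: (esym (mulgA _ _ _)).
- exists (maxn N0 (maxn (height (f u)) (height (f u * s)))) => N L.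
  rewrite !geq_max => /and3P[N0N hN hsN] LN.
  rewrite gmulfM f_s; have [_ ->] := LN _ (Df u) hN => //.
  by rewrite (Lu N _ N0N LN) mulgA.
Qed.

Theorem descent_injective : injective f.
Proof.
apply: gmulf_inj => u fu; have [N0 LN0] := compatible_follows u.
have [L LN] := compatible_all N0.
have := LN0 _ _ (leqnn _) LN; rewrite fu => e.
by apply: (mulgI (L 1)); rewrite mulg1 -e.
Qed.

Theorem descent_surjective g : D g -> exists u, f u = g.
Proof.
have [N] := ubnP (height g); elim: N g => // N IHN g hN Dg.
have [g0|] := posnP (height g).
  by have [h ->] := height0 geo Dg g0; exists (nf' h); rewrite f_nf.
move=> /(descend geo Dg)[h low].
have [|u fu] := IHN _ (leq_trans low hN); first exact: (doms geo (domM geo h Dg)).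
exists (u * s' * (nf' h)^-1).
by rewrite gmulfM gmulfV gmulfM f_nf f_s fu -(mulgA _ s s) (picard_ss picG) mulg1 mulgK.
Qed.

End Descent.

(** * Gaussian matrices *)

Section GaussianMatrices.
Local Open Scope Z_scope.

(** Lists of pairs of binary integers make identities between explicit matrices decidable by
    computation; [ofGmx] carries them to complex matrices. *)
Definition gauss : Type := Z * Z.
Definition gadd (x y : gauss) : gauss := (x.1 + y.1, x.2 + y.2).
Definition gmul (x y : gauss) : gauss :=
  (x.1 * y.1 - x.2 * y.2, x.1 * y.2 + x.2 * y.1).
Definition gconj (x : gauss) : gauss := (x.1, - x.2).

Definition gmx : Type := seq (seq gauss).
Definition gentry (A : gmx) (i j : nat) : gauss := nth (0, 0) (nth [::] A i) j.
Definition gmatrix (E : nat -> nat -> gauss) : gmx :=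
  [seq [seq E i j | j <- iota 0 3] | i <- iota 0 3].
Definition gmulmx (A B : gmx) : gmx := gmatrix (fun i j =>
  gadd (gadd (gmul (gentry A i 0) (gentry B 0 j))
             (gmul (gentry A i 1) (gentry B 1 j)))
       (gmul (gentry A i 2) (gentry B 2 j))).
Definition gadjmx (A : gmx) : gmx := gmatrix (fun i j => gconj (gentry A j i)).
Definition gscale (c : gauss) (A : gmx) : gmx :=
  gmatrix (fun i j => gmul c (gentry A i j)).

Definition gJ : gmx :=
  [:: [:: (0, 0); (0, 0); (1, 0)]; [:: (0, 0); (1, 0); (0, 0)];
      [:: (1, 0); (0, 0); (0, 0)]].
Definition g1 : gmx :=
  [:: [:: (1, 0); (0, 0); (0, 0)]; [:: (0, 0); (1, 0); (0, 0)];
      [:: (0, 0); (0, 0); (1, 0)]].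
Definition ga : gmx :=
  [:: [:: (0, -1); (0, 0); (-1, 0)]; [:: (-1, 1); (-1, 0); (1, 1)];
      [:: (-1, 1); (-1, 1); (1, 0)]].
Definition gb : gmx :=
  [:: [:: (-1, 0); (0, 0); (0, 1)]; [:: (1, 1); (1, 0); (1, -1)];
      [:: (1, 0); (1, -1); (-1, -1)]].
Definition gX : gmx :=
  [:: [:: (1, 0); (-1, 1); (-1, 0)]; [:: (0, 0); (1, 0); (1, 1)];
      [:: (0, 0); (0, 0); (1, 0)]].
Definition gY : gmx :=
  [:: [:: (1, 0); (1, 1); (-1, 0)]; [:: (0, 0); (1, 0); (-1, 1)];
      [:: (0, 0); (0, 0); (1, 0)]].
Definition gZ : gmx :=
  [:: [:: (1, 0); (0, 0); (0, 1)]; [:: (0, 0); (1, 0); (0, 0)];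
      [:: (0, 0); (0, 0); (1, 0)]].
Definition gr : gmx :=
  [:: [:: (1, 0); (0, 0); (0, 0)]; [:: (0, 0); (0, 1); (0, 0)];
      [:: (0, 0); (0, 0); (1, 0)]].
Definition gs : gmx :=
  [:: [:: (0, 0); (0, 0); (1, 0)]; [:: (0, 0); (-1, 0); (0, 0)];
      [:: (1, 0); (0, 0); (0, 0)]].

Definition ginv (A : gmx) : gmx := gmulmx gJ (gmulmx (gadjmx A) gJ).
Definition gunitary (A : gmx) : bool := gmulmx (gmulmx (gadjmx A) gJ) A == gJ.

(** The scalars are the units of Z[i]. The factor [g1] leaves the entries unchanged and gives the
    left side the list shape that [gscale] produces. *)
Definition gproportional (A B : gmx) : bool :=
  has (fun c => gmulmx g1 A == gscale c B) [:: (1, 0); (0, 1); (-1, 0); (0, -1)].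

End GaussianMatrices.

Section GaussianModel.
Variable R : realType.
Local Open Scope ring_scope.
Local Open Scope complex_scope.
Local Open Scope sesquilinear_scope.
Import Order.TTheory GRing.Theory Num.Theory.
Local Notation C := R[i].

Definition ofG (x : gauss) : C := ofZ R x.1 +i* ofZ R x.2.

Definition ofGmx (A : gmx) : 'M[C]_3 := \matrix_(i, j) ofG (gentry A i j).

Lemma ofGD x y : ofG (gadd x y) = ofG x + ofG y.
Proof. by apply/eqP; rewrite eq_complex /= !ofZD !eqxx. Qed.

Lemma ofGM x y : ofG (gmul x y) = ofG x * ofG y.
Proof. by apply/eqP; rewrite eq_complex /= ofZB ofZD !ofZM !eqxx. Qed.

Lemma ofG_conj x : ofG (gconj x) = Num.conj (ofG x).
Proof. by apply/eqP; rewrite eq_complex /= ofZN !eqxx. Qed.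

Lemma gentry_matrix E (i j : 'I_3) : gentry (gmatrix E) i j = E i j.
Proof. by case: i => [[|[|[|]]]] //= ?; case: j => [[|[|[|]]]]. Qed.

Lemma ofGmxM A B : ofGmx (gmulmx A B) = ofGmx A *m ofGmx B.
Proof.
apply/matrixP=> i j; rewrite !mxE !big_ord_recl big_ord0 !mxE.
by rewrite gentry_matrix !ofGD !ofGM addr0 addrA.
Qed.

Lemma ofGmx_adj A : ofGmx (gadjmx A) = (ofGmx A) ^t*.
Proof. by apply/matrixP=> i j; rewrite !mxE gentry_matrix ofG_conj. Qed.

Lemma ofGmxZ c A : ofGmx (gscale c A) = ofG c *: ofGmx A.
Proof. by apply/matrixP=> i j; rewrite !mxE gentry_matrix ofGM. Qed.

Ltac matrix_entries := apply/matrixP;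
  let i := fresh "i" in let j := fresh "j" in move=> i j; rewrite !mxE;
  case: i => [[|[|[|//]]] ?]; case: j => [[|[|[|//]]] ?] /=;
  apply/eqP; rewrite eq_complex /= ?(oppr0, addr0, add0r, subr0, sub0r, opprK) ?eqxx.

Lemma ofGmx_J : ofGmx gJ = J R.
Proof. by matrix_entries. Qed.

Lemma ofGmx_1 : ofGmx g1 = 1%:M.
Proof. by matrix_entries. Qed.

Lemma ofGmx_a : ofGmx ga = mx_a R.
Proof. by matrix_entries. Qed.

Lemma ofGmx_b : ofGmx gb = mx_b R.
Proof. by matrix_entries. Qed.

Lemma gunitaryP A : gunitary A -> unitaryJ (ofGmx A).
Proof.
move=> /eqP uA; apply: unitaryJ_adj.
by rewrite -ofGmx_J -ofGmx_adj -!ofGmxM uA.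
Qed.

Definition UJ_of (A : gmx) (uA : gunitary A) : UJ R := MkUJ (gunitaryP uA).

Definition represents (A : UJ R) (M : gmx) : Prop := UJmx A = ofGmx M.

Lemma represents1 : represents 1%g g1.
Proof. by rewrite /represents ofGmx_1. Qed.

Lemma representsM A B M N : represents A M -> represents B N ->
  represents (A * B)%g (gmulmx M N).
Proof. by rewrite /represents ofGmxM => <- <-. Qed.

Lemma JJ : J R *m J R = 1%:M.
Proof.
by rewrite -ofGmx_J -ofGmxM -ofGmx_1.
Qed.

Lemma UJ_invE (A : UJ R) : UJmx A^-1%g = J R *m ((UJmx A) ^t* *m J R).
Proof.
have /andP[uA /eqP JA] := valP A.
rewrite /= -[LHS]mul1mx -JJ -!mulmxA; congr (_ *m _).
by rewrite -[X in X *m _]JA mulmxK // .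
Qed.

Lemma representsV A M : represents A M -> represents A^-1%g (ginv M).
Proof.
by rewrite /represents UJ_invE /ginv !ofGmxM ofGmx_adj ofGmx_J => ->.
Qed.

Lemma PUclass_eq A B M N : represents A M -> represents B N ->
  gproportional M N -> PUclass A = PUclass B.
Proof.
move=> AM BN /hasP[c _ /eqP e]; apply/PUclassP; exists (ofG c).
by rewrite AM BN -ofGmxZ -e ofGmxM ofGmx_1 mul1mx.
Qed.

End GaussianModel.

(** * Matrices of the stabilizer of infty *)

Section CuspMatrices.
Variable R : realType.
Local Open Scope ring_scope.
Local Open Scope complex_scope.
Local Open Scope sesquilinear_scope.
Import Order.TTheory GRing.Theory Num.Theory.
Local Notation C := R[i].

(** The shape of an element of U(J) fixing infty, scaled to last diagonal entry 1: orthogonality of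
    the last two columns for J forces the entry -conj(w) u. *)
Definition tmx (w z u : C) : 'M[C]_3 :=
  mx3 [:: [:: 1; - (Num.conj w * u); z]; [:: 0; u; w]; [:: 0; 0; 1]].

Lemma tmxM w z u w' z' u' : Num.conj u * u = 1 ->
  tmx w z u *m tmx w' z' u' =
  tmx (w + u * w') (z + z' - Num.conj w * u * w') (u * u').
Proof.
move=> u1; apply/matrixP=> i j; rewrite !mxE !big_ord_recl big_ord0 !mxE.
case: i => [[|[|[|//]]] ?]; case: j => [[|[|[|//]]] ?] /=;
  rewrite ?rmorphD ?rmorphM /=; try by ring.
by ring: u1.
Qed.

Lemma tmx1 : tmx 0 0 1 = 1%:M.
Proof.
apply/matrixP=> i j; rewrite !mxE.
by case: i => [[|[|[|//]]] ?]; case: j => [[|[|[|//]]] ?] /=;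
  rewrite ?rmorph0 ?mul0r ?oppr0.
Qed.

Lemma UJmxM (A B : UJ R) : UJmx (A * B)%g = UJmx A *m UJmx B.
Proof. by []. Qed.

Lemma UJmx_expz (A : UJ R) (F : int -> 'M[C]_3) n :
  F 0 = 1%:M -> UJmx A = F 1 -> (forall m k, F (m + k) = F m *m F k) ->
  UJmx (expz A n) = F n.
Proof.
move=> F0 F1 FD.
have Fn (k : nat) : UJmx (A ^+ k)%g = F k.
  elim: k => [|k IH]; first by rewrite F0.
  by rewrite expgSr UJmxM IH F1 -FD -PoszD addn1.
case: n => k; rewrite /expz ?Fn //.
have Fk : F (Negz k) *m F k.+1 = 1%:M by rewrite -FD NegzE addNr F0.
have uF : F k.+1 \in unitmx by rewrite -Fn UJ_unit.
by rewrite [LHS]/= Fn -[LHS]mul1mx -Fk mulmxK.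
Qed.

Lemma gX_unitary : gunitary gX. Proof. by vm_compute. Qed.
Lemma gY_unitary : gunitary gY. Proof. by vm_compute. Qed.
Lemma gZ_unitary : gunitary gZ. Proof. by vm_compute. Qed.
Lemma gr_unitary : gunitary gr. Proof. by vm_compute. Qed.
Lemma gs_unitary : gunitary gs. Proof. by vm_compute. Qed.

Definition UX : UJ R := UJ_of R gX_unitary.
Definition UY : UJ R := UJ_of R gY_unitary.
Definition UZ : UJ R := UJ_of R gZ_unitary.
Definition Ur : UJ R := UJ_of R gr_unitary.
Definition Us : UJ R := UJ_of R gs_unitary.

Definition cusp_w (m n : int) : C := (m - n)%:~R +i* (m + n)%:~R.
Definition cusp_z (m n t : int) : C := - (m * m + n * n)%:~R +i* t%:~R.

Ltac complex_ring :=
  apply/eqP; rewrite eq_complex /=; apply/andP; split; apply/eqP; ring.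

Lemma UX_expz n : UJmx (expz UX n) = tmx (cusp_w n 0) (cusp_z n 0 0) 1.
Proof.
apply: (@UJmx_expz UX (fun n => tmx (cusp_w n 0) (cusp_z n 0 0) 1)).
- by rewrite -tmx1; congr tmx; complex_ring.
- apply/matrixP=> i j; rewrite !mxE.
  case: i => [[|[|[|//]]] ?]; case: j => [[|[|[|//]]] ?] /=; complex_ring.
- by move=> m k; rewrite tmxM ?rmorph1 ?mul1r //; congr tmx; complex_ring.
Qed.

Lemma UY_expz n : UJmx (expz UY n) = tmx (cusp_w 0 n) (cusp_z 0 n 0) 1.
Proof.
apply: (@UJmx_expz UY (fun n => tmx (cusp_w 0 n) (cusp_z 0 n 0) 1)).
- by rewrite -tmx1; congr tmx; complex_ring.
- apply/matrixP=> i j; rewrite !mxE.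
  case: i => [[|[|[|//]]] ?]; case: j => [[|[|[|//]]] ?] /=; complex_ring.
- by move=> m k; rewrite tmxM ?rmorph1 ?mul1r //; congr tmx; complex_ring.
Qed.

Lemma UZ_expz n : UJmx (expz UZ n) = tmx 0 (cusp_z 0 0 n) 1.
Proof.
apply: (@UJmx_expz UZ (fun n => tmx 0 (cusp_z 0 0 n) 1)).
- by rewrite -tmx1; congr tmx; complex_ring.
- apply/matrixP=> i j; rewrite !mxE.
  case: i => [[|[|[|//]]] ?]; case: j => [[|[|[|//]]] ?] /=; complex_ring.
- by move=> m k; rewrite tmxM ?rmorph1 ?mul1r //; congr tmx; complex_ring.
Qed.

Local Notation I := (0 +i* 1 : C).

Lemma Ur_exp k : UJmx (Ur ^+ k)%g = tmx 0 0 (I ^+ k).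
Proof.
elim: k => [|k IH]; first by rewrite expr0 tmx1.
rewrite expgS UJmxM IH exprS -[X in X *m _]/(ofGmx R gr).
have -> : ofGmx R gr = tmx 0 0 I.
  apply/matrixP=> i j; rewrite !mxE.
  case: i => [[|[|[|//]]] ?]; case: j => [[|[|[|//]]] ?] /=; complex_ring.
rewrite tmxM; last by complex_ring.
by congr tmx; rewrite ?mulr0 ?addr0 ?subr0.
Qed.

Definition unf : cusp_index -> UJ R := normal_form UX UY UZ Ur.

Lemma unfE m n t k :
  UJmx (unf (m, n, t + 2 * (m * n), k)) = tmx (cusp_w m n) (cusp_z m n t) (I ^+ k).
Proof.
rewrite /unf /normal_form /normal_form3 !UJmxM UX_expz UY_expz UZ_expz Ur_exp.
have c1 : Num.conj 1 * 1 = 1 :> C by rewrite rmorph1 mulr1.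
rewrite !tmxM ?mulr1 ?mul1r ?mulr0 ?addr0 ?subr0 ?rmorph1 //.
by congr tmx; complex_ring.
Qed.

End CuspMatrices.

(** * Cusps near a given point *)

Section NearbyCusps.
Variable R : realType.
Local Open Scope ring_scope.
Import Order.TTheory GRing.Theory Num.Theory.
Implicit Types (x : R * R * R) (m n t : int).

Definition origin : cusp_data := (1, 0, 0, 0)%BZ.

(** The neighbour reached by [shear m n t] and then s. Its horizontal coordinates are those of (1 +
    i)(m + ni), and 2t makes up for the halving of the vertical coordinate. *)
Definition lattice_cusp m n t : cusp_data :=
  (1%BZ, Z_of_int (m - n), Z_of_int (m + n), Z_of_int (2 * t)).

Lemma ofZK n : ofZ R (Z_of_int n) = n%:~R.
Proof. by rewrite /ofZ Z_of_intK. Qed.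

Lemma depth_lattice m n t x : depth (lattice_cusp m n t) x =
  ((x.1.1 - (m - n)%:~R) ^+ 2 + (x.1.2 - (m + n)%:~R) ^+ 2) ^+ 2 / 4
  + (x.2 - t%:~R + (m - n)%:~R * x.1.2 - (m + n)%:~R * x.1.1) ^+ 2.
Proof.
case: x => [[x1 x2] x3] /=; rewrite !ofZK -[ofZ R 1]/(1 : R) mul1r.
by congr (_ + _ ^+ 2); rewrite intrM; field.
Qed.

Lemma depth_origin x : depth origin x =
  (x.1.1 ^+ 2 + x.1.2 ^+ 2) ^+ 2 / 4 + x.2 ^+ 2.
Proof.
have := depth_lattice 0 0 0 x; rewrite -[lattice_cusp 0 0 0]/origin => ->.
by rewrite !(subr0, addr0, mulr0z, mul0r).
Qed.

Lemma origin_bounds x : depth origin x <= 1 ->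
  [/\ x.1.1 ^+ 2 + x.1.2 ^+ 2 <= 2, `|x.1.1| <= 2, `|x.1.2| <= 2 & `|x.2| <= 1].
Proof.
rewrite depth_origin; case: x => [[x1 x2] x3] /= le1.
have s2 : x1 ^+ 2 + x2 ^+ 2 <= 2.
  rewrite -(@ler_sqr _ _ 2) ?nnegrE ?addr_ge0 ?sqr_ge0 //.
  by have := sqr_ge0 x3; nra.
split=> //; rewrite ler_norml; apply/andP; split; have := sqr_ge0 x1;
  have := sqr_ge0 x2; have := sqr_ge0 (x1 ^+ 2 + x2 ^+ 2); nra.
Qed.

(** After division by [scale], the boxes are [-2, 2]^3 and [0, 2]^2 x [-1, 1]. *)
Definition whole_box : box := (0, 0, 0, 8192)%BZ.
Definition quadrant_box : box := (4096, 4096, 0, 4096)%BZ.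

Lemma in_whole_box x : depth origin x <= 1 -> in_box whole_box x.
Proof.
case: x => [[x1 x2] x3] /origin_bounds[_ /= b1 b2 b3].
have D0 : 0 <= ofZ R scale by rewrite -[0]/(ofZ R 0) ofZ_le.
have e : ofZ R 8192 = ofZ R scale * 2 by rewrite -[2]/(ofZ R 2) -ofZM.
rewrite /in_box /whole_box e -[ofZ R 0]/(0 : R) !subr0 !normrM !(ger0_norm D0).
by split; apply: ler_wpM2l => //; apply: le_trans b3 _; rewrite ler1n.
Qed.

Lemma in_quadrant_box x : depth origin x <= 1 -> 0 <= x.1.1 -> 0 <= x.1.2 ->
  in_box quadrant_box x.
Proof.
case: x => [[x1 x2] x3] /origin_bounds[_ /= b1 b2 b3] p1 p2.
have D0 : 0 <= ofZ R scale by rewrite -[0]/(ofZ R 0) ofZ_le.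
rewrite /in_box /quadrant_box -/scale -[ofZ R 0]/(0 : R) subr0 /=.
move: (ofZ R scale) D0 => D D0.
have sub y : 0 <= y -> `|y| <= 2 -> `|D * y - D| <= D.
  move=> y0; rewrite ger0_norm // => y2.
  rewrite -[X in _ - X]mulr1 -mulrBr normrM ger0_norm // ler_piMr //.
  by rewrite ler_norml; apply/andP; split; lra.
split; [exact: sub | exact: sub |].
by rewrite normrM ger0_norm // ler_piMr.
Qed.

Lemma near_box inside goals x :
  all (fun v => 0 <=? v.1.1.1)%BZ (inside ++ flatten goals) ->
  box_check 12 (origin :: inside) [::] goals whole_box ->
  depth origin x < 1 -> (forall v, v \in inside -> depth v x < 1) ->
  exists2 g, g \in goals & forall v, v \in g -> depth v x < 1.
Proof.
move=> pos chk O1 ins; apply: (box_checkP _ chk) => //.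
- exact/in_whole_box/ltW.
- by move=> v; rewrite inE => /orP[/eqP->|/ins].
Qed.

(** Vertices g s K s infty of squares, for K the shears (0, 1, -1), (1, 0, 1), (1, 0, -1), (0, -1,
    1) in this order. The leading 2 is the squared modulus of [cusp_z] at K. *)
Definition cusp_01N : cusp_data := (2, 0, 1, 1)%BZ.
Definition cusp_101 : cusp_data := (2, 0, 1, -1)%BZ.
Definition cusp_10N : cusp_data := (2, 1, 0, 1)%BZ.
Definition cusp_0N1 : cusp_data := (2, 1, 0, -1)%BZ.

(** With an empty list of goals the subdivision must dismiss every box, so the two open regions are
    disjoint. *)
Lemma apart_cusps m n t x :
  (m, n, t) \in [:: (0, 0, 2); (0, 0, 3); (0, 0, 4); (1, 0, 3); (1, 0, 4);
                    (1, 1, 3); (1, 1, 4)] ->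
  depth origin x < 1 -> 1 <= depth (lattice_cusp m n t) x.
Proof.
have far : box_check 12 [:: origin; lattice_cusp m n t] [::] [::] whole_box ->
    depth origin x < 1 -> 1 <= depth (lattice_cusp m n t) x.
  move=> chk O1; rewrite leNgt; apply/negP => K1.
  have [||g //] := @near_box [:: lattice_cusp m n t] [::] x _ chk O1.
  - by [].
  - by move=> v; rewrite inE => /eqP->.
rewrite !inE => mnt; apply: far; move: mnt.
by do 6?[case/orP]; move=> /eqP[-> -> ->]; vm_compute.
Qed.

Lemma near_cusps101 x : depth origin x < 1 -> depth (lattice_cusp 1 0 1) x < 1 ->
  [\/ depth (lattice_cusp 0 0 1) x < 1, depth (lattice_cusp 1 0 0) x < 1,
      depth cusp_01N x < 1 | depth cusp_101 x < 1].
Proof.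
move=> O1 K1; have [|||g gin gx] := @near_box [:: lattice_cusp 1 0 1]
  [:: [:: lattice_cusp 0 0 1]; [:: lattice_cusp 1 0 0]; [:: cusp_01N]; [:: cusp_101]]
  x _ _ O1.
- by vm_compute.
- by vm_compute.
- by move=> v; rewrite inE => /eqP->.
move: gin gx; rewrite !inE => /or4P[] /eqP-> gx.
- by apply: Or41; apply: gx; rewrite inE.
- by apply: Or42; apply: gx; rewrite inE.
- by apply: Or43; apply: gx; rewrite inE.
- by apply: Or44; apply: gx; rewrite inE.
Qed.

Lemma near_cusps110 x : depth origin x < 1 -> depth (lattice_cusp 1 1 0) x < 1 ->
  depth cusp_01N x < 1 \/ depth cusp_101 x < 1.
Proof.
move=> O1 K1; have [|||g gin gx] := @near_box [:: lattice_cusp 1 1 0]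
  [:: [:: cusp_01N]; [:: cusp_101]] x _ _ O1.
- by vm_compute.
- by vm_compute.
- by move=> v; rewrite inE => /eqP->.
move: gin gx; rewrite !inE => /orP[] /eqP-> gx; [left|right];
  by apply: gx; rewrite inE.
Qed.

Lemma near_cusps112 x : depth origin x < 1 -> depth (lattice_cusp 1 1 2) x < 1 ->
  depth (lattice_cusp 0 1 0) x < 1.
Proof.
move=> O1 K1; have [|||g gin gx] := @near_box [:: lattice_cusp 1 1 2]
  [:: [:: lattice_cusp 0 1 0]] x _ _ O1.
- by vm_compute.
- by vm_compute.
- by move=> v; rewrite inE => /eqP->.
by apply: gx; move: gin; rewrite !inE => /eqP->.
Qed.

Lemma near_cusps102 x : depth origin x < 1 -> depth (lattice_cusp 1 0 2) x < 1 ->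
  [\/ depth (lattice_cusp 0 0 1) x < 1, depth (lattice_cusp 1 0 1) x < 1,
      depth (lattice_cusp 0 1 0) x < 1 | depth (lattice_cusp 1 1 0) x < 1].
Proof.
move=> O1 K1; have [|||g gin gx] := @near_box [:: lattice_cusp 1 0 2]
  [:: [:: lattice_cusp 0 0 1]; [:: lattice_cusp 1 0 1]; [:: lattice_cusp 0 1 0];
      [:: lattice_cusp 1 1 0]] x _ _ O1.
- by vm_compute.
- by vm_compute.
- by move=> v; rewrite inE => /eqP->.
move: gin gx; rewrite !inE => /or4P[] /eqP-> gx.
- by apply: Or41; apply: gx; rewrite inE.
- by apply: Or42; apply: gx; rewrite inE.
- by apply: Or43; apply: gx; rewrite inE.
- by apply: Or44; apply: gx; rewrite inE.
Qed.

Lemma near_cusps111 x : depth origin x < 1 -> depth (lattice_cusp 1 1 1) x < 1 ->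
  [\/ depth (lattice_cusp 0 1 (-1)) x < 1, depth (lattice_cusp 0 1 0) x < 1
    | depth (lattice_cusp 1 1 0) x < 1].
Proof.
move=> O1 K1; have [|||g gin gx] := @near_box [:: lattice_cusp 1 1 1]
  [:: [:: lattice_cusp 0 1 (-1)]; [:: lattice_cusp 0 1 0];
      [:: lattice_cusp 1 1 0]] x _ _ O1.
- by vm_compute.
- by vm_compute.
- by move=> v; rewrite inE => /eqP->.
move: gin gx; rewrite !inE => /or3P[] /eqP-> gx.
- by apply: Or31; apply: gx; rewrite inE.
- by apply: Or32; apply: gx; rewrite inE.
- by apply: Or33; apply: gx; rewrite inE.
Qed.

Definition tie_triangles : seq (int * int * int) :=
  [:: (0, 0, 1); (0, 0, -1); (1, 0, 0); (0, 1, 0); (-1, 0, 0); (0, -1, 0)].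

Definition tie_squares : seq (int * int * int * cusp_data) :=
  [:: (1, 0, 1, cusp_01N); (1, 0, 1, cusp_101);
      (1, 0, -1, cusp_10N); (1, 0, -1, cusp_0N1)].

(** Equal heights put x on the surface where the depth of [origin] is 1. Each goal lists the
    vertices of a triangle or square off the edge, all of which must be lower. *)
Lemma tie_cusps x : depth origin x = 1 -> 0 <= x.1.1 -> 0 <= x.1.2 ->
  (exists2 h, h \in tie_triangles & depth (lattice_cusp h.1.1 h.1.2 h.2) x < 1) \/
  (exists2 h, h \in tie_squares &
     depth (lattice_cusp h.1.1.1 h.1.1.2 h.1.2) x < 1 /\ depth h.2 x < 1).
Proof.
move=> O1 x1 x2.
pose goals := [seq [:: lattice_cusp h.1.1 h.1.2 h.2] | h <- tie_triangles] ++
  [seq [:: lattice_cusp h.1.1.1 h.1.1.2 h.1.2; h.2] | h <- tie_squares].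
have [|||||g gin gx] := @box_checkP R 12 [::] [:: origin] goals quadrant_box x.
- by vm_compute.
- by vm_compute.
- by apply: in_quadrant_box => //; rewrite O1.
- by [].
- by move=> v; rewrite inE => /eqP->.
move: gin; rewrite mem_cat => /orP[] /mapP[h hin eg]; rewrite eg in gx; [left|right]; exists h => //.
  by apply: gx; rewrite inE.
by split; apply: gx; rewrite !inE eqxx ?orbT.
Qed.

Lemma near_indices m n t x : depth origin x < 1 ->
  depth (lattice_cusp m n t) x < 1 -> [&& `|m| <= 1, `|n| <= 1 & `|t| <= 4]%N.
Proof.
move=> O1; have [s2 _ _ b3] := origin_bounds (ltW O1); rewrite depth_lattice.
case: x s2 b3 {O1} => [[x1 x2] x3] /= s2 b3 K1.
pose a : R := (m - n)%:~R; pose b : R := (m + n)%:~R.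
rewrite -/a -/b in K1.
have k2 : (x1 - a) ^+ 2 + (x2 - b) ^+ 2 < 2.
  rewrite -(@ltr_sqr _ _ 2) ?nnegrE ?addr_ge0 ?sqr_ge0 //.
  by have := sqr_ge0 (x3 - t%:~R + a * x2 - b * x1); nra.
have k3 : `|x3 - t%:~R + a * x2 - b * x1| < 1.
  rewrite -(@ltr_sqr _ _ 1) ?nnegrE ?normr_ge0 // real_normK ?num_real //.
  have := sqr_ge0 ((x1 - a) ^+ 2 + (x2 - b) ^+ 2); nra.
(* Parallelogram law: (a, b) is the sum of two horizontal vectors whose squared lengths are at most
   2. *)
have ab : a ^+ 2 + b ^+ 2 < 8.
  have := sqr_ge0 (2 * x1 - a); have := sqr_ge0 (2 * x2 - b); nra.
have mn : (m * m + n * n < 4)%R.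
  have -> : (m * m + n * n < 4)%R = ((m * m + n * n)%:~R < (4 : R)).
    by rewrite -(ltr_int R).
  by move: ab; rewrite /a /b !rmorphD !rmorphM /= rmorphN /=; nra.
have /andP[ml mu] : (-1 <= m <= 1)%R by apply/andP; split; nia.
have /andP[nl nu] : (-1 <= n <= 1)%R by apply/andP; split; nia.
have mn2 : (m * m + n * n <= 2)%R by nia.
have ab4 : a ^+ 2 + b ^+ 2 <= 4.
  have : (m * m + n * n)%:~R <= (2 : R) by rewrite -(ler_int R) in mn2.
  by rewrite /a /b !rmorphD !rmorphM /= rmorphN /=; nra.
(* By Lagrange's identity the square is at most (a^2 + b^2)(x1^2 + x2^2) <= 8. Together with the
   bound 1 on [x3] and on the vertical term this gives |t| < 5. *)
have cr : `|a * x2 - b * x1| < 3.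
  rewrite -(@ltr_sqr _ _ 3) ?nnegrE ?normr_ge0 // real_normK ?num_real //.
  have := sqr_ge0 (a * x1 + b * x2); nra.
have t5 : `|t%:~R : R| < 5.
  move: b3 k3 cr; rewrite !ler_norml !ltr_norml => /andP[? ?] /andP[? ?] /andP[? ?].
  by apply/andP; split; lra.
have t5' : (`|t| < 5)%R by rewrite -(ltr_int R) intr_norm.
by move: ml mu nl nu t5'; clear; lia.
Qed.

(** Rounding (x1 + x2) / 2 and (x2 - x1) / 2 leaves a squared horizontal distance of at most 1;
    rounding the vertical coordinate leaves at most 1/2. The depth is then at most 1/4 + 1/4. *)
Lemma descending_cusp x : exists m n t, depth (lattice_cusp m n t) x < 1.
Proof.
have round (y : R) : exists k : int, - (1 / 2) <= y - k%:~R <= 1 / 2.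
  exists (Num.floor (y + 1 / 2)).
  have := floor_le_tmp (y + 1 / 2); have := floorD1_gt (y + 1 / 2).
  by rewrite rmorphD /= => ? ?; apply/andP; split; lra.
case: x => [[x1 x2] x3].
have [m /andP[m1 m2]] := round ((x1 + x2) / 2).
have [n /andP[n1 n2]] := round ((x2 - x1) / 2).
have [t /andP[t1 t2]] := round (x3 + (m - n)%:~R * x2 - (m + n)%:~R * x1).
exists m, n, t; rewrite depth_lattice /=.
have k1 : (x1 - (m - n)%:~R) ^+ 2 + (x2 - (m + n)%:~R) ^+ 2 <= 1.
  by rewrite rmorphB rmorphD /=; nra.
have k0 : 0 <= (x1 - (m - n)%:~R) ^+ 2 + (x2 - (m + n)%:~R) ^+ 2.
  by rewrite addr_ge0 ?sqr_ge0.
have k2 : (x3 - t%:~R + (m - n)%:~R * x2 - (m + n)%:~R * x1) ^+ 2 <= 1 / 4.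
  have -> : x3 - t%:~R + (m - n)%:~R * x2 - (m + n)%:~R * x1 =
    x3 + (m - n)%:~R * x2 - (m + n)%:~R * x1 - t%:~R by ring.
  by move: t1 t2; set d := _ - t%:~R => *; nra.
by move: k1 k0 k2; set e := _ + _ ^+ 2; set d := _ ^+ 2 => *; nra.
Qed.

End NearbyCusps.

(** * Heights of cusps *)

Section GaussianHeights.
Variable R : realType.
Local Open Scope ring_scope.
Local Open Scope complex_scope.
Local Open Scope sesquilinear_scope.
Import Order.TTheory GRing.Theory Num.Theory.
Local Notation C := R[i].

Definition normsq (x : C) : R := complex.Re x ^+ 2 + complex.Im x ^+ 2.

Lemma normsqM x y : normsq (x * y) = normsq x * normsq y.
Proof. by case: x y => [a b] [c d]; rewrite /normsq /=; ring. Qed.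

Lemma normsq_ge0 x : 0 <= normsq x.
Proof. by rewrite addr_ge0 ?sqr_ge0. Qed.

Lemma normsq_eq0 x : (normsq x == 0) = (x == 0).
Proof. by case: x => a b; rewrite paddr_eq0 ?sqr_ge0 // !sqrf_eq0 eq_complex. Qed.

Lemma conj_normsq x : Num.conj x * x = (normsq x)%:C.
Proof.
by case: x => a b; apply/eqP; rewrite eq_complex /=; apply/andP; split;
  apply/eqP; rewrite /normsq /=; ring.
Qed.

Definition corner (A : UJ R) : C := UJmx A ord_max 0.

(** The representative is arbitrary and need not have Gaussian entries. Scalars relating elements of
    U(J) have modulus 1, so on Gamma_1 the truncated number is already a natural number. *)
Definition cusp_height (u : PUJ R) : nat := Num.truncn (normsq (corner (repr u))).

(** A* J A = |c|^2 B* J B, and both products are J; compare an entry where J is 1. *)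
Lemma scalar_normsq (A B : UJ R) c : UJmx A = c *: UJmx B -> normsq c = 1.
Proof.
move=> e; have /andP[_ /eqP JA] := valP A; have /andP[_ /eqP JB] := valP B.
have := JA; rewrite [val A]e -[UJmx B]/(val B).
have -> : (c *: val B) ^t* = Num.conj c *: (val B) ^t*.
  by apply/matrixP=> i j; rewrite !mxE rmorphM.
rewrite -!scalemxAl -scalemxAr scalerA JB => /matrixP/(_ 0 ord_max).
by rewrite !mxE /= mulr1 conj_normsq => /(congr1 (@complex.Re R)).
Qed.

Lemma corner_class (A : UJ R) :
  normsq (corner (repr (PUclass A))) = normsq (corner A).
Proof.
have /asboolP[c e] := cong_repr (scalar_cong R) A.
rewrite /corner [UJmx (repr _)]e mxE normsqM.
by rewrite (scalar_normsq e) mul1r.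
Qed.

Local Notation gint := (@gaussian_int R).

Lemma gint_add x y : x \in gint -> y \in gint -> x + y \in gint.
Proof.
move=> /andP[a b] /andP[c d]; apply/andP.
by case: x y a b c d => [? ?] [? ?] /= *; split; rewrite rpredD.
Qed.

Lemma gint_mul x y : x \in gint -> y \in gint -> x * y \in gint.
Proof.
move=> /andP[a b] /andP[c d]; apply/andP.
by case: x y a b c d => [? ?] [? ?] /= *; split; rewrite ?rpredB ?rpredD ?rpredM.
Qed.

Lemma gint_conj x : x \in gint -> Num.conj x \in gint.
Proof.
by move=> /andP[a b]; apply/andP; case: x a b => ? ? /= *; split; rewrite ?rpredN.
Qed.

Lemma gint_ofG x : ofG R x \in gint.
Proof. by apply/andP; rewrite /= /ofZ; split; exact: intr_int. Qed.

Definition gauss_entries (A : 'M[C]_3) : Prop := forall i j, A i j \in gint.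

Lemma gauss_entriesM A B :
  gauss_entries A -> gauss_entries B -> gauss_entries (A *m B).
Proof.
move=> gA gB i j; rewrite mxE !big_ord_recl big_ord0 addr0.
by rewrite !gint_add ?gint_mul.
Qed.

Lemma gauss_entries_of M : gauss_entries (ofGmx R M).
Proof. by move=> i j; rewrite mxE; apply: gint_ofG. Qed.

Lemma gauss_entriesV (A : UJ R) :
  gauss_entries (UJmx A) -> gauss_entries (UJmx A^-1%g).
Proof.
move=> gA; rewrite UJ_invE; have gJ' : gauss_entries (J R).
  by rewrite -ofGmx_J; apply: gauss_entries_of.
do 2![apply: gauss_entriesM => //].
by move=> i j; rewrite !mxE; apply: gint_conj.
Qed.

Lemma gauss_entriesX (A : UJ R) n :
  gauss_entries (UJmx A) -> gauss_entries (UJmx (A ^+ n)%g).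
Proof.
move=> gA; elim: n => [|n IH].
  by rewrite /= -ofGmx_1; apply: gauss_entries_of.
by rewrite expgS UJmxM; apply: gauss_entriesM.
Qed.

Lemma gauss_entries_expz (A : UJ R) n :
  gauss_entries (UJmx A) -> gauss_entries (UJmx (expz A n)).
Proof.
move=> gA; case: n => k; rewrite /expz; first exact: gauss_entriesX.
by apply/gauss_entriesV/gauss_entriesX.
Qed.

Lemma gauss_unf h : gauss_entries (UJmx (unf R h)).
Proof.
case: h => [[[m n] t] k]; rewrite /unf /normal_form /normal_form3.
rewrite !UJmxM; do ![apply: gauss_entriesM];
  rewrite ?UJmxM; try apply: gauss_entries_expz; try apply: gauss_entriesX;
  exact: gauss_entries_of.
Qed.

Lemma gauss_Us : gauss_entries (UJmx (Us R)).
Proof. exact: gauss_entries_of. Qed.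

(** The inverse J A* J of a unitary matrix has Gaussian entries as soon as A has. *)
Lemma GL3_gaussianE (A : UJ R) :
  GL3_gaussian (UJmx A) <-> gauss_entries (UJmx A).
Proof.
split; first by case/and3P=> _ /mxOverP.
move=> gA; apply/and3P; split; [exact: UJ_unit | exact/mxOverP |].
by apply/mxOverP; apply: gauss_entriesV.
Qed.

Lemma cusp_heightE (A : UJ R) : gauss_entries (UJmx A) ->
  (cusp_height (PUclass A))%:R = normsq (corner A).
Proof.
move=> gA; rewrite /cusp_height corner_class; apply/eqP.
have /andP[re im] := gA ord_max 0.
rewrite -natrEtruncn natrEint normsq_ge0 andbT.
by rewrite rpredD ?rpredX.
Qed.

Lemma Gamma1P (u : PUJ R) :
  Gamma1 R u <-> exists2 A : UJ R, gauss_entries (UJmx A) & u = PUclass A.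
Proof.
split; first by move=> [A /GL3_gaussianE gA <-]; exists A.
by move=> [A /GL3_gaussianE gA ->]; exists A.
Qed.

End GaussianHeights.

Lemma normal_form_morph (G H : groupType) (phi : G -> H) X Y Z r h :
  {morph phi : x y / x * y} ->
  phi (normal_form X Y Z r h) =
  normal_form (phi X) (phi Y) (phi Z) (phi r) h.
Proof.
move=> phiM; have [_ phiV phiX] := morph_group phiM.
have phiZ x n : phi (expz x n) = expz (phi x) n.
  by case: n => k; rewrite /expz ?phiV phiX.
by case: h => [[[m n] t] k]; rewrite /normal_form /= !phiM !phiZ phiX.
Qed.

(** * Heisenberg coordinates of a cusp and heights of its neighbours *)

Section CuspCoordinates.
Variable R : realType.
Local Open Scope ring_scope.
Local Open Scope complex_scope.
Local Open Scope sesquilinear_scope.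
Import Order.TTheory GRing.Theory Num.Theory.
Local Notation C := R[i].
Local Notation I := (0 +i* 1 : C).

Definition smx : 'M[C]_3 := mx3 [:: [:: 0; 0; 1]; [:: 0; -1; 0]; [:: 1; 0; 0]].

Lemma UsE : UJmx (Us R) = smx.
Proof.
apply/matrixP=> i j; rewrite !mxE.
case: i => [[|[|[|//]]] ?]; case: j => [[|[|[|//]]] ?] //=;
  by apply/eqP; rewrite eq_complex /= ?oppr0 ?eqxx.
Qed.

Lemma corner_unf (A : UJ R) h : corner (A * unf R h)%g = corner A.
Proof.
case: h => [[[m n] t'] k]; pose t : int := t' - 2 * (m * n).
have -> : t' = t + 2 * (m * n) by rewrite /t subrK.
rewrite /corner UJmxM unfE !mxE !big_ord_recl big_ord0 !mxE /=.
by rewrite !mulr0 mulr1 !addr0; congr (UJmx A _ _); apply: val_inj.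
Qed.

Lemma corner_s (A : UJ R) : corner (A * Us R)%g = UJmx A ord_max ord_max.
Proof.
rewrite /corner UJmxM UsE !mxE !big_ord_recl big_ord0 !mxE /=.
by rewrite !mulr0 mulr1 !addr0 !add0r; congr (UJmx A _ _); apply: val_inj.
Qed.

Lemma corner_unf_s (A : UJ R) m n t k :
  corner (A * unf R (m, n, t + 2 * (m * n), k) * Us R)%g =
  corner A * cusp_z R m n t + UJmx A ord_max 1 * cusp_w R m n +
  UJmx A ord_max ord_max.
Proof.
rewrite corner_s UJmxM unfE !mxE !big_ord_recl big_ord0 !mxE /= mulr1 addr0 addrA.
by congr (_ * _ + _ * _ + _); rewrite ?/corner; congr (UJmx A _ _); apply: val_inj.
Qed.

Lemma corner_s_unf_s (A : UJ R) m n t k :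
  corner (A * Us R * unf R (m, n, t + 2 * (m * n), k) * Us R)%g =
  UJmx A ord_max ord_max * cusp_z R m n t - UJmx A ord_max 1 * cusp_w R m n +
  corner A.
Proof.
rewrite corner_unf_s corner_s UJmxM UsE !mxE !big_ord_recl !big_ord0 !mxE /=.
rewrite !(mulr0, mulr1, add0r, addr0, mulrN, mulNr); congr (_ - _ * _ + _);
  by rewrite ?/corner; congr (UJmx A _ _); apply: val_inj.
Qed.

(** This is the lower left entry of A (J A* J) = 1. *)
Lemma row_isotropic (A : UJ R) :
  corner A * Num.conj (UJmx A ord_max ord_max)
  + UJmx A ord_max 1 * Num.conj (UJmx A ord_max 1)
  + UJmx A ord_max ord_max * Num.conj (corner A) = 0.
Proof.
have : UJmx (A * A^-1)%g = 1%:M by rewrite mulgV.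
rewrite UJmxM UJ_invE => /matrixP/(_ ord_max 0).
rewrite !mxE !big_ord_recl !big_ord0 !mxE !big_ord_recl !big_ord0 !mxE /=.
rewrite !big_ord_recl !big_ord0 !mxE /=.
rewrite !(mulr0, mulr1, mul0r, mul1r, add0r, addr0) /corner addrA => e.
rewrite -[RHS]e; congr (_ * _ + _ * _ + _ * _); do ?congr Num.conj;
  congr (UJmx A _ _); exact: val_inj.
Qed.

(** Up to its first entry, the bottom row depends on three real numbers only: isotropy prescribes
    the real part of the last quotient. *)
Definition has_coordinates (A : UJ R) (x : R * R * R) : Prop :=
  UJmx A ord_max 1 = corner A * (x.1.1 +i* (- x.1.2)) /\
  UJmx A ord_max ord_max =
    corner A * (- (x.1.1 ^+ 2 + x.1.2 ^+ 2) / 2 +i* (- x.2)).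

Lemma cusp_coordinates (A : UJ R) : corner A != 0 -> exists x, has_coordinates A x.
Proof.
move=> y0; rewrite /has_coordinates; have := row_isotropic A.
set y1 := corner A in y0 *; set y2 := UJmx A ord_max 1.
set y3 := UJmx A ord_max ord_max.
have -> : y2 = y1 * (y2 / y1) by rewrite mulrC divfK.
have -> : y3 = y1 * (y3 / y1) by rewrite mulrC divfK.
move: (y2 / y1) (y3 / y1) => [a b] [c d] iso.
have {}iso : (y1 * Num.conj y1) *
    (Num.conj (c +i* d) + (a +i* b) * Num.conj (a +i* b) + (c +i* d)) = 0.
  by rewrite -[RHS]iso !rmorphM /=; ring.
move/eqP: iso; rewrite !mulf_eq0 conjc_eq0 (negPf y0) /= eq_complex /=.
move=> /andP[/eqP e _]; exists (a, - b, - d) => /=; rewrite !opprK; split=> //.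
by congr (_ * (_ +i* _)); rewrite sqrrN; lra.
Qed.

Lemma normsq_lattice m n t (x : R * R * R) :
  normsq (cusp_z R m n t + (x.1.1 +i* (- x.1.2)) * cusp_w R m n +
          (- (x.1.1 ^+ 2 + x.1.2 ^+ 2) / 2 +i* (- x.2)))
  = depth (lattice_cusp m n t) x.
Proof.
rewrite depth_lattice /normsq /cusp_z /cusp_w; case: x => [[x1 x2] x3] /=.
by field.
Qed.

Lemma coordinates_r (A : UJ R) x1 x2 x3 :
  has_coordinates A (x1, x2, x3) -> has_coordinates (A * Ur R)%g (x2, - x1, x3).
Proof.
move=> [/= e2 e3].
have er : UJmx (Ur R) = tmx 0 0 I by rewrite -[Ur R]expg1 Ur_exp expr1.
have c : corner (A * Ur R)%g = corner A.
  by have := corner_unf A (0, 0, 0, 1%N); rewrite /unf /normal_form /= !mul1g.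
rewrite /has_coordinates c UJmxM er !mxE !big_ord_recl !big_ord0 !mxE /=.
have -> : lift ord0 (ord0 : 'I_2) = 1 :> 'I_3 by apply: val_inj.
have -> : lift ord0 (lift ord0 (ord0 : 'I_1)) = ord_max :> 'I_3 by apply: val_inj.
rewrite e2 e3 rmorph0 !(mulr0, mulr1, add0r, addr0, oppr0, mul0r) -mulrA; split.
  by congr (_ * _); apply/eqP; rewrite eq_complex /=; apply/andP; split;
    apply/eqP; ring.
by rewrite sqrrN [x2 ^+ 2 + _]addrC.
Qed.

(** The corner of each product is [corner A] times a polynomial in x, and the squared modulus of
    that polynomial is a depth. In the third clause the extra s first reverses the row, with a sign
    in the middle. *)
Lemma depth_corner (A : UJ R) x : has_coordinates A x ->
  [/\ normsq (corner (A * Us R)%g) = normsq (corner A) * depth origin x,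
      forall m n t k, normsq (corner (A * unf R (m, n, t + 2 * (m * n), k) * Us R)%g)
        = normsq (corner A) * depth (lattice_cusp m n t) x
    & forall h v, (h, v) \in [:: (shear 0 1 (-1), cusp_01N); (shear 1 0 1, cusp_101);
          (shear 1 0 (-1), cusp_10N); (shear 0 (-1) 1, cusp_0N1)] ->
        normsq (corner (A * Us R * unf R h * Us R)%g)
        = normsq (corner A) * depth v x].
Proof.
move=> [e2 e3]; split.
- rewrite corner_s e3 normsqM depth_origin /normsq /=; congr (_ * _).
  by case: (x) => [[x1 x2] x3] /=; field.
- move=> m n t k; rewrite corner_unf_s e2 e3 -mulrA -!mulrDr normsqM.
  by rewrite normsq_lattice.
- have gen m n t v : normsq ((- (x.1.1 ^+ 2 + x.1.2 ^+ 2) / 2 +i* (- x.2))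
        * cusp_z R m n t - (x.1.1 +i* (- x.1.2)) * cusp_w R m n + 1) = depth v x ->
      normsq (corner (A * Us R * unf R (shear m n t) * Us R)%g)
      = normsq (corner A) * depth v x.
    move=> <-; rewrite -normsqM corner_s_unf_s e2 e3; congr normsq.
    by rewrite mulrDr mulrBr mulr1 !mulrA.
  move=> h v; rewrite !inE => /or4P[] /eqP[-> ->]; apply: gen;
    rewrite /normsq /cusp_z /cusp_w /depth; case: (x) => [[x1 x2] x3] /=.
  + by rewrite -[ofZ R 2]/(2 : R) -[ofZ R 0]/(0 : R) -[ofZ R 1]/(1 : R); field.
  + rewrite -[ofZ R 2]/(2 : R) -[ofZ R 0]/(0 : R) -[ofZ R 1]/(1 : R) -[ofZ R _]/(-1 : R).
    by field.
  + by rewrite -[ofZ R 2]/(2 : R) -[ofZ R 0]/(0 : R) -[ofZ R 1]/(1 : R); field.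
  + rewrite -[ofZ R 2]/(2 : R) -[ofZ R 0]/(0 : R) -[ofZ R 1]/(1 : R) -[ofZ R _]/(-1 : R).
    by field.
Qed.

End CuspCoordinates.

(** * The stabilizer of infty in Gamma_1, and the geometry required by the descent *)

Section CuspGroup.
Variable R : realType.
Local Open Scope ring_scope.
Local Open Scope complex_scope.
Local Open Scope sesquilinear_scope.
Import Order.TTheory GRing.Theory Num.Theory.
Local Notation C := R[i].
Local Notation I := (0 +i* 1 : C).

Lemma imaginary_expr1 k : I ^+ k = 1 -> exists q, k = (4 * q)%N.
Proof.
have i2 : I ^+ 2 = -1.
  by rewrite expr2; apply/eqP; rewrite eq_complex /=; apply/andP; split;
    apply/eqP; ring.
have i4 : I ^+ 4 = 1 by rewrite (exprM _ 2 2) i2 sqrrN expr1n.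
have N1 : (-1 : R) = 1 -> False.
  by move=> /eqP; rewrite lt_eqF // (lt_trans _ (@ltr01 R)) // oppr_lt0.
move=> ik; have : I ^+ (k %% 4) = 1.
  by rewrite -[RHS]ik {2}(divn_eq k 4) exprD mulnC exprM i4 expr1n mul1r.
have := ltn_pmod k (isT : 0 < 4)%N; case E : (k %% 4)%N => [|[|[|[|//]]]] _.
- by exists (k %/ 4)%N; rewrite {1}(divn_eq k 4) E addn0 mulnC.
- by rewrite expr1 => /eqP; rewrite eq_complex /= oner_eq0 andbF.
- by rewrite i2 => /(congr1 (@complex.Re R)) /N1.
- rewrite exprS i2 mulrN1 => /eqP; rewrite eq_complex /= oppr0.
  by rewrite eq_sym oner_eq0.
Qed.

Lemma gint_unit (x : C) : x \in @gaussian_int R -> normsq x = 1 ->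
  exists k, x = I ^+ k.
Proof.
case: x => a b /andP[/= /intrP[p ->] /intrP[q ->]].
rewrite /normsq /= => e.
have p2 : p * p + q * q = 1.
  by apply/eqP; rewrite -(eqr_int R) rmorphD !rmorphM /= -!expr2 e.
have [[-> ->]|[[-> ->]|[[-> ->]|[-> ->]]]] :
   (p = 1 /\ q = 0) \/ (p = 0 /\ q = 1) \/ (p = -1 /\ q = 0) \/ (p = 0 /\ q = -1).
  have p1 : (-1 <= p <= 1)%R by apply/andP; split; nia.
  have q1 : (-1 <= q <= 1)%R by apply/andP; split; nia.
  nia.
- by exists 0%N.
- by exists 1%N; rewrite expr1.
- exists 2%N; apply/eqP; rewrite expr2 eq_complex /=.
  by apply/andP; split; apply/eqP; ring.
- exists 3%N; apply/eqP; rewrite !exprS expr0 eq_complex /=.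
  by apply/andP; split; apply/eqP; ring.
Qed.

(** Since Re z is an integer, |w|^2 is even; hence w is divisible by 1 + i, with quotient m + ni. *)
Lemma cusp_w_exists (w z : C) :
  w \in @gaussian_int R -> z \in @gaussian_int R ->
  normsq w + 2 * complex.Re z = 0 ->
  exists m n t, w = cusp_w R m n /\ z = cusp_z R m n t.
Proof.
case: w z => [a b] [c d] /andP[/= /intrP[p ->] /intrP[q ->]].
move=> /andP[/= /intrP[r ->] /intrP[t ->]].
rewrite /normsq /= => e.
have pqr : p * p + q * q + 2 * r = 0.
  by apply/eqP; rewrite -(eqr_int R) !rmorphD !rmorphM /= -!expr2 e.
have [m [n [ep eq]]] : exists m n : int, p = m - n /\ q = m + n.
  have [m em] : exists m : int, p + q = 2 * m.
    exists ((p + q) %/ 2)%Z; rewrite mulrC divzK //.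
    have : (2 %| p * p + q * q)%Z by apply/dvdzP; exists (- r); lia.
    by nia.
  by exists m, (m - p); lia.
exists m, n, t; rewrite /cusp_w /cusp_z -ep -eq; split=> //.
have r2 : 2 * (m * m + n * n) + 2 * r = 0 by rewrite -pqr ep eq; ring.
have -> : r = - (m * m + n * n) by lia.
by rewrite rmorphN.
Qed.

(** The entries of A* J A = J force A to be upper triangular. Its last diagonal entry c is a unit of
    Z[i], and division by c leaves a matrix [tmx] of the stabilizer. *)
Lemma upper_triangular (A : UJ R) : gauss_entries (UJmx A) -> corner A = 0 ->
  exists h c, UJmx A = c *: UJmx (unf R h).
Proof.
move=> gA a20; have /andP[_ /eqP JA] := valP A.
have JAij i j : (val A ^t* *m J R *m val A) i j = J R i j by rewrite JA.
pose a i j := UJmx A i j.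
have e i j : Num.conj (a 0 i) * a ord_max j + Num.conj (a 1 i) * a 1 j
    + Num.conj (a ord_max i) * a 0 j = J R i j.
  rewrite -JAij /a /= !mxE !big_ord_recl !big_ord0 !mxE.
  rewrite !big_ord_recl !big_ord0 !mxE /=.
  rewrite !(mulr0, mulr1, mul0r, mul1r, add0r, addr0) addrA.
  have <- : lift ord0 (ord0 : 'I_2) = 1 :> 'I_3 by apply: val_inj.
  have <- : lift ord0 (lift ord0 (ord0 : 'I_1)) = ord_max :> 'I_3 by apply: val_inj.
  have <- : ord0 = 0 :> 'I_3 by apply: val_inj.
  by rewrite addrC addrA addrAC.
have z0 : a ord_max 0 = 0 by [].
have J00 : J R 0 0 = 0 by rewrite mxE.
have J01 : J R 0 1 = 0 by rewrite mxE.
have J02 : J R 0 ord_max = 1 by rewrite mxE.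
have J11 : J R 1 1 = 1 by rewrite mxE.
have J12 : J R 1 ord_max = 0 by rewrite mxE.
have J22 : J R ord_max ord_max = 0 by rewrite mxE.
have a10 : a 1 0 = 0.
  have := e 0 0; rewrite z0 J00 rmorph0 mulr0 mul0r add0r addr0 conj_normsq.
  move=> /(congr1 (@complex.Re R)) /= n0; apply/eqP.
  by rewrite -normsq_eq0 n0.
have c02 : Num.conj (a 0 0) * a ord_max ord_max = 1.
  by have := e 0 ord_max; rewrite z0 a10 rmorph0 !mul0r !addr0 J02.
have a00 : a 0 0 != 0.
  by apply: contra_eq_neq c02 => ->; rewrite rmorph0 mul0r eq_sym oner_neq0.
have a21 : a ord_max 1 = 0.
  have := e 0 1; rewrite z0 a10 rmorph0 !mul0r !addr0 J01 => /eqP.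
  by rewrite mulf_eq0 conjc_eq0 (negPf a00) => /eqP.
have n11 : Num.conj (a 1 1) * a 1 1 = 1.
  by have := e 1 1; rewrite a21 rmorph0 mulr0 mul0r add0r addr0 J11.
have e12 := e 1 ord_max; rewrite a21 rmorph0 mul0r addr0 J12 in e12.
have e22 := e ord_max ord_max; rewrite J22 in e22.
set c := a ord_max ord_max in c02 e12 e22.
have gn i j : exists2 k : nat, normsq (a i j) = k%:R & a i j \in @gaussian_int R.
  have gij := gA i j; have /andP[re im] := gij.
  have : normsq (a i j) \is a Num.nat.
    by rewrite natrEint normsq_ge0 andbT rpredD ?rpredX.
  by move=> /natrP[k ->]; exists k.
(* The squared moduli of [a 0 0] and c are natural numbers with product 1. *)
have nc : normsq c = 1.
  have [k ek _] := gn 0 0; have [l el _] := gn ord_max ord_max.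
  have : normsq (a 0 0) * normsq c = 1.
    have <- : normsq (Num.conj (a 0 0)) = normsq (a 0 0).
      by rewrite /normsq; case: (a 0 0) => ? ? /=; rewrite sqrrN.
    by rewrite -normsqM c02 /normsq /= expr1n expr0n addr0.
  rewrite /c el ek -natrM => /eqP; rewrite -[1]/(1%:R) eqr_nat muln_eq1.
  by case/andP=> _ /eqP->.
have cc : Num.conj c * c = 1 by rewrite conj_normsq nc.
have ec : a 0 0 = c.
  have c0 : c != 0 by apply: contra_eq_neq cc => ->; rewrite mulr0 eq_sym oner_neq0.
  have : Num.conj (a 0 0) = Num.conj c by apply: (mulIf c0); rewrite c02 cc.
  exact: (can_inj (@conjcK R)).
have gc : Num.conj c \in @gaussian_int R by apply/gint_conj/gA.
pose w := Num.conj c * a 1 ord_max; pose z := Num.conj c * a 0 ord_max.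
(* As conj(c) is the inverse of c, this is the middle entry after scaling: a Gaussian integer of
   modulus 1. *)
have [k ek] : exists k, Num.conj c * a 1 1 = I ^+ k.
  apply: gint_unit; first by apply: gint_mul => //; apply: gA.
  rewrite normsqM.
  have -> : normsq (Num.conj c) = 1.
    by rewrite -nc /normsq; case: (c) => ? ? /=; rewrite sqrrN.
  rewrite mul1r; have := n11; rewrite conj_normsq.
  by move=> /(congr1 (@complex.Re R)).
have [m [n [t [ew ez]]]] : exists m n t, w = cusp_w R m n /\ z = cusp_z R m n t.
  apply: cusp_w_exists; try by apply: gint_mul => //; apply: gA.
  have : Num.conj z + Num.conj w * w + z = 0.
    rewrite /z /w !rmorphM /= !conjCK; rewrite -[RHS]e22.
    by ring: cc.
  case: (w) (z) => [p q] [u v] /(congr1 (@complex.Re R)); rewrite /normsq /=.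
  by move=> <-; ring.
exists (m, n, t + 2 * (m * n), k), c; rewrite unfE -ew -ez -ek.
have kc : c * Num.conj c = 1 by rewrite mulrC.
apply/matrixP=> i j; rewrite !mxE.
have o1 (q : 'I_3) : val q = 1%N -> q = 1 by move=> h; apply: val_inj.
have o0 (q : 'I_3) : val q = 0%N -> q = 0 by move=> h; apply: val_inj.
have o2 (q : 'I_3) : val q = 2%N -> q = ord_max by move=> h; apply: val_inj.
have cK x : c * (Num.conj c * x) = x by rewrite mulrA kc mul1r.
have a01 : a 0 1 = - (c * (a 1 1 * Num.conj (a 1 ord_max))).
  have e12' : a 0 1 * Num.conj c + a 1 1 * Num.conj (a 1 ord_max) = 0.
    have := congr1 Num.conj e12.
    by rewrite rmorphD !rmorphM /= !conjCK rmorph0.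
  have -> : a 1 1 * Num.conj (a 1 ord_max) = - (a 0 1 * Num.conj c).
    by apply/eqP; rewrite -addr_eq0 addrC e12'.
  by rewrite mulrN opprK (mulrC (a 0 1)) cK.
case: i => [[|[|[|//]]] hi]; case: j => [[|[|[|//]]] hj] /=;
  rewrite -/(a _ _).
- by rewrite [Ordinal hi]o0 // [Ordinal hj]o0 // ec mulr1.
- rewrite [Ordinal hi]o0 // [Ordinal hj]o1 // a01 /w rmorphM /= conjCK.
  by rewrite mulrN; congr (- _); rewrite -[in LHS](cK (a 1 1)); ring.
- by rewrite [Ordinal hi]o0 // [Ordinal hj]o2 // /z cK.
- by rewrite [Ordinal hi]o1 // [Ordinal hj]o0 // a10 mulr0.
- by rewrite [Ordinal hi]o1 // [Ordinal hj]o1 // cK.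
- by rewrite [Ordinal hi]o1 // [Ordinal hj]o2 // /w cK.
- by rewrite [Ordinal hi]o2 // [Ordinal hj]o0 // z0 mulr0.
- by rewrite [Ordinal hi]o2 // [Ordinal hj]o1 // a21 mulr0.
- by rewrite [Ordinal hi]o2 // [Ordinal hj]o2 // mulr1.
Qed.

Local Notation PX := (PUclass (UX R)).
Local Notation PY := (PUclass (UY R)).
Local Notation PZ := (PUclass (UZ R)).
Local Notation Pr := (PUclass (Ur R)).
Local Notation Ps := (PUclass (Us R)).
Local Notation nf := (normal_form PX PY PZ Pr).

Lemma PUclassM (A B : UJ R) : PUclass (A * B)%g = (PUclass A * PUclass B)%g.
Proof. exact: quotg_piM. Qed.

Lemma PUclass_unf h : PUclass (unf R h) = nf h.
Proof. exact: normal_form_morph PUclassM. Qed.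

Section Geometry.
Variables (P : groupType) (X' Y' Z' r' : P).
Hypothesis r4 : (r' ^+ 4 = 1)%g.

(** The last diagonal entry is 1 on both sides, so the scalar is 1. The other entries then give m =
    n = t = 0 and i^k = 1, and r'^4 = 1 disposes of k. *)
Lemma nf_faithful_PUJ h :
  nf h = 1%g -> normal_form X' Y' Z' r' h = 1%g.
Proof.
case: h => [[[m n] t'] k]; pose t : int := t' - 2 * (m * n).
have -> : t' = t + 2 * (m * n) by rewrite /t subrK.
rewrite -PUclass_unf => /(@PUclassP R (unf R _) 1%g)[c].
have -> : UJmx (1%g : UJ R) = tmx 0 0 1 by rewrite tmx1.
rewrite unfE => /matrixP e.
have c1 : c = 1 by have := e ord_max ord_max; rewrite !mxE /= mulr1.
have : cusp_w R m n = 0 by have := e 1 ord_max; rewrite !mxE /= mulr0.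
have : cusp_z R m n t = 0 by have := e 0 ord_max; rewrite !mxE /= mulr0.
have : I ^+ k = 1 by have := e 1 1; rewrite !mxE /= c1 mulr1.
move=> ik [_ /eqP]; rewrite -[0]/(0%:~R) eqr_int => /eqP t0.
move=> [/eqP + /eqP]; rewrite -[0]/(0%:~R) !eqr_int => /eqP mn /eqP mn'.
have m0 : m = 0 by lia.
have n0 : n = 0 by lia.
rewrite m0 n0 t0 /normal_form /= !mul1g.
by have [q ->] := imaginary_expr1 ik; rewrite expgnA r4 expg1n.
Qed.

Local Notation D := (Gamma1 R).
Local Notation height := (@cusp_height R).
Local Open Scope group_scope.

Lemma height_eq (A B : UJ R) : gauss_entries (UJmx A) -> gauss_entries (UJmx B) ->
  normsq (corner A) = normsq (corner B) -> height (PUclass A) = height (PUclass B).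
Proof.
move=> gA gB e; apply/eqP; rewrite -(eqr_nat R).
by rewrite (cusp_heightE gA) (cusp_heightE gB) e.
Qed.

Lemma gauss_mul (A B : UJ R) : gauss_entries (UJmx A) -> gauss_entries (UJmx B) ->
  gauss_entries (UJmx (A * B)).
Proof. exact: gauss_entriesM. Qed.

Lemma height_eq0 (A : UJ R) : gauss_entries (UJmx A) ->
  (height (PUclass A) == 0)%N = (corner A == 0)%R.
Proof. by move=> gA; rewrite -(eqr_nat R) (cusp_heightE gA) normsq_eq0. Qed.

Lemma height_lt (A B : UJ R) (d : R) :
  gauss_entries (UJmx A) -> gauss_entries (UJmx B) -> corner A != 0%R ->
  normsq (corner B) = (normsq (corner A) * d)%R ->
  (height (PUclass B) < height (PUclass A))%N = (d < 1)%R.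
Proof.
move=> gA gB A0 e; rewrite -(ltr_nat R) (cusp_heightE gA) (cusp_heightE gB) e.
by rewrite gtr_pMr // lt_def normsq_eq0 A0 normsq_ge0.
Qed.

Definition cusp_depths (u : PUJ R) (x : R * R * R) : Prop :=
  [/\ (height (u * Ps)%g < height u)%N = (depth origin x < 1)%R,
      (height (u * Ps) = height u -> depth origin x = 1%R),
      forall m n t k,
        (height (u * nf (m, n, (t + 2 * (m * n))%R, k) * Ps)%g < height u)%N
        = (depth (lattice_cusp m n t) x < 1)%R
    & forall h v, (h, v) \in [:: (shear 0 1 (-1)%R, cusp_01N);
          (shear 1 0 1, cusp_101); (shear 1 0 (-1)%R, cusp_10N);
          (shear 0 (-1)%R 1, cusp_0N1)] ->
        (height (u * Ps * nf h * Ps)%g < height u)%N = (depth v x < 1)%R].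

Lemma coordinates_depths (A : UJ R) x : gauss_entries (UJmx A) ->
  corner A != 0%R -> has_coordinates A x -> cusp_depths (PUclass A) x.
Proof.
move=> gA A0 /depth_corner[x1 x2 x3].
have gs := @gauss_Us R; have gu := @gauss_unf R.
split.
- by rewrite -PUclassM; apply: (height_lt gA (gauss_mul gA gs) A0 x1).
- rewrite -PUclassM => /(congr1 (fun k => k%:R : R)%R).
  rewrite (cusp_heightE gA) (cusp_heightE (gauss_mul gA gs)) x1 => e.
  by apply: (@mulfI _ (normsq (corner A))); rewrite ?normsq_eq0 // mulr1.
- move=> m n t k; rewrite -PUclass_unf -!PUclassM.
  exact: height_lt gA (gauss_mul (gauss_mul gA (gu _)) gs) A0 (x2 _ _ _ _).
- move=> h v hv; rewrite -PUclass_unf -!PUclassM.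
  apply: (height_lt gA _ A0 (x3 _ _ hv)).
  exact: (gauss_mul (gauss_mul (gauss_mul gA gs) (gu _)) gs).
Qed.

Lemma near_coordinates (u : PUJ R) : D u -> (0 < height u)%N ->
  exists x, cusp_depths u x.
Proof.
move=> /Gamma1P[A gA ->]; rewrite lt0n height_eq0 // => A0.
have [x Ax] := cusp_coordinates A0.
by exists x; apply: coordinates_depths.
Qed.

(** Multiplication by r turns the horizontal coordinates by a quarter turn, so some power of r leads
    to the closed first quadrant. *)
Lemma near_quadrant (u : PUJ R) : D u -> (0 < height u)%N ->
  exists j x, [/\ (0 <= x.1.1)%R, (0 <= x.1.2)%R & cusp_depths (u * Pr ^+ j) x].
Proof.
move=> /Gamma1P[A gA ->]; rewrite lt0n height_eq0 // => A0.
have [[[x1 x2] x3] Ax] := cusp_coordinates A0.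
have PrX j : Pr ^+ j = PUclass (Ur R ^+ j).
  by elim: j => // j IH; rewrite !expgS PUclassM IH.
have unfr j : Ur R ^+ j = unf R (0, 0, 0, j)%R by rewrite /unf /normal_form /= !mul1g.
suff [j [x [p1 p2 Ajx]]] : exists j x,
    [/\ (0 <= x.1.1)%R, (0 <= x.1.2)%R & has_coordinates (A * Ur R ^+ j) x].
  exists j, x; split=> //; rewrite PrX -PUclassM; apply: coordinates_depths => //.
    by rewrite unfr; apply: gauss_mul (@gauss_unf R _).
  by rewrite unfr corner_unf.
have A1 := coordinates_r Ax; have A2 := coordinates_r A1; have A3 := coordinates_r A2.
case: (lerP 0 x1) => p1; case: (lerP 0 x2) => p2.
- by exists 0%N, (x1, x2, x3); rewrite mulg1.
- exists 3%N, (- x2, - - x1, x3)%R; split.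
  + by rewrite /= oppr_ge0 ltW.
  + by rewrite /= opprK.
  + by rewrite !expgS expg0 mulg1 !mulgA.
- by exists 1%N, (x2, - x1, x3)%R; split=> //=; rewrite oppr_ge0 ltW.
- exists 2%N, (- x1, - x2, x3)%R; split.
  + by rewrite /= oppr_ge0 ltW.
  + by rewrite /= oppr_ge0 ltW.
  + by rewrite expg2 mulgA.
Qed.

Lemma Gamma1M_nf u h : D u -> D (u * nf h).
Proof.
move=> /Gamma1P[A gA ->]; apply/Gamma1P; exists (A * unf R h).
  exact: gauss_mul (@gauss_unf R h).
by rewrite PUclassM PUclass_unf.
Qed.

Lemma Gamma1M_s u : D u -> D (u * Ps).
Proof.
move=> /Gamma1P[A gA ->]; apply/Gamma1P; exists (A * Us R).
  exact: gauss_mul (@gauss_Us R).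
by rewrite PUclassM.
Qed.

Lemma height_nf u h : D u -> height (u * nf h) = height u.
Proof.
move=> /Gamma1P[A gA ->]; rewrite -PUclass_unf -PUclassM.
by apply: height_eq; rewrite ?corner_unf //; apply: gauss_mul (@gauss_unf R h).
Qed.

Lemma Ps_comm : commute Ps Pr.
Proof.
rewrite /commute -!PUclassM.
apply: (@PUclass_eq R _ _ (gmulmx gs gr) (gmulmx gr gs)); last by vm_compute.
  exact: representsM.
exact: representsM.
Qed.

Lemma cusp_geometry_PUJ : cusp_geometry PX PY PZ Pr Ps X' Y' Z' r' D height.
Proof.
split.
- apply/Gamma1P; exists 1 => //; rewrite -[UJmx 1]ofGmx_1.
  exact: gauss_entries_of.
- by move=> g h; apply: Gamma1M_nf.
- exact: Gamma1M_s.
- apply/eqP; rewrite height_eq0.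
    by rewrite /corner -[UJmx 1]ofGmx_1 !mxE.
  by rewrite -[UJmx 1]ofGmx_1; apply: gauss_entries_of.
- by move=> g h; apply: height_nf.
- move=> g /Gamma1P[A gA ->] /eqP; rewrite height_eq0 // => /eqP A0.
  have [h [c e]] := upper_triangular gA A0; exists h.
  by rewrite -PUclass_unf; apply/PUclassP; exists c.
- move=> g /Gamma1P[A gA ->] /eqP; rewrite height_eq0 // => /eqP A0.
  rewrite -PUclassM => /eqP; rewrite height_eq0; last exact: gauss_mul (@gauss_Us R).
  rewrite corner_s => /eqP A2; have [h [c e]] := upper_triangular gA A0.
  have := UJ_neq0 A; rewrite e.
  (* At height 0 the last bottom entry is the scalar c, since that of [unf] is 1; height 0 after s
     would make it vanish. *)
  have : c = 0%R.
    move: A2; rewrite e; case: h {e} => [[[m n] t'] k].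
    pose t : int := (t' - 2 * (m * n))%R.
    have -> : t' = (t + 2 * (m * n))%R by rewrite /t subrK.
    by rewrite unfE !mxE /= mulr1.
  by move=> ->; rewrite scale0r eqxx.
- exact: nf_faithful_PUJ.
- move=> g Dg g0; have [x [_ _ lat _]] := near_coordinates Dg g0.
  have [m [n [t lt1]]] := descending_cusp x.
  by exists (m, n, (t + 2 * (m * n))%R, 0%N); rewrite lat.
- move=> g m n t k Dg g0; have [x [o _ lat _]] := near_coordinates Dg (leq_ltn_trans (leq0n _) g0).
  by move: g0; rewrite o lat; apply: near_indices.
- move=> g Dg g0 m n t far.
  have [x [o _ lat _]] := near_coordinates Dg (leq_ltn_trans (leq0n _) g0).
  by rewrite leqNgt lat -leNgt; apply: apart_cusps far _; rewrite -o.
- move=> g Dg g0; have [x [o _ lat sq]] := near_coordinates Dg (leq_ltn_trans (leq0n _) g0).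
  rewrite o in g0; rewrite (lat 1%R 0%R 1%R 0%N) => K1.
  case: (near_cusps101 g0 K1) => d.
  + by apply: Or41; rewrite -(lat 0%R 0%R 1%R 0%N) in d.
  + by apply: Or42; rewrite -(lat 1%R 0%R 0%R 0%N) in d.
  + by apply: Or43; rewrite -(sq (shear 0 1 (-1)%R) cusp_01N isT) in d.
  + by apply: Or44; rewrite -(sq (shear 1 0 1) cusp_101 isT) in d.
- move=> g Dg g0; have [x [o _ lat sq]] := near_coordinates Dg (leq_ltn_trans (leq0n _) g0).
  rewrite o in g0; rewrite (lat 1%R 1%R 0%R 0%N) => K1.
  case: (near_cusps110 g0 K1) => d.
  + by left; rewrite -(sq (shear 0 1 (-1)%R) cusp_01N isT) in d.
  + by right; rewrite -(sq (shear 1 0 1) cusp_101 isT) in d.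
- move=> g Dg g0; have [x [o _ lat sq]] := near_coordinates Dg (leq_ltn_trans (leq0n _) g0).
  by move: g0; rewrite o !lat; apply: near_cusps112.
- move=> g Dg g0; have [x [o _ lat sq]] := near_coordinates Dg (leq_ltn_trans (leq0n _) g0).
  by move: g0; rewrite o !lat; apply: near_cusps102.
- move=> g Dg g0; have [x [o _ lat sq]] := near_coordinates Dg (leq_ltn_trans (leq0n _) g0).
  by move: g0; rewrite o !lat; apply: near_cusps111.
- move=> g Dg g0 gs; have [j [x [p1 p2 [_ o lat sq]]]] := near_quadrant Dg g0.
  have hj : height (g * Pr ^+ j) = height g.
    have -> : Pr ^+ j = nf (0, 0, 0, j)%R by rewrite /normal_form /= !mul1g.
    exact: height_nf.
  have o1 : depth origin x = 1%R.
    apply: o; rewrite hj -gs.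
    have -> : g * Pr ^+ j * Ps = g * Ps * nf (0, 0, 0, j)%R.
      rewrite /normal_form /= !mul1g -!mulgA; congr (_ * _).
      apply/commute_sym/commuteX.
      exact: Ps_comm.
    by apply: height_nf; apply: Gamma1M_s.
  exists j => /=; have [[h hin hx]|[h hin [hx hx']]] := tie_cusps o1 p1 p2.
    left; exists (shear h.1.1 h.1.2 h.2); split.
      by move: hin; rewrite !inE => /or4P[/eqP-> | /eqP-> | /eqP-> | /or3P[/eqP-> | /eqP-> | /eqP->]].
    by rewrite -hj lat.
  right; exists (shear h.1.1.1 h.1.1.2 h.1.2).
  (* The translation by which the vertex [h.2] of the square is reached from the other end of the
     edge. *)
  exists (if h.2 == cusp_01N then shear 0 1 (-1)%R else
          if h.2 == cusp_101 then shear 1 0 1 else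
          if h.2 == cusp_10N then shear 1 0 (-1)%R else shear 0 (-1)%R 1).
  rewrite -{1 2}hj lat; split.
    by move: hin; rewrite !inE => /or4P[] /eqP->.
  split=> //; move: hin hx'; rewrite !inE => /or4P[] /eqP-> hx'.
  - by rewrite (sq (shear 0 1 (-1)%R) cusp_01N isT).
  - by rewrite (sq (shear 1 0 1) cusp_101 isT).
  - by rewrite (sq (shear 1 0 (-1)%R) cusp_10N isT).
  - by rewrite (sq (shear 0 (-1)%R 1) cusp_0N1 isT).
Qed.

End Geometry.
End CuspGroup.

(** * The presented group *)

Lemma picard_relations_morph (G H : groupType) (phi : G -> H) X Y Z r s :
  {morph phi : x y / x * y} -> picard_relations X Y Z r s ->
  picard_relations (phi X) (phi Y) (phi Z) (phi r) (phi s).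
Proof.
move=> phiM [[? ? ? ? ? ? ?] ? ? ? ? ? ? ? ?].
have [phi1 phiV phiX] := morph_group phiM.
by split; first split; rewrite -?(phiM, phiV, phiX, phi1); congr phi.
Qed.

Section Presentation.
Local Open Scope group_scope.

Definition picard_relators : seq (word 2 * word 2) :=
  let a : word 2 := letter ord0 in
  let b : word 2 := letter ord_max in
  let r := a ^- 2 * b ^- 3 * a ^+ 2 in
  let s := a * b * a ^- 2 * b * a ^+ 2 * b^-1 in
  let t := a^-1 * b ^+ 2 * a ^+ 2 * b^-1 in
  let u := a ^+ 2 in
  let v := a * b * a ^- 2 * b * a ^+ 2 * b^-1 in
  let w := a * b * a ^- 2 * b ^- 2 in
  [:: (a ^+ 8, 1); (b ^+ 12, 1); (r ^+ 4, 1); (s ^+ 2, 1); (t ^+ 2, 1);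
      (u ^+ 4, 1); (v ^+ 2, 1); (w ^+ 2, 1);
      braid 2 r s; braid 4 t u; braid 3 v w;
      braid 2 (a ^+ 2) (b * a ^+ 2 * b^-1)].

Local Notation P := (presented picard_relators).
Local Notation pi := (quotg_pi (rel_cong picard_relators)).
Local Notation wa := (letter (ord0 : 'I_2)).
Local Notation wb := (letter (ord_max : 'I_2)).

Definition pres_a : P := pi wa.
Definition pres_b : P := pi wb.

Lemma piM v w : pi (v * w) = (pi v : P) * pi w.
Proof. exact: quotg_piM. Qed.

Lemma piV v : pi v^-1 = (pi v : P)^-1.
Proof. exact: quotg_piV. Qed.

Lemma pi1 : pi 1 = 1 :> P.
Proof. by []. Qed.

Lemma piX v n : pi (v ^+ n) = (pi v : P) ^+ n.
Proof. by elim: n => [|n IH]; rewrite ?pi1 // !expgS piM IH. Qed.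

Lemma pi_relator i : (i < 12)%N -> let e := nth (1, 1) picard_relators i in
  pi e.1 = pi e.2 :> P.
Proof.
move=> i12; apply/presented_eqP/rel_eq_rel; rewrite -surjective_pairing.
exact: mem_nth.
Qed.

Lemma pres_picard :
  [/\ picard_relations (gen_X pres_a pres_b) (gen_Y pres_a pres_b)
        (gen_Z pres_a pres_b) (gen_r pres_a pres_b) (gen_s pres_a pres_b),
      pres_a = gen_s pres_a pres_b * gen_X pres_a pres_b
        * gen_r pres_a pres_b ^+ 2 * gen_s pres_a pres_b * gen_Z pres_a pres_b
        * gen_s pres_a pres_b
    & pres_b = gen_s pres_a pres_b * gen_X pres_a pres_b
        * gen_r pres_a pres_b ^+ 2 * gen_s pres_a pres_b
        * (gen_Z pres_a pres_b)^-1].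
Proof.
have rel i e : nth (1, 1) picard_relators i = e -> (i < 12)%N -> pi e.1 = pi e.2 :> P.
  by move=> <- /pi_relator.
apply: gen_picard_relations.
- by have := rel 0%N _ erefl isT; rewrite !(piM, piV, piX).
- by have := rel 2%N _ erefl isT; rewrite !(piM, piV, piX).
- by have := rel 3%N _ erefl isT; rewrite !(piM, piV, piX).
- by have := rel 7%N _ erefl isT; rewrite !(piM, piV, piX).
- by have := rel 8%N _ erefl isT; rewrite /= !(piM, piV, piX, pi1) !mulg1.
- by have := rel 10%N _ erefl isT; rewrite /= !(piM, piV, piX, pi1) !mulg1 !mulgA.
- by have := rel 11%N _ erefl isT; rewrite /= !(piM, piV, piX, pi1) !mulg1.
Qed.

(** * Evaluation of words at the two matrices *)

Section Evaluation.
Variable R : realType.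

Definition UJ_letter (x : 'I_2 * bool) : UJ R :=
  let A := if x.1 == ord0 then UJ_a R else UJ_b R in if x.2 then A^-1 else A.

Definition UJ_word (w : word 2) : UJ R := foldr (fun x A => UJ_letter x * A) 1 w.

Definition gletter (x : 'I_2 * bool) : gmx :=
  let A := if x.1 == ord0 then ga else gb in if x.2 then ginv A else A.

Definition gword (w : word 2) : gmx := foldr (fun x A => gmulmx (gletter x) A) g1 w.

Lemma UJ_word_represents w : represents (UJ_word w) (gword w).
Proof.
elim: w => [|[i e] w IH] /=; first exact: represents1.
apply: representsM => //; rewrite /UJ_letter /gletter /=.
have ra : represents (UJ_a R) ga by rewrite /represents ofGmx_a.
have rb : represents (UJ_b R) gb by rewrite /represents ofGmx_b.
by case: (i == ord0); case: e => //; apply: representsV.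
Qed.

Lemma UJ_wordM v w : UJ_word (v * w) = UJ_word v * UJ_word w.
Proof. by elim: v => [|x v IH] /=; rewrite ?mul1g // -mulgA -IH. Qed.

Lemma UJ_wordV (w : word 2) : UJ_word w^-1 = (UJ_word w)^-1.
Proof.
elim: w => [|x w IH]; first by rewrite /= invg1.
have -> : (x :: w : word 2)^-1 = (w : word 2)^-1 * ([:: (x.1, ~~ x.2)] : word 2).
  exact: (@word_invM 2 [:: x] w).
rewrite UJ_wordM IH /= mulg1 invgM; congr (_ * _).
by rewrite /UJ_letter /=; case: x.2 => //=; rewrite invgK.
Qed.

Definition PUJ_word (w : word 2) : PUJ R := PUclass (UJ_word w).

(** In U(J) the relations are checked up to a unit of Z[i], which is enough in PU(J). *)
Lemma picard_relators_hold :
  all (fun e => gproportional (gword e.1) (gword e.2)) picard_relators.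
Proof. by vm_compute. Qed.

Lemma PUJ_word_rel v w : rel_eq picard_relators v w -> PUJ_word v = PUJ_word w.
Proof.
elim=> {v w} [v w vw|w|v v' w w' _ vv' _ ww'|//|v w _ ->|u v w _ -> _ ->] //.
- apply: PUclass_eq (UJ_word_represents v) (UJ_word_represents w) _.
  exact: (allP picard_relators_hold _ vw).
- by rewrite /PUJ_word UJ_wordM UJ_wordV mulVg.
- by rewrite /PUJ_word !UJ_wordM !PUclassM -!/(PUJ_word _) vv' ww'.
Qed.

Definition PUJ_eval (u : P) : PUJ R := PUJ_word (repr u).

Lemma PUJ_eval_pi w : PUJ_eval (pi w) = PUJ_word w.
Proof. by apply: PUJ_word_rel; apply/presented_eqP; apply: quotg_piK. Qed.

Lemma PUJ_evalM : monoid_morphism PUJ_eval.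
Proof.
split=> [|u v]; first exact: PUJ_eval_pi.
rewrite -(quotg_piK u) -(quotg_piK v) -piM !PUJ_eval_pi.
by rewrite /PUJ_word UJ_wordM PUclassM.
Qed.

HB.instance Definition _ := isUMagmaMorphism.Build P (PUJ R) PUJ_eval PUJ_evalM.

End Evaluation.
End Presentation.

Lemma gen_morph (G H : groupType) (phi : G -> H) a b :
  {morph phi : x y / x * y} ->
  [/\ phi (gen_r a b) = gen_r (phi a) (phi b),
      phi (gen_s a b) = gen_s (phi a) (phi b),
      phi (gen_Z a b) = gen_Z (phi a) (phi b),
      phi (gen_X a b) = gen_X (phi a) (phi b)
    & phi (gen_Y a b) = gen_Y (phi a) (phi b)].
Proof.
move=> phiM; have [_ phiV phiX] := morph_group phiM.
by split; rewrite /gen_Y /gen_X /gen_r /gen_s /gen_Z !(phiM, phiV, phiX).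
Qed.

(** Both generators are products of stabilizer elements and s; inverses are covered because
    stabilizer elements have inverses in normal form and s is an involution. *)
Lemma cusp_closed_generators (G : groupType) (X Y Z r s a b : G) (Q : G -> Prop) :
  picard_relations X Y Z r s ->
  (forall u h, Q u -> Q (u * normal_form X Y Z r h)) ->
  (forall u, Q u -> Q (u * s)) ->
  a = s * X * r ^+ 2 * s * Z * s -> b = s * X * r ^+ 2 * s * Z^-1 ->
  [/\ forall u, Q u -> Q (u * a), forall u, Q u -> Q (u * a^-1),
      forall u, Q u -> Q (u * b) & forall u, Q u -> Q (u * b^-1)].
Proof.
move=> pic Qnf Qs -> ->.
have heis : heisenberg_relations X Y Z r := pic.
have sV : s^-1 = s := mulg1_eq (picard_ss pic).
have eXr : X * r ^+ 2 = normal_form X Y Z r (1, 0, 0, 2)%R.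
  by rewrite /normal_form /= expg1 !mulg1.
have eZ : Z = normal_form X Y Z r (0, 0, 1, 0)%R.
  by rewrite /normal_form /= expg1 !mulg1 !mul1g.
have QV u h : Q u -> Q (u * (normal_form X Y Z r h)^-1).
  by rewrite -(normal_formV heis); apply: Qnf.
have QX u : Q u -> Q (u * (X * r ^+ 2)) by rewrite eXr; apply: Qnf.
have QXV u : Q u -> Q (u * (X * r ^+ 2)^-1) by rewrite eXr; apply: QV.
have QZ u : Q u -> Q (u * Z) by rewrite eZ; apply: Qnf.
have QZV u : Q u -> Q (u * Z^-1) by rewrite eZ; apply: QV.
rewrite -(mulgA s X); move: (X * r ^+ 2) QX QXV => g Qg QgV.
by split=> u Qu; rewrite ?invgM ?invgK ?sV ?mulgA;
  do ?[apply: (Qs) | apply: (Qg) | apply: (QgV) | apply: (QZ) | apply: (QZV)].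
Qed.

(** * The isomorphism from the presented group onto Gamma_1 *)

Section MainTheorem.
Variable R : realType.
Local Notation P := (presented picard_relators).
Local Notation pi := (quotg_pi (rel_cong picard_relators)).
Local Notation a := (PUclass (UJ_a R)).
Local Notation b := (PUclass (UJ_b R)).
Local Notation Xp := (gen_X pres_a pres_b).
Local Notation Yp := (gen_Y pres_a pres_b).
Local Notation Zp := (gen_Z pres_a pres_b).
Local Notation rp := (gen_r pres_a pres_b).
Local Notation sp := (gen_s pres_a pres_b).
Local Notation PX := (PUclass (UX R)).
Local Notation PY := (PUclass (UY R)).
Local Notation PZ := (PUclass (UZ R)).
Local Notation Pr := (PUclass (Ur R)).
Local Notation Ps := (PUclass (Us R)).

Lemma gen_PUJ :
  [/\ gen_r a b = Pr, gen_s a b = Ps, gen_Z a b = PZ, gen_X a b = PX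
    & gen_Y a b = PY].
Proof.
have ra : represents (UJ_a R) ga by rewrite /represents ofGmx_a.
have rb : represents (UJ_b R) gb by rewrite /represents ofGmx_b.
have [<- <- <- <- <-] := gen_morph (UJ_a R) (UJ_b R) (@PUclassM R).
rewrite /gen_Y /gen_X /gen_Z /gen_r /gen_s !(expgS, expg0, mulg1).
split; (eapply PUclass_eq;
  [repeat first [exact: ra | exact: rb | apply: representsM | apply: representsV]
  | exact: erefl | by vm_compute]).
Qed.

Lemma PUJ_eval_mul : {morph PUJ_eval R : u v / u * v}.
Proof. exact: gmulfM. Qed.

Lemma PUJ_eval_gens : PUJ_eval R pres_a = a /\ PUJ_eval R pres_b = b.
Proof. by rewrite !PUJ_eval_pi /PUJ_word /= !mulg1. Qed.

Lemma PUJ_eval_gen :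
  [/\ PUJ_eval R rp = Pr, PUJ_eval R sp = Ps, PUJ_eval R Zp = PZ,
      PUJ_eval R Xp = PX & PUJ_eval R Yp = PY].
Proof.
have [-> -> -> -> ->] := gen_morph pres_a pres_b PUJ_eval_mul.
by have [-> ->] := PUJ_eval_gens; apply: gen_PUJ.
Qed.

(** The relations derived in P are transported along [PUJ_eval], once the generators are matched. *)
Lemma picard_PUJ : picard_relations PX PY PZ Pr Ps.
Proof.
have [pic _ _] := pres_picard; have [<- <- <- <- <-] := PUJ_eval_gen.
exact: picard_relations_morph PUJ_eval_mul pic.
Qed.

Lemma PUJ_eval_nf h :
  PUJ_eval R (normal_form Xp Yp Zp rp h) = normal_form PX PY PZ Pr h.
Proof.
rewrite (normal_form_morph _ _ _ _ _ PUJ_eval_mul).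
by have [-> _ -> -> ->] := PUJ_eval_gen.
Qed.

Lemma presented_cusp_ind (Q : P -> Prop) :
  Q 1 -> (forall u h, Q u -> Q (u * normal_form Xp Yp Zp rp h)) ->
  (forall u, Q u -> Q (u * sp)) -> forall u, Q u.
Proof.
have [pic ea eb] := pres_picard; move=> Q1 Qnf Qs.
have [Qa QaV Qb QbV] := cusp_closed_generators pic Qnf Qs ea eb.
(* Removing the last letter matches closure under right multiplication. *)
move=> u; rewrite -(quotg_piK u); elim/last_ind: (repr u) => // w [i e] IH.
rewrite -cats1 piM.
have [->|->] : i = ord0 \/ i = ord_max.
  by case: i => [[|[|//]] i2]; [left|right]; apply: val_inj.
- by case: e; [have -> : [:: (ord0, true)] = (letter ord0 : word 2)^-1 by [];
    rewrite piV; apply: QaV | apply: Qa].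
- by case: e; [have -> : [:: (ord_max, true)] = (letter ord_max : word 2)^-1 by [];
    rewrite piV; apply: QbV | apply: Qb].
Qed.

Lemma PUJ_eval_injective : injective (PUJ_eval R).
Proof.
have [pic _ _] := pres_picard; have [_ es _ _ _] := PUJ_eval_gen.
exact: (descent_injective picard_PUJ pic
  (cusp_geometry_PUJ R Xp Yp Zp (heis_r4 pic)) presented_cusp_ind PUJ_eval_nf es).
Qed.

Lemma PUJ_eval_range : range (PUJ_eval R) = Gamma1 R.
Proof.
have [pic _ _] := pres_picard; have [_ es _ _ _] := PUJ_eval_gen.
have geo := cusp_geometry_PUJ R Xp Yp Zp (heis_r4 pic).
apply/seteqP; split=> [_ [u _ <-]|g Dg].
  by have := domf geo presented_cusp_ind PUJ_eval_nf es u (dom1 geo); rewrite mul1g.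
by have [u <-] := descent_surjective picard_PUJ geo PUJ_eval_nf es Dg; exists u.
Qed.

(** The range of the evaluation is a group containing both classes; conversely any group containing
    them contains the value of every word. *)
Lemma Gamma1_generated : generated [set a; b] = Gamma1 R.
Proof.
have [ea eb] := PUJ_eval_gens.
apply/seteqP; split.
  rewrite -PUJ_eval_range; apply: smallest_sub.
    split=> [|_ _ /set_mem[u _ <-] /set_mem[v _ <-]]; apply/mem_set.
      by exists 1; rewrite ?gmulf1.
    by exists (u / v); rewrite ?gmulfF.
  by move=> _ [] ->; [exists pres_a | exists pres_b].
rewrite -PUJ_eval_range => _ [u _ <-] K [[K1 KV] abK].
have {}KV v w : K v -> K w -> K (v / w).
  by move=> /mem_set Kv /mem_set Kw; apply/set_mem/KV.
have {}K1 : K 1 by exact: set_mem.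
have KVl v : K v -> K v^-1 by rewrite -[v^-1]mul1g; apply: KV.
have KM v w : K v -> K w -> K (v * w).
  by move=> Kv /KVl Kw; rewrite -[w]invgK; apply: KV.
rewrite -(quotg_piK u) PUJ_eval_pi; elim: (repr u) => [|x w IH]; first exact: K1.
rewrite /PUJ_word /= PUclassM; apply: KM => //.
have PV A : PUclass (A^-1) = (PUclass A)^-1 := @quotg_piV _ (scalar_cong R) A.
by rewrite /UJ_letter; case: (x.1 == ord0); case: x.2 => /=;
  rewrite ?PV; try apply: KVl; apply: abK; [left|left|right|right].
Qed.

End MainTheorem.

Theorem mainTheorem13 (R : realType) :
  generated [set PUclass (UJ_a R); PUclass (UJ_b R)] = Gamma1 R /\
  let a : word 2 := letter ord0 in
  let b : word 2 := letter ord_max in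
  let r := a ^- 2 * b ^- 3 * a ^+ 2 in
  let s := a * b * a ^- 2 * b * a ^+ 2 * b^-1 in
  let t := a^-1 * b ^+ 2 * a ^+ 2 * b^-1 in
  let u := a ^+ 2 in
  let v := a * b * a ^- 2 * b * a ^+ 2 * b^-1 in
  let w := a * b * a ^- 2 * b ^- 2 in
  has_presentation (Gamma1 R) [tuple PUclass (UJ_a R); PUclass (UJ_b R)]
    [:: (a ^+ 8, 1); (b ^+ 12, 1); (r ^+ 4, 1); (s ^+ 2, 1); (t ^+ 2, 1);
        (u ^+ 4, 1); (v ^+ 2, 1); (w ^+ 2, 1);
        braid 2 r s; braid 4 t u; braid 3 v w;
        braid 2 (a ^+ 2) (b * a ^+ 2 * b^-1)].
Proof.
split; first exact: Gamma1_generated.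
move=> a b r s t u v w.
(* [picard_relators] unfolds to the list of relations in the statement. *)
exists (PUJ_eval R : {multiplicative presented picard_relators -> PUJ R}).
split; [exact: PUJ_eval_injective | exact: PUJ_eval_range |].
have [ea eb] := PUJ_eval_gens R.
by case=> [[|[|//]] i2]; [rewrite -[RHS]ea | rewrite -[RHS]eb];
  congr (PUJ_eval R (quotg_pi _ (letter _))); apply: val_inj.
Qed.
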